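(* Let $l$ be a fixed constant. There is an algorithm (a dynamic program over all subtrees of $T$) that solves Problem A on any tree network $T$ with $n$ vertices and at most $l$ leaves in $O(n^{l+2})$ time.
   Context: Problem A on a tree. Given: a tree $T=(V,E)$ with $|V|=n$; a length $c_e>0$ for each edge $e\in E$; and a nonnegative weight $w_{\{u,v\}}$ for each unordered pair of vertices, with $w_{\{v,v\}}=0$. A pair with positive weight is a relevant pair (r-pair); $\mathcal R$ denotes the set of r-pairs. An s-sequence is an ordering $(e_1,\dots,e_{n-1})$ of all edges of $T$. Edge $e_k$ is completed at time $\sum_{j\le k}c_{e_j}$. The connection time $t_{\{u,v\}}$ is the completion time of the last-built edge of the unique $u$–$v$ path $P(u,v)$ in $T$. The task is to find an s-sequence minimizing $\sum_{\{u,v\}\in\mathcal R}w_{\{u,v\}}t_{\{u,v\}}$. A leaf is a vertex of degree $1$. *)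

(* Defs.v *)
From HB Require Import structures.
From mathcomp Require Import all_boot all_order all_algebra.
From mathcomp Require Import fingroup perm.
From mathcomp Require Export reals.
Set Implicit Arguments. Unset Strict Implicit. Unset Printing Implicit Defensive.
Import Order.TTheory GRing.Theory Num.Theory.
Local Open Scope ring_scope.

Definition adj (n : nat) (ends : 'I_n.-1 -> 'I_n * 'I_n) : rel 'I_n :=
  fun u v => [exists e, (ends e == (u, v)) || (ends e == (v, u))].

(* T = (V,E) with |V| = n and |E| = n-1 (edges indexed by 'I_n.-1) is a tree:
   n >= 1 and it is connected (connected with n-1 edges <=> tree). *)
Definition is_tree (n : nat) (ends : 'I_n.-1 -> 'I_n * 'I_n) : bool :=
  (0 < n)%N && [forall u, forall v, connect (adj ends) u v].

Definition degree (n : nat) (ends : 'I_n.-1 -> 'I_n * 'I_n) (v : 'I_n) : nat :=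
  #|[set e | ((ends e).1 == v) || ((ends e).2 == v)]|.

Definition nleaves (n : nat) (ends : 'I_n.-1 -> 'I_n * 'I_n) : nat :=
  #|[set v | degree ends v == 1%N]|.

Definition edge_in (n : nat) (ends : 'I_n.-1 -> 'I_n * 'I_n) (e : 'I_n.-1)
  (u : 'I_n) (q : seq 'I_n) : bool :=
  has (fun xy => (ends e == xy) || (ends e == (xy.2, xy.1))) (zip (u :: q) q).

(* e lies on the (unique) simple u-v path P(u,v) of T.  A simple path has at
   most n vertices, so it is [u :: take k p] for some k <= n and n-tuple p. *)
Definition on_path (n : nat) (ends : 'I_n.-1 -> 'I_n * 'I_n) (e : 'I_n.-1)
  (u v : 'I_n) : bool :=
  [exists k : 'I_n.+1, exists p : n.-tuple 'I_n,
     let q := take k p in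
     [&& uniq (u :: q), path (adj ends) u q, last u q == v & edge_in ends e u q]].

(* An s-sequence is a permutation sigma: position j |-> edge sigma j.
   Completion time of edge e. *)
Definition completion (R : realType) (n : nat) (c : 'I_n.-1 -> R)
  (sigma : {perm 'I_n.-1}) (e : 'I_n.-1) : R :=
  \sum_(j : 'I_n.-1 | (j <= (sigma^-1)%g e)%N) c (sigma j).

Definition conn_time (R : realType) (n : nat) (ends : 'I_n.-1 -> 'I_n * 'I_n)
  (c : 'I_n.-1 -> R) (sigma : {perm 'I_n.-1}) (u v : 'I_n) : R :=
  \big[Num.max/0]_(e | on_path ends e u v) completion c sigma e.

Definition objective (R : realType) (n : nat) (ends : 'I_n.-1 -> 'I_n * 'I_n)
  (c : 'I_n.-1 -> R) (w : 'I_n -> 'I_n -> R) (sigma : {perm 'I_n.-1}) : R :=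
  \sum_(u : 'I_n) \sum_(v : 'I_n | (u < v)%N && (0 < w u v))
     w u v * conn_time ends c sigma u v.

Definition optimal (R : realType) (n : nat) (ends : 'I_n.-1 -> 'I_n * 'I_n)
  (c : 'I_n.-1 -> R) (w : 'I_n -> 'I_n -> R) (sigma : {perm 'I_n.-1}) : Prop :=
  forall sigma' : {perm 'I_n.-1}, objective ends c w sigma <= objective ends c w sigma'.

(* Cost = number of executed commands (including loop tests); each    *)
(* command contains a fixed, program-bounded number of operations.     *)

Inductive nexp : Type :=
| NLit (k : nat)
| NVar (x : nat)
| NRead (a : nat) (i : nexp)
| NPlus (e1 e2 : nexp)
| NMinus (e1 e2 : nexp).

Inductive rexp : Type :=
| RLit (k : nat)
| RRead (a : nat) (i : nexp)
| RPlus (r1 r2 : rexp)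
| RMinus (r1 r2 : rexp)
| RTimes (r1 r2 : rexp).

Inductive bexp : Type :=
| BTrue
| BNLt (e1 e2 : nexp)
| BNEq (e1 e2 : nexp)
| BRLt (r1 r2 : rexp)
| BRLe (r1 r2 : rexp)
| BNot (b : bexp)
| BAnd (b1 b2 : bexp).

Inductive cmd : Type :=
| CSkip
| CNSet (x : nat) (e : nexp)
| CNWrite (a : nat) (i e : nexp)
| CRWrite (a : nat) (i : nexp) (r : rexp)
| CSeq (c1 c2 : cmd)
| CIf (b : bexp) (c1 c2 : cmd)
| CWhile (b : bexp) (c : cmd).

Record state (R : Type) := State {
  nvar : nat -> nat;
  narr : nat -> nat -> nat;
  rarr : nat -> nat -> R }.

Definition upd (T : Type) (f : nat -> T) (x : nat) (v : T) : nat -> T :=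
  fun y => if y == x then v else f y.

Section Semantics.
Variable R : realType.

Fixpoint neval (s : state R) (e : nexp) : nat :=
  match e with
  | NLit k => k
  | NVar x => nvar s x
  | NRead a i => narr s a (neval s i)
  | NPlus e1 e2 => (neval s e1 + neval s e2)%N
  | NMinus e1 e2 => (neval s e1 - neval s e2)%N
  end.

Fixpoint reval (s : state R) (r : rexp) : R :=
  match r with
  | RLit k => k%:R
  | RRead a i => rarr s a (neval s i)
  | RPlus r1 r2 => reval s r1 + reval s r2
  | RMinus r1 r2 => reval s r1 - reval s r2
  | RTimes r1 r2 => reval s r1 * reval s r2
  end.

Fixpoint beval (s : state R) (b : bexp) : bool :=
  match b with
  | BTrue => true
  | BNLt e1 e2 => (neval s e1 < neval s e2)%N
  | BNEq e1 e2 => neval s e1 == neval s e2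
  | BRLt r1 r2 => reval s r1 < reval s r2
  | BRLe r1 r2 => reval s r1 <= reval s r2
  | BNot b => ~~ beval s b
  | BAnd b1 b2 => beval s b1 && beval s b2
  end.

Inductive exec : cmd -> state R -> nat -> state R -> Prop :=
| ExSkip s : exec CSkip s 1 s
| ExNSet x e s :
    exec (CNSet x e) s 1 (State (upd (nvar s) x (neval s e)) (narr s) (rarr s))
| ExNWrite a i e s :
    exec (CNWrite a i e) s 1
      (State (nvar s) (upd (narr s) a (upd (narr s a) (neval s i) (neval s e))) (rarr s))
| ExRWrite a i r s :
    exec (CRWrite a i r) s 1
      (State (nvar s) (narr s) (upd (rarr s) a (upd (rarr s a) (neval s i) (reval s r))))
| ExSeq c1 c2 s s1 s2 k1 k2 :
    exec c1 s k1 s1 -> exec c2 s1 k2 s2 -> exec (CSeq c1 c2) s (k1 + k2).+1 s2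
| ExIfT b c1 c2 s s' k :
    beval s b -> exec c1 s k s' -> exec (CIf b c1 c2) s k.+1 s'
| ExIfF b c1 c2 s s' k :
    ~~ beval s b -> exec c2 s k s' -> exec (CIf b c1 c2) s k.+1 s'
| ExWhileF b c s : ~~ beval s b -> exec (CWhile b c) s 1 s
| ExWhileT b c s s1 s2 k1 k2 :
    beval s b -> exec c s k1 s1 -> exec (CWhile b c) s1 k2 s2 ->
    exec (CWhile b c) s (k1 + k2).+1 s2.

End Semantics.

(* Input encoding:
   nvar 0 = n;
   narr 0 (2i) = first endpoint of edge i, narr 0 (2i+1) = second endpoint;
   rarr 0 i = c_i (length of edge i);
   rarr 1 (u*n+v) = w_{u,v};
   everything else 0. *)
Definition init_state (R : realType) (n : nat) (ends : 'I_n.-1 -> 'I_n * 'I_n)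
  (c : 'I_n.-1 -> R) (w : 'I_n -> 'I_n -> R) : state R :=
  State
    (fun x => if x == 0%N then n else 0%N)
    (fun a i => if a == 0%N then
        oapp (fun e : 'I_n.-1 => nat_of_ord (if odd i then (ends e).2 else (ends e).1)) 0%N
             (insub i./2)
      else 0%N)
    (fun a i => if a == 0%N then oapp (fun e : 'I_n.-1 => c e) 0 (insub i)
      else if a == 1%N then
        oapp (fun u : 'I_n => oapp (fun v : 'I_n => w u v) 0 (insub (i %% n)%N))
             0 (insub (i %/ n)%N)
      else 0).

(* Main.v *)
(* Let g(A) be the total weight of the pairs whose path lies in the edge set A.
   The cost of an s-sequence is the sum over its edges of the length times the
   weight not yet collected, and g is supermodular.  If e is the last edge, the
   rest of the sequence interleaves orderings of the two parts of the tree minus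
   e, on which g is additive.

   Optimal orderings of the parts can be merged optimally without looking back.
   By supermodularity, an optimal ordering has, for every mu, a prefix maximizing
   g - mu c among all edge sets.  Hence the least concave majorant of its curve
   (elapsed length, collected weight) dominates that of any other ordering of the
   same part, and the mutual delay of two orderings, at least
   sum c_x c_y min(lam_x, lam_y) for the slopes lam of their majorants, is attained
   by merging them by decreasing slope, in linear time.

   A subtree of a tree with at most l leaves is spanned by an l-tuple of vertices,
   and removing an edge from it leaves the spans of two projected l-tuples.  The
   n^l tuples are solved by increasing number of spanned edges; each tries at most
   n last edges, with O(n) work per edge. *)

Require Import Defs.
From HB Require Import structures.
From mathcomp Require Import all_boot all_order all_algebra.
From mathcomp Require Import fingroup perm.
From mathcomp Require Import reals.
From mathcomp Require Import zify ring lra.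
Import Order.TTheory GRing.Theory Num.Theory.
Local Open Scope ring_scope.
Set Implicit Arguments. Unset Strict Implicit. Unset Printing Implicit Defensive.

(** * Sequencing with a supermodular reward *)

Section Sequencing.
Variables (R : realType) (E : finType) (c : E -> R).
Hypothesis c_gt0 : forall e, 0 < c e.

Implicit Types (r : seq E) (P A B : {set E}) (w lam : E -> R).

Fixpoint wcost w r : R :=
  if r is e :: r' then c e * (\sum_(x <- r) w x) + wcost w r' else 0.

(* Up to the constant [c(A) * g A], the cost of an ordering of [A] under the
   reward [g]; it makes sense for a [g] that is not monotone. *)
Fixpoint pcost (g : {set E} -> R) P r : R :=
  if r is e :: r' then - (c e * g P) + pcost g (e |: P) r' else 0.

Definition ordering A r := uniq r /\ [set x in r] = A.

Definition opt_ordering g A r :=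
  ordering A r /\
  forall r', ordering A r' -> pcost g set0 r <= pcost g set0 r'.

Definition supermodular (g : {set E} -> R) :=
  forall A B, g A + g B <= g (A :|: B) + g (A :&: B).

Lemma pcost_cat g P r1 r2 :
  pcost g P (r1 ++ r2) = pcost g P r1 + pcost g (P :|: [set x in r1]) r2.
Proof.
elim: r1 P => [|e r1 IH] P /=.
  by rewrite add0r; congr (pcost g _ r2); apply/setP=> x; rewrite !inE orbF.
rewrite IH addrA; congr (_ + pcost g _ r2).
by apply/setP=> x; rewrite !inE; case: (x == e); case: (x \in P).
Qed.

Lemma pcost_split h A B P r :
  supermodular h -> B \subset A -> (forall B', B' \subset A -> h B' <= h B) ->
  P \subset A -> {subset r <= A} ->
  pcost h (P :&: B) [seq x <- r | x \in B] +
  pcost h (P :|: B) [seq x <- r | x \notin B] <= pcost h P r.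
Proof.
move=> smh sBA maxB; elim: r P => [|e r IH] P sPA srA /=; first by rewrite addr0.
have eA : e \in A by apply: srA; rewrite inE eqxx.
have srA' : {subset r <= A} by move=> x xr; apply: srA; rewrite inE xr orbT.
have sePA : e |: P \subset A by rewrite subUset sub1set eA.
have := IH _ sePA srA'; have /= := smh P B.
have := maxB (P :|: B); rewrite subUset sPA sBA => /(_ isT) hU.
have := maxB (P :&: B); rewrite subIset ?sPA // => /(_ isT) hI hsm.
have ce := c_gt0 e.
case: ifP => eB /=.
  have -> : (e |: P) :&: B = e |: (P :&: B).
    by apply/setP=> x; rewrite !inE; case: eqP => // ->; rewrite eB.
  have -> : (e |: P) :|: B = P :|: B.
    by apply/setP=> x; rewrite !inE; case: eqP => [->|_]; rewrite ?eB ?orbT.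
  have : c e * h P <= c e * h (P :&: B) by rewrite ler_pM2l //; lra.
  lra.
have -> : (e |: P) :&: B = P :&: B.
  by apply/setP=> x; rewrite !inE; case: eqP => // ->; rewrite eB !andbF.
have -> : (e |: P) :|: B = e |: (P :|: B).
  by apply/setP=> x; rewrite !inE orbA.
have : c e * h P <= c e * h (P :|: B) by rewrite ler_pM2l //; lra.
lra.
Qed.

(* If [B] maximizes [h] and [p] is the longest prefix inside [B], moving the
   rest of [B] right after [p] does not increase the cost, and changes it by at
   least [c x * (h p - h B)], where [x] is the first element outside [B]. *)
Lemma opt_prefix_max h A r :
  supermodular h -> opt_ordering h A r ->
  exists k, forall B, B \subset A -> h B <= h [set x in take k r].
Proof.
move=> smh [[ur rA] optr].
have [B sBA maxB] : exists2 B : {set E}, B \subset A & forall B' : {set E}, B' \subset A -> h B' <= h B.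
  have [B sB mB] := arg_maxP h (sub0set A : (fun B : {set E} => B \subset A) set0).
  by exists B => // B' sB'; apply: mB.
case: (boolP (all [in B] r)) => [/allP allB|].
  exists (size r) => B' sB'; rewrite take_size rA.
  suff -> : A = B by apply: maxB.
  apply/eqP; rewrite eqEsubset sBA andbT.
  by apply/subsetP => x; rewrite -rA inE => /allB.
rewrite -has_predC => hasr; set k := find (predC [in B]) r.
exists k => B' sB'; apply: le_trans (maxB _ sB') _.
have ksz : (k < size r)%N by rewrite -has_find.
case: r => [//|x0 r0] in ur rA optr hasr k ksz *; set r := x0 :: r0 in ur rA optr hasr k ksz *.
set x := nth x0 r k; set s := drop k.+1 r; set p := take k r.
have def_r : r = p ++ x :: s by rewrite /x /s -drop_nth // cat_take_drop.
have xB : x \notin B by apply: (nth_find x0 hasr).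
have pB : {subset p <= B}.
  move=> y /(nthP x0)[i]; rewrite size_take ksz => ik <-.
  rewrite nth_take //; apply/negPn.
  by have /= -> := before_find x0 ik.
have xsA : {subset s <= A}.
  by move=> y ys; rewrite -rA inE def_r mem_cat inE ys !orbT.
have xA : x \in A by rewrite -rA inE def_r mem_cat inE eqxx orbT.
have urc := ur; rewrite def_r in urc.
move: ur; rewrite def_r cat_uniq => /and3P[up /hasPn pxs /= /andP[xs us]].
pose r' := p ++ [seq y <- s | y \in B] ++ x :: [seq y <- s | y \notin B].
have or' : ordering A r'.
  split; last first.
    apply/setP=> y; rewrite -rA def_r !inE !mem_cat !inE !mem_filter.
    by case: (y \in B); case: (y \in s); rewrite ?andbT ?andbF ?orbT ?orbF.
  suff /perm_uniq -> : perm_eq r' (p ++ x :: s) by [].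
  rewrite perm_cat2l (perm_catCA _ [:: x]) /= perm_cons.
  by rewrite perm_filterC.
have := optr _ or'; rewrite def_r /r' !pcost_cat /= !set0U.
have -> : [set y in p] :|: [set y in [seq y <- s | y \in B]] = B.
  apply/setP=> y; rewrite !inE mem_filter.
  apply/idP/idP => [/orP[/pB//|/andP[]//]|yB].
  move/subsetP: sBA => /(_ _ yB); rewrite -rA inE def_r mem_cat inE yB /=.
  by case: eqP => // yx; rewrite -yx yB in xB.
have spA : x |: [set y in p] \subset A.
  rewrite subUset sub1set xA; apply/subsetP => y; rewrite inE => /pB.
  by move/subsetP: sBA; apply.
have := pcost_split smh sBA maxB spA xsA.
have -> : (x |: [set y in p]) :&: B = [set y in p].
  apply/setP=> y; rewrite !inE; case: eqP => [->|_] /=.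
    by rewrite (negbTE xB) /=; apply/esym/negbTE/negP => /pB; rewrite (negbTE xB).
  by case: (boolP (y \in p)) => //= /pB.
have -> : (x |: [set y in p]) :|: B = x |: B.
  apply/setP=> y; rewrite !inE; case: eqP => //= _.
  by case: (boolP (y \in p)) => //= /pB ->.
move=> Hs Ho; rewrite -(ler_pM2l (c_gt0 x)); lra.
Qed.

Definition csum A : R := \sum_(x in A) c x.

Lemma csumU1 e A : e \notin A -> csum (e |: A) = c e + csum A.
Proof. by move=> eA; rewrite /csum big_setU1. Qed.

Lemma csum_seq r : uniq r -> csum [set x in r] = \sum_(x <- r) c x.
Proof.
by move=> ur; rewrite /csum [RHS]big_uniq //; apply: eq_bigl => x; rewrite inE.
Qed.

Lemma pcost_csum P r :
  uniq r -> {in r, forall x, x \notin P} ->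
  2 * pcost csum P r =
  \sum_(x <- r) c x ^+ 2 - ((csum P + \sum_(x <- r) c x) ^+ 2 - csum P ^+ 2).
Proof.
elim: r P => [|e r IH] P /=; first by rewrite !big_nil => _ _; ring.
move=> /andP[er ur] rP.
have eP : e \notin P by apply: rP; rewrite inE eqxx.
have rP' : {in r, forall x, x \notin e |: P}.
  move=> x xr; rewrite !inE negb_or rP ?inE ?xr ?orbT // andbT.
  by apply: contraNneq er => <-.
rewrite mulrDr (IH _ ur rP') !big_cons csumU1 //; ring.
Qed.

Lemma pcostB g h P r :
  pcost (fun A => g A - h A) P r = pcost g P r - pcost h P r.
Proof. by elim: r P => [|e r IH] P /=; rewrite ?IH; ring. Qed.

Lemma pcostZ mu h P r : pcost (fun A => mu * h A) P r = mu * pcost h P r.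
Proof. by elim: r P => [|e r IH] P /=; rewrite ?IH; ring. Qed.

Lemma sum_ordering (f : E -> R) A r :
  ordering A r -> \sum_(x <- r) f x = \sum_(x in A) f x.
Proof. by case=> ur <-; rewrite big_uniq //; apply: eq_bigl => x; rewrite inE. Qed.

Lemma opt_ordering_linear g A r mu :
  opt_ordering g A r -> opt_ordering (fun B => g B - mu * csum B) A r.
Proof.
move=> [orA optr]; split=> // r' or'.
have := optr _ or'; rewrite !pcostB !pcostZ.
suff -> : pcost csum set0 r = pcost csum set0 r' by move=> ?; rewrite lerD2r.
have H q : ordering A q -> 2 * pcost csum set0 q =
    \sum_(x in A) c x ^+ 2 - ((\sum_(x in A) c x) ^+ 2).
  move=> oq; have [uq _] := oq; rewrite pcost_csum // => [|x _]; last by rewrite inE.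
  by rewrite !(sum_ordering _ oq) /csum big_set0; ring.
by have := H _ orA; rewrite -(H _ or') => E2; lra.
Qed.

Lemma supermodular_linear g mu :
  supermodular g -> supermodular (fun B => g B - mu * csum B).
Proof.
move=> smg A B; have := smg A B.
have -> : csum A = csum (A :&: B) + csum (A :\: B) by rewrite /csum (big_setID B).
have -> : csum (A :|: B) = csum B + csum (A :\: B).
  rewrite /csum (big_setID B) /=; congr (_ + _); apply: eq_bigl => x; rewrite !inE.
    by case: (x \in B); rewrite ?andbT ?andbF ?orbT.
  by case: (x \in B); rewrite ?orbF.
lra.
Qed.

Lemma opt_prefix_threshold g A r mu :
  supermodular g -> opt_ordering g A r ->
  exists k, forall B, B \subset A ->
    g B - mu * csum B <= g [set x in take k r] - mu * csum [set x in take k r].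
Proof.
move=> smg /(opt_ordering_linear mu); apply: opt_prefix_max.
exact: supermodular_linear.
Qed.

Fixpoint increments (g : {set E} -> R) P w r : Prop :=
  if r is e :: r' then w e = g (e |: P) - g P /\ increments g (e |: P) w r'
  else True.

Lemma increments_ext g P w w' r :
  {in r, w =1 w'} -> increments g P w r -> increments g P w' r.
Proof.
elim: r P => [//|e r IH] P /= ww' [<- Hr]; split.
  by rewrite ww' ?inE ?eqxx.
by apply: IH => // x xr; apply: ww'; rewrite inE xr orbT.
Qed.

Lemma increments_exist g P r : uniq r -> exists w, increments g P w r.
Proof.
elim: r P => [|e r IH] P /=; first by exists (fun _ => 0).
move=> /andP[er /IH-/(_ (e |: P))[w Hw]].
exists (fun x => if x == e then g (e |: P) - g P else w x); rewrite eqxx; split=> //.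
apply: increments_ext Hw => x xr /=.
by case: eqP xr er => // -> ->.
Qed.

Lemma increments_cat g P w r1 r2 :
  increments g P w (r1 ++ r2) <->
  increments g P w r1 /\ increments g (P :|: [set x in r1]) w r2.
Proof.
elim: r1 P => [|e r1 IH] P /=.
  have -> : P :|: [set x in [::]] = P by apply/setP=> x; rewrite !inE orbF.
  by split=> // -[].
rewrite IH; have -> : (e |: P) :|: [set x in r1] = P :|: [set x in e :: r1].
  by apply/setP=> x; rewrite !inE orbCA orbA orbAC.
by split=> [[? []]|[[]]].
Qed.

Lemma increments_sum g P w r :
  increments g P w r -> \sum_(x <- r) w x = g (P :|: [set x in r]) - g P.
Proof.
elim: r P => [|e r IH] P /=.
  move=> _; rewrite big_nil; have -> : P :|: [set x in [::]] = P.
    by apply/setP=> x; rewrite !inE orbF.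
  by rewrite subrr.
move=> [we Hr]; rewrite big_cons we (IH _ Hr).
have -> : (e |: P) :|: [set x in r] = P :|: [set x in e :: r].
  by apply/setP=> x; rewrite !inE orbCA orbA orbAC.
by ring.
Qed.

Lemma increments_wcost g P w r :
  increments g P w r ->
  wcost w r = (\sum_(x <- r) c x) * g (P :|: [set x in r]) + pcost g P r.
Proof.
elim: r P => [|e r IH] P; first by rewrite /= big_nil mul0r addr0.
move=> Her; have := increments_sum Her; case: Her => we Hr /= ->.
rewrite (IH _ Hr) big_cons.
have -> : (e |: P) :|: [set x in r] = P :|: [set x in e :: r].
  by apply/setP=> x; rewrite !inE orbCA orbA orbAC.
by ring.
Qed.

Lemma ordering_wcost g A w r :
  ordering A r -> increments g set0 w r ->
  wcost w r = csum A * g A + pcost g set0 r.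
Proof.
move=> orA /increments_wcost ->; rewrite set0U.
by rewrite /csum (sum_ordering c orA); case: orA => _ ->.
Qed.

Lemma wcost_rcons w r e :
  wcost w (rcons r e) = wcost w r + (\sum_(x <- rcons r e) c x) * w e.
Proof.
elim: r => [|x r IH] /=; first by rewrite !big_cons !big_nil; ring.
by rewrite IH !big_cons -!cats1 !big_cat /= !big_cons !big_nil; ring.
Qed.

Lemma set_ordering0 (P : {set E}) : P :|: [set x in [::]] = P.
Proof. by apply/setP=> x; rewrite !inE orbF. Qed.

Section DirectSum.
Variables (g : {set E} -> R) (A1 A2 : {set E}).
Hypothesis disjA : [disjoint A1 & A2].
Hypothesis gsum : forall P, P \subset A1 :|: A2 ->
  g P = g (P :&: A1) + g (P :&: A2).

Lemma disj12 x : x \in A1 -> x \notin A2.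
Proof. by move=> xA1; rewrite (disjointFr disjA). Qed.

Lemma increments_filter1 P w r :
  P \subset A1 :|: A2 -> {subset r <= A1 :|: A2} ->
  increments g P w r -> increments g (P :&: A1) w [seq x <- r | x \in A1].
Proof.
elim: r P => [//|e r IH] P sP sr /= [we Hr].
have eA : e \in A1 :|: A2 by apply: sr; rewrite inE eqxx.
have sr' : {subset r <= A1 :|: A2} by move=> x xr; apply: sr; rewrite inE xr orbT.
have seP : e |: P \subset A1 :|: A2 by rewrite subUset sub1set eA.
have := IH _ seP sr' Hr; case: ifP => eA1 /=.
  have -> : (e |: P) :&: A1 = e |: (P :&: A1).
    by apply/setP=> x; rewrite !inE; case: eqP => // ->; rewrite eA1.
  split=> //; rewrite we (gsum seP) (gsum sP).
  have -> : (e |: P) :&: A2 = P :&: A2.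
    apply/setP=> x; rewrite !inE; case: eqP => // ->.
    by rewrite (negbTE (disj12 eA1)) !andbF.
  have -> : (e |: P) :&: A1 = e |: (P :&: A1).
    by apply/setP=> x; rewrite !inE; case: eqP => // ->; rewrite eA1.
  by ring.
suff -> : (e |: P) :&: A1 = P :&: A1 by [].
by apply/setP=> x; rewrite !inE; case: eqP => // ->; rewrite eA1 ?andbF.
Qed.

Lemma increments_unfilter P w r :
  P \subset A1 :|: A2 -> {subset r <= A1 :|: A2} ->
  increments g (P :&: A1) w [seq x <- r | x \in A1] ->
  increments g (P :&: A2) w [seq x <- r | x \in A2] ->
  increments g P w r.
Proof.
elim: r P => [//|e r IH] P sP sr /= H1 H2.
have eA : e \in A1 :|: A2 by apply: sr; rewrite inE eqxx.
have sr' : {subset r <= A1 :|: A2} by move=> x xr; apply: sr; rewrite inE xr orbT.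
have seP : e |: P \subset A1 :|: A2 by rewrite subUset sub1set eA.
have IHe := IH _ seP sr'.
have H e' A (b : bool) : (e' \in A) = b ->
    (e' |: P) :&: A = if b then e' |: (P :&: A) else P :&: A.
  by case: b => e'A; apply/setP=> x; rewrite !inE; case: eqP => // ->;
     rewrite e'A ?andbF.
rewrite (gsum seP) (gsum sP).
case: (boolP (e \in A1)) H1 H2 => eA1.
  have eA2 := negbTE (disj12 eA1); rewrite eA2.
  rewrite (H _ _ _ eA1) (H _ _ _ eA2) in IHe *.
  by move=> /= [-> H1] H2; split; [ring|apply: IHe].
have eA2 : e \in A2 by move: eA; rewrite inE (negbTE eA1).
rewrite eA2; rewrite (H _ _ _ (negbTE eA1)) (H _ _ _ eA2) in IHe *.
by move=> H1 /= [-> H2]; split; [ring|apply: IHe].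
Qed.

End DirectSum.

(** * Concave envelopes and merging *)

(* Along [r], plot the collected reward [w] against the elapsed length [c]:
   [lam x] is the slope over [x] of the least concave majorant of this curve.
   The last clause says that the majorant touches the curve wherever its slope
   changes. *)
Definition envelope w lam r :=
  [/\ sorted (fun x y => lam y <= lam x) r,
      (forall k, \sum_(x <- drop k r) c x * lam x <= \sum_(x <- drop k r) w x) &
      (forall p : pred R, \sum_(x <- r | p (lam x)) (w x - c x * lam x) = 0)].

Lemma sorted_filter_take (lam : E -> R) (p : pred R) r :
  (forall a b, a <= b -> p a -> p b) ->
  sorted (fun x y => lam y <= lam x) r ->
  [seq x <- r | p (lam x)] = take (count (fun x => p (lam x)) r) r.
Proof.
move=> pup; elim: r => [//|e r IH] /= per.
have sr := path_sorted per.
case: (boolP (p (lam e))) => pe /=; first by rewrite -IH.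
have H : all (fun x => ~~ p (lam x)) r.
  have tr : transitive (fun x y => lam y <= lam x).
    by move=> y x z xy yz; exact: le_trans yz xy.
  apply/allP => x xr; apply: contra pe; apply: pup.
  by have /allP/(_ _ xr) := order_path_min tr per.
rewrite add0n; have -> : count (fun x => p (lam x)) r = 0%N.
  by apply/eqP; rewrite -leqn0 leqNgt -has_count -all_predC.
by rewrite take0; apply/eqP; rewrite -size_eq0 size_filter -leqn0 leqNgt -has_count -all_predC.
Qed.

Lemma envelope_ext w lam w' lam' r :
  {in r, w =1 w'} -> {in r, lam =1 lam'} ->
  envelope w lam r -> envelope w' lam' r.
Proof.
move=> ww' ll' [srt suf bal]; split.
- case: r srt ll' {ww' suf bal} => //= x r.
  elim: r x => //= y r IH x /andP[xy yr] ll'.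
  rewrite -!ll' ?inE ?eqxx ?orbT // xy /=; apply: IH => // z zr; apply: ll'.
  by rewrite inE zr orbT.
- move=> k; have dr x : x \in drop k r -> x \in r by apply: mem_drop.
  have -> : \sum_(x <- drop k r) c x * lam' x = \sum_(x <- drop k r) c x * lam x.
    by apply: eq_big_seq => x /dr xr; rewrite ll'.
  have -> // : \sum_(x <- drop k r) w' x = \sum_(x <- drop k r) w x.
  by apply: eq_big_seq => x /dr xr; rewrite ww'.
move=> p; rewrite -[RHS](bal p) [LHS]big_seq_cond [RHS]big_seq_cond.
apply: eq_big => [x|x /andP[xr _]].
  by case: (boolP (x \in r)) => //= xr; rewrite ll'.
by rewrite ww' ?ll'.
Qed.

Lemma envelope_block w lam (lam0 : R) (q r : seq E) :
  q != [::] -> {in q, forall x, lam x = lam0} ->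
  \sum_(x <- q) w x = lam0 * \sum_(x <- q) c x ->
  (forall k, \sum_(x <- take k (q ++ r)) w x <=
             lam0 * \sum_(x <- take k (q ++ r)) c x) ->
  envelope w lam r -> envelope w lam (q ++ r).
Proof.
move=> q0 lq eqq maxq [srt suf bal].
have cpos s : s != [::] -> 0 < \sum_(x <- s) c x.
  case: s => // x s _; rewrite big_cons ltr_wpDr //.
  by apply: sumr_ge0 => i _; apply: ltW.
have clq s : {subset s <= q} -> \sum_(x <- s) c x * lam x = lam0 * \sum_(x <- s) c x.
  move=> sq; rewrite mulr_sumr big_seq [RHS]big_seq; apply: eq_bigr => x xs.
  by rewrite lq ?sq // mulrC.
have headr x r' : r = x :: r' -> lam x <= lam0.
  move=> er; set p := fun a : R => lam x <= a.
  have pup a b : a <= b -> p a -> p b by move=> ab; rewrite /p => /le_trans; apply.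
  have := sorted_filter_take pup srt; set k := count _ _ => ft.
  have kx : take k r = x :: take k.-1 r' by rewrite /k er /= /p lexx.
  have allx : {in take k r, forall y, lam y = lam x}.
    move=> y; rewrite -ft mem_filter => /andP[py yr]; apply/le_anti; rewrite -/(p _) py andbT.
    have tr : transitive (fun x y => lam y <= lam x).
      by move=> b a d ab bd; exact: le_trans bd ab.
    move: srt yr; rewrite er /= => /(order_path_min tr)/allP H; rewrite inE.
    by case/orP => [/eqP->//|/H].
  have E1 : \sum_(y <- take k r) w y = lam x * \sum_(y <- take k r) c y.
    have := bal p; rewrite -big_filter ft sumrB => /eqP; rewrite subr_eq0 => /eqP ->.
    by rewrite mulr_sumr !big_seq; apply: eq_bigr => y yr; rewrite allx // mulrC.
  have := maxq (size q + k)%N.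
  rewrite take_cat ltnNge leq_addr /= addKn !big_cat /= eqq E1 mulrDr lerD2l.
  by rewrite ler_pM2r // cpos // kx.
split.
- have sq : sorted (fun x y => lam y <= lam x) q.
    case: q lq {q0 eqq maxq clq} => //= x q.
    elim: q x => //= y q IH x lq.
    rewrite !lq ?inE ?eqxx ?orbT // lexx /=; apply: IH => z zq; apply: lq.
    by rewrite inE zq orbT.
  case: q q0 lq sq {eqq maxq clq} => //= x q _ lq sq.
  rewrite cat_path sq /=; case: r srt headr {suf bal} => //= y r -> hr.
  by rewrite (lq (last x q)) ?mem_last // (hr y r).
- move=> k; rewrite drop_cat; case: ltnP => kq; last exact: suf.
  rewrite !big_cat /=; apply: lerD; last by have := suf 0%N; rewrite drop0.
  rewrite clq => [|x]; last by apply: mem_drop.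
  have := maxq k; rewrite take_cat kq.
  have := eqq; rewrite -{1 2}(cat_take_drop k q) !big_cat /= mulrDr; lra.
move=> p; rewrite big_cat /= bal addr0.
have -> : \sum_(x <- q | p (lam x)) (w x - c x * lam x) =
          if p lam0 then \sum_(x <- q) (w x - c x * lam x) else 0.
  case: ifP => p0.
    rewrite big_seq_cond [RHS]big_seq; apply: eq_bigl => x.
    by case: (boolP (x \in q)) => //= xq; rewrite lq.
  by rewrite big_seq_cond big_pred0 // => x; apply/negbTE/negP => /andP[xq];
     rewrite lq // p0.
by rewrite sumrB clq // eqq subrr if_same.
Qed.

Lemma envelope_nil w lam : envelope w lam [::].
Proof. by split=> [||p] //=; rewrite !big_nil. Qed.

Lemma envelope_exist w r : uniq r -> exists lam, envelope w lam r.
Proof.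
have [m] := ubnP (size r); elim: m r => // m IH [|x0 r0] szr ur.
  by exists w; apply: envelope_nil.
set r := x0 :: r0 in szr ur *.
pose d (k : 'I_(size r)) := (\sum_(x <- take k.+1 r) w x) / (\sum_(x <- take k.+1 r) c x).
have cpos k : (0 < k)%N -> 0 < \sum_(x <- take k r) c x.
  case: k => // k _; rewrite /r /= big_cons ltr_wpDr //.
  by apply: sumr_ge0 => i _; apply: ltW.
have [k _ maxk] := arg_maxP d (isT : predT (ord0 : 'I_(size r))).
have [lam' Hlam'] : exists lam, envelope w lam (drop k.+1 r).
  apply: IH; last exact: drop_uniq.
  by rewrite size_drop /r /=; move: szr; rewrite /r /=; lia.
exists (fun x => if x \in take k.+1 r then d k else lam' x).
set lam0 := (fun x => _); suff : envelope w lam0 (take k.+1 r ++ drop k.+1 r).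
  by rewrite cat_take_drop.
apply: (@envelope_block _ _ (d k)); rewrite /lam0.
- by rewrite /r.
- by move=> x ->.
- by rewrite /d divfK // lt0r_neq0 // cpos.
- move=> j; rewrite cat_take_drop; case: (posnP j) => [->|j0].
    by rewrite take0 !big_nil mulr0.
  wlog js : j j0 / (j <= size r)%N.
    move=> W; case: (leqP j (size r)) => [/(W _ j0)//|js].
    by have := W (size r); rewrite take_size (take_oversize (ltnW js)); apply.
  have jj : (j.-1 < size r)%N by rewrite prednK.
  have Ej : (Ordinal jj).+1 = j by rewrite /= prednK.
  have H : d (Ordinal jj) <= d k := maxk (Ordinal jj) isT.
  rewrite {1}/d Ej in H.
  by rewrite -ler_pdivrMr // cpos.
apply: envelope_ext Hlam' => // x xd; rewrite ifN //.
by move: ur; rewrite -{1}(cat_take_drop k.+1 r) cat_uniq => /and3P[_ /hasPn H _]; exact: H.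
Qed.

End Sequencing.

Section Merging.
Variables (R : realType) (E : finType) (c : E -> R).
Hypothesis c_gt0 : forall e, 0 < c e.
Implicit Types (r : seq E) (P A B : {set E}) (w lam : E -> R).

(* The mutual delay of [r1] and [r2] in the best interleaving of the two. *)
Definition cross lam lam' r1 r2 : R :=
  \sum_(x <- r1) c x * \sum_(y <- r2) c y * Num.min (lam x) (lam' y).

Lemma crossC lam lam' r1 r2 : cross lam lam' r1 r2 = cross lam' lam r2 r1.
Proof.
rewrite /cross; under eq_bigr do rewrite mulr_sumr.
under [RHS]eq_bigr do rewrite mulr_sumr.
rewrite exchange_big; apply: eq_bigr => y _; apply: eq_bigr => x _.
by rewrite minC; ring.
Qed.

Lemma interleave_wcost_ge w lam (p : pred E) r :
  (forall k, \sum_(x <- drop k (filter p r)) c x * lam x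
             <= \sum_(x <- drop k (filter p r)) w x) ->
  (forall k, \sum_(x <- drop k (filter (predC p) r)) c x * lam x
             <= \sum_(x <- drop k (filter (predC p) r)) w x) ->
  wcost c w (filter p r) + wcost c w (filter (predC p) r)
    + cross lam lam (filter p r) (filter (predC p) r) <= wcost c w r.
Proof.
elim: r => [|e r IH] /=; first by move=> _ _; rewrite /cross big_nil !addr0.
have sumf : \sum_(x <- r) w x =
    \sum_(x <- filter p r) w x + \sum_(x <- filter (predC p) r) w x.
  by rewrite !big_filter [LHS](bigID p).
have minle s : \sum_(y <- s) c y * Num.min (lam e) (lam y) <= \sum_(y <- s) c y * lam y.
  apply: ler_sum => y _; rewrite ler_pM2l //; by rewrite ge_min lexx orbT.
case: (boolP (p e)) => pe /= H1 H2.
  have H1' k := H1 k.+1; have := IH H1' H2.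
  have := H2 0%N; rewrite drop0 => H20.
  rewrite /cross !big_cons sumf; have := minle (filter (predC p) r) => M.
  have := le_trans M H20; rewrite -(ler_pM2l (c_gt0 e)) => K Hr; lra.
have H2' k := H2 k.+1; have := IH H1 H2'.
have := H1 0%N; rewrite drop0 => H10.
rewrite crossC [X in _ -> X]/= [in X in _ -> X]crossC.
rewrite /cross !big_cons sumf; have := minle (filter p r) => M.
have := le_trans M H10; rewrite -(ler_pM2l (c_gt0 e)) => K Hr; lra.
Qed.

Definition by_label lam : rel E := fun x y => lam y <= lam x.

Lemma by_label_trans lam : transitive (by_label lam).
Proof. by move=> y x z xy yz; exact: le_trans yz xy. Qed.

Lemma sum_merge (f : E -> R) lam r1 r2 :
  \sum_(x <- merge (by_label lam) r1 r2) f x = \sum_(x <- r1) f x + \sum_(x <- r2) f x.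
Proof. by rewrite (perm_big (r1 ++ r2)) ?big_cat //= perm_merge. Qed.

Lemma merge_cons lam x1 r1 x2 r2 :
  merge (by_label lam) (x1 :: r1) (x2 :: r2) =
  if lam x2 <= lam x1 then x1 :: merge (by_label lam) r1 (x2 :: r2)
  else x2 :: merge (by_label lam) (x1 :: r1) r2.
Proof. by []. Qed.

Lemma merges0 lam r : merge (by_label lam) r [::] = r.
Proof. by case: r. Qed.

Lemma merge0s lam r : merge (by_label lam) [::] r = r.
Proof. by []. Qed.

Lemma merge_wcost w lam r1 r2 :
  sorted (by_label lam) r1 -> sorted (by_label lam) r2 ->
  wcost c w (merge (by_label lam) r1 r2) =
  wcost c w r1 + wcost c w r2
  + \sum_(x <- r1) c x * \sum_(y <- r2 | lam y <= lam x) w y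
  + \sum_(y <- r2) c y * \sum_(x <- r1 | lam x < lam y) w x.
Proof.
elim: r1 r2 => [|x1 r1 IH1] r2.
  move=> _ _; rewrite merge0s big_nil /= !(add0r, addr0) big1 ?addr0 //.
  by move=> y _; rewrite big_nil mulr0.
elim: r2 => [|x2 r2 IH2] s1 s2.
  rewrite merges0 [X in _ = _ + X]big_nil [X in _ = _ + X + _]big1 ?addr0 //.
  by move=> y _; rewrite big_nil mulr0.
have s1' := path_sorted s1; have s2' := path_sorted s2.
have /allP a1 := order_path_min (@by_label_trans lam) s1.
have /allP a2 := order_path_min (@by_label_trans lam) s2.
rewrite merge_cons; case: (leP (lam x2) (lam x1)) => cmp.
  have E1 : \sum_(y <- x2 :: r2 | lam y <= lam x1) w y = \sum_(y <- x2 :: r2) w y.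
    rewrite big_seq_cond [RHS]big_seq; apply: eq_bigl => y.
    case: (boolP (y \in x2 :: r2)) => //=; rewrite inE => /orP[/eqP->//|/a2].
    by move=> yx; rewrite (le_trans yx).
  have E2 : \sum_(y <- x2 :: r2) c y * \sum_(x <- x1 :: r1 | lam x < lam y) w x =
            \sum_(y <- x2 :: r2) c y * \sum_(x <- r1 | lam x < lam y) w x.
    apply: eq_big_seq => y yr; rewrite big_cons ifN // -leNgt.
    move: yr; rewrite inE => /orP[/eqP->//|/a2 yx]; exact: le_trans cmp.
  rewrite E2 [X in _ = _ + X + _]big_cons E1 [LHS]/= (IH1 _ s1' s2).
  rewrite big_cons sum_merge [wcost _ _ (x1 :: r1)]/= !(big_cons _ _ x1).
  ring.
have E1 : \sum_(x <- x1 :: r1 | lam x < lam x2) w x = \sum_(x <- x1 :: r1) w x.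
  rewrite big_seq_cond [RHS]big_seq; apply: eq_bigl => y.
  case: (boolP (y \in x1 :: r1)) => //=; rewrite inE => /orP[/eqP->//|/a1].
  by move=> yx; rewrite (le_lt_trans yx).
have E2 : \sum_(x <- x1 :: r1) c x * \sum_(y <- x2 :: r2 | lam y <= lam x) w y =
          \sum_(x <- x1 :: r1) c x * \sum_(y <- r2 | lam y <= lam x) w y.
  apply: eq_big_seq => y yr; rewrite big_cons ifN // -ltNge.
  move: yr; rewrite inE => /orP[/eqP->//|/a1 yx]; exact: le_lt_trans cmp.
rewrite E2 [X in _ = _ + X]big_cons E1 [LHS]/= (IH2 s1 s2').
rewrite big_cons sum_merge [wcost _ _ (x2 :: r2)]/= !(big_cons _ _ x2).
ring.
Qed.

Lemma merge_wcost_cross w lam r1 r2 :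
  envelope c w lam r1 -> envelope c w lam r2 ->
  wcost c w (merge (by_label lam) r1 r2) =
  wcost c w r1 + wcost c w r2 + cross lam lam r1 r2.
Proof.
move=> [s1 _ b1] [s2 _ b2]; rewrite merge_wcost // -addrA; congr (_ + _).
have bal r (p : pred R) : (forall p : pred R, \sum_(x <- r | p (lam x)) (w x - c x * lam x) = 0) ->
    \sum_(x <- r | p (lam x)) w x = \sum_(x <- r | p (lam x)) c x * lam x.
  by move=> /(_ p) /eqP; rewrite sumrB subr_eq0 => /eqP.
under eq_bigr => x _ do rewrite (bal r2 (fun a => a <= lam x) b2) mulr_sumr.
under [X in _ + X]eq_bigr => y _ do rewrite (bal r1 (fun a => a < lam y) b1) mulr_sumr.
rewrite [X in _ + X](exchange_big_dep predT) //= -big_split /=; apply: eq_bigr => x _.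
rewrite mulr_sumr [RHS](bigID (fun y => lam y <= lam x)) /=; congr (_ + _).
  by apply: eq_bigr => y yx; rewrite min_r.
apply: eq_big => y; first by rewrite ltNge.
by move=> xy; rewrite min_l ?(ltW xy) //; ring.
Qed.

Lemma filter_merge1 lam (p : pred E) r1 r2 :
  {in r1, forall x, p x} -> {in r2, forall x, ~~ p x} ->
  filter p (merge (by_label lam) r1 r2) = r1.
Proof.
have f0 r : {in r, forall x, ~~ p x} -> filter p r = [::].
  by elim: r => //= x r IH H; rewrite ifN ?H ?inE ?eqxx // IH // => y yr; rewrite H // inE yr orbT.
have f1 r : {in r, forall x, p x} -> filter p r = r by move=> /allP/all_filterP.
elim: r1 r2 => [|x1 r1 IH1] r2; first by rewrite merge0s => _ /f0.
elim: r2 => [|x2 r2 IH2] H1 H2; first by rewrite merges0 f1.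
have H1' : {in r1, forall x, p x} by move=> y yr; rewrite H1 // inE yr orbT.
have H2' : {in r2, forall x, ~~ p x} by move=> y yr; rewrite H2 // inE yr orbT.
rewrite merge_cons; case: ifP => _.
  by rewrite [LHS]/= H1 ?inE ?eqxx // IH1.
by rewrite [LHS]/= ifN ?H2 ?inE ?eqxx // IH2.
Qed.

Lemma filter_merge2 lam (p : pred E) r1 r2 :
  {in r1, forall x, ~~ p x} -> {in r2, forall x, p x} ->
  filter p (merge (by_label lam) r1 r2) = r2.
Proof.
have f0 r : {in r, forall x, ~~ p x} -> filter p r = [::].
  by elim: r => //= x r IH H; rewrite ifN ?H ?inE ?eqxx // IH // => y yr; rewrite H // inE yr orbT.
have f1 r : {in r, forall x, p x} -> filter p r = r by move=> /allP/all_filterP.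
elim: r1 r2 => [|x1 r1 IH1] r2; first by rewrite merge0s => _ /f1.
elim: r2 => [|x2 r2 IH2] H1 H2; first by rewrite merges0 f0.
have H1' : {in r1, forall x, ~~ p x} by move=> y yr; rewrite H1 // inE yr orbT.
have H2' : {in r2, forall x, p x} by move=> y yr; rewrite H2 // inE yr orbT.
rewrite merge_cons; case: ifP => _.
  by rewrite [LHS]/= ifN ?H1 ?inE ?eqxx // IH1.
by rewrite [LHS]/= H2 ?inE ?eqxx // IH2.
Qed.

(* [\sum c * min lam mu] is the total reward minus the largest value of
   [g - mu * c] over prefixes, and an optimal ordering has a prefix where this
   value is the largest over all subsets. *)
Lemma envelope_opt_min g A w lam r w' lam' r' mu :
  supermodular g -> opt_ordering c g A r ->
  increments g set0 w r -> envelope c w lam r ->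
  ordering A r' -> increments g set0 w' r' -> envelope c w' lam' r' ->
  \sum_(x <- r) c x * Num.min (lam x) mu <= \sum_(x <- r') c x * Num.min (lam' x) mu.
Proof.
move=> smg opt inc env or' inc' env'; have [or _] := opt.
pose h B := g B - mu * csum c B.
have minE v l s : envelope c v l s -> increments g set0 v s -> ordering A s ->
    \sum_(x <- s) c x * Num.min (l x) mu =
    g A - g set0 - \sum_(x <- s | mu < l x) (v x - mu * c x).
  move=> [_ _ b] i os.
  have -> : g A - g set0 = \sum_(x <- s) c x * l x.
    have := b predT; rewrite sumrB => /eqP; rewrite subr_eq0 => /eqP /= <-.
    by rewrite (increments_sum i) set0U; case: os => _ ->.
  have -> : \sum_(x <- s | mu < l x) (v x - mu * c x) =
            \sum_(x <- s | mu < l x) c x * (l x - mu).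
    apply/eqP; rewrite -subr_eq0 -sumrB; apply/eqP.
    by rewrite -[RHS](b (fun a => mu < a)); apply: eq_bigr => x _; ring.
  rewrite [X in _ - X]big_mkcond -sumrB; apply: eq_bigr => x _.
  by case: ltP => hx; ring.
rewrite (minE _ _ _ env) // (minE _ _ _ env') // lerD2l lerN2.
have hE v s k : uniq s -> increments g set0 v s ->
    h [set x in take k s] - h set0 = \sum_(x <- take k s) (v x - mu * c x).
  move=> us; rewrite -{1}(cat_take_drop k s) => /increments_cat[i _].
  rewrite sumrB (increments_sum i) set0U /h csum_seq ?take_uniq //.
  have -> : csum c set0 = 0 by rewrite /csum big_set0.
  by rewrite mulr_sumr; ring.
have [[ur _] [ur' _]] := (or, or').
have [srt' _ _] := env'.
have mup a b : a <= b -> mu < a -> mu < b by move=> ab /lt_le_trans; apply.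
rewrite -[leLHS]big_filter (sorted_filter_take (p := fun a => mu < a) mup srt').
set k' := count _ _; rewrite -hE //.
have [k kmax] := opt_prefix_threshold c_gt0 mu smg opt.
have sk' : [set x in take k' r'] \subset A.
  by case: or' => _ <-; apply/subsetP => x; rewrite !inE => /mem_take.
have := kmax _ sk'; rewrite -/(h _) -/(h _) => hk.
apply: (@le_trans _ _ (h [set x in take k r] - h set0)); first by rewrite lerD2r.
rewrite (hE w) //.
have [srt suf bal] := env.
have -> : \sum_(x <- r | mu < lam x) (w x - mu * c x) =
          \sum_(x <- r | mu < lam x) c x * (lam x - mu).
  apply/eqP; rewrite -subr_eq0 -sumrB; apply/eqP.
  by rewrite -[RHS](bal (fun a => mu < a)); apply: eq_bigr => x _; ring.
apply: (@le_trans _ _ (\sum_(x <- take k r) c x * (lam x - mu))).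
  have -> : \sum_(x <- take k r) c x * (lam x - mu) =
      \sum_(x <- take k r) c x * lam x - \sum_(x <- take k r) mu * c x.
    by rewrite -sumrB; apply: eq_bigr => x _; ring.
  rewrite sumrB lerD2r; have := bal predT; rewrite sumrB => /eqP; rewrite subr_eq0 => /eqP /=.
  rewrite -{1 2}(cat_take_drop k r) !big_cat /=; have := suf k; lra.
rewrite -{2}(cat_take_drop k r) big_cat /= ler_wpDr //.
  by apply: sumr_ge0 => x hx; apply: mulr_ge0; [exact: ltW|rewrite subr_ge0 ltW].
rewrite [leRHS]big_mkcond; apply: ler_sum => x _.
by case: ltP => // hx; rewrite pmulr_rle0 // subr_le0.
Qed.

Lemma merge_opt g A1 A2 w lam r1 r2 :
  supermodular g -> [disjoint A1 & A2] ->
  (forall P, P \subset A1 :|: A2 -> g P = g (P :&: A1) + g (P :&: A2)) ->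
  opt_ordering c g A1 r1 -> opt_ordering c g A2 r2 ->
  increments g set0 w r1 -> increments g set0 w r2 ->
  envelope c w lam r1 -> envelope c w lam r2 ->
  let r := merge (by_label lam) r1 r2 in
  [/\ ordering (A1 :|: A2) r, increments g set0 w r &
      forall r' w', ordering (A1 :|: A2) r' -> increments g set0 w' r' ->
        wcost c w r <= wcost c w' r'].
Proof.
move=> smg dA gs opt1 opt2 inc1 inc2 env1 env2 r.
have [o1 _] := opt1; have [o2 _] := opt2.
have [[u1 e1] [u2 e2]] := (o1, o2).
have m1 x : (x \in r1) = (x \in A1) by rewrite -e1 inE.
have m2 x : (x \in r2) = (x \in A2) by rewrite -e2 inE.
have n12 x : x \in A1 -> x \notin A2 by move=> xA1; rewrite (disjointFr dA).
have n21 x : x \in A2 -> x \notin A1 by move=> xA2; rewrite (disjointFl dA).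
have mr x : (x \in r) = (x \in A1 :|: A2) by rewrite /r mem_merge mem_cat m1 m2 inE.
have or : ordering (A1 :|: A2) r.
  split; last by apply/setP=> x; rewrite inE mr.
  rewrite /r merge_uniq cat_uniq u1 u2 andbT /=; apply/hasPn => x.
  by rewrite /= m1 m2 => /n21.
have incr : increments g set0 w r.
  apply: (increments_unfilter dA gs); rewrite ?sub0set //.
  - by move=> x; rewrite mr.
  - rewrite set0I filter_merge1 // => x; first by rewrite m1.
    by rewrite m2 => /n21.
  rewrite set0I filter_merge2 // => x; last by rewrite m2.
  by rewrite m1 => /n12.
split=> // r' w' or' inc'; have [ur' er'] := or'.
have mr' x : (x \in r') = (x \in A1 :|: A2) by rewrite -er' inE.
pose q1 := [seq x <- r' | x \in A1]; pose q2 := [seq x <- r' | x \in A2].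
have oq1 : ordering A1 q1.
  by split; [exact: filter_uniq | apply/setP=> x; rewrite inE mem_filter mr' inE; case: (x \in A1)].
have oq2 : ordering A2 q2.
  split; [exact: filter_uniq | apply/setP=> x; rewrite inE mem_filter mr' inE].
  by case: (x \in A2); rewrite ?orbT.
have q2E : q2 = filter (predC [in A1]) r'.
  apply: eq_in_filter => x; rewrite mr' inE /=.
  by case: (boolP (x \in A1)) => [/n12/negbTE|_ /=].
have iq1 : increments g set0 w' q1.
  rewrite -(set0I A1); apply: (increments_filter1 dA gs); rewrite ?sub0set //.
  by move=> x; rewrite mr'.
have iq2 : increments g set0 w' q2.
  rewrite -(set0I A2).
  apply: (@increments_filter1 _ _ g A2 A1); rewrite ?sub0set //.
  - by rewrite disjoint_sym.
  - by move=> P; rewrite setUC addrC; apply: gs.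
  by move=> x; rewrite mr' setUC.
have [l1 Hl1] := envelope_exist c_gt0 w' (filter_uniq [in A1] ur').
have [l2 Hl2] := envelope_exist c_gt0 w' (filter_uniq [in A2] ur').
pose l x := if x \in A1 then l1 x else l2 x.
have El1 : envelope c w' l q1.
  by apply: envelope_ext Hl1 => // x; rewrite mem_filter /l => /andP[-> _].
have El2 : envelope c w' l q2.
  by apply: envelope_ext Hl2 => // x; rewrite mem_filter /l => /andP[/n21/negbTE->].
have Hge : wcost c w' q1 + wcost c w' q2 + cross l l q1 q2 <= wcost c w' r'.
  rewrite q2E; apply: interleave_wcost_ge; first by case: El1.
  by rewrite -q2E; case: El2.
apply: le_trans Hge; rewrite merge_wcost_cross //.
have optle A s s' v v' : opt_ordering c g A s -> ordering A s' ->
    increments g set0 v s -> increments g set0 v' s' -> wcost c v s <= wcost c v' s'.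
  move=> [os H] os' i i'; rewrite (ordering_wcost c os i) (ordering_wcost c os' i').
  by rewrite lerD2l H.
apply: lerD; first by apply: lerD; [exact: optle opt1 oq1 _ _|exact: optle opt2 oq2 _ _].
apply: (@le_trans _ _ (cross lam l r1 q2)).
  apply: ler_sum => x _; rewrite ler_pM2l //.
  under eq_bigr do rewrite minC; under [leRHS]eq_bigr do rewrite minC.
  by apply: (envelope_opt_min _ smg opt2 inc2 env2 oq2 iq2 El2).
rewrite crossC [leRHS]crossC; apply: ler_sum => x _; rewrite ler_pM2l //.
under eq_bigr do rewrite minC; under [leRHS]eq_bigr do rewrite minC.
by apply: (envelope_opt_min _ smg opt1 inc1 env1 oq1 iq1 El1).
Qed.

Lemma wcost_last g A e r w :
  ordering A (rcons r e) -> increments g set0 w (rcons r e) ->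
  [/\ e \in A, ordering (A :\ e) r, increments g set0 w r,
      w e = g A - g (A :\ e) &
      wcost c w (rcons r e) = wcost c w r + csum c A * (g A - g (A :\ e))].
Proof.
move=> o; have [u eA] := o; rewrite wcost_rcons (sum_ordering c o).
rewrite -cats1 => /increments_cat[i /= []]; rewrite set0U.
move: u; rewrite rcons_uniq => /andP[er ur].
have Ae : A :\ e = [set x in r].
  apply/setP=> x; rewrite -eA !inE mem_rcons inE.
  by case: eqP => [->|] //=; rewrite (negbTE er).
have -> : e |: [set x in r] = A.
  by rewrite -Ae setD1K // -eA inE mem_rcons inE eqxx.
rewrite -Ae => we _; rewrite we; split=> //.
by rewrite -eA inE mem_rcons inE eqxx.
Qed.

Lemma merge_last_opt g A e A1 A2 w lam r1 r2 :
  supermodular g -> e \in A -> A :\ e = A1 :|: A2 -> [disjoint A1 & A2] ->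
  (forall P, P \subset A1 :|: A2 -> g P = g (P :&: A1) + g (P :&: A2)) ->
  opt_ordering c g A1 r1 -> opt_ordering c g A2 r2 ->
  increments g set0 w r1 -> increments g set0 w r2 ->
  envelope c w lam r1 -> envelope c w lam r2 ->
  w e = g A - g (A :\ e) ->
  let r := rcons (merge (by_label lam) r1 r2) e in
  [/\ ordering A r, increments g set0 w r &
      forall r' w', ordering A (rcons r' e) -> increments g set0 w' (rcons r' e) ->
        wcost c w r <= wcost c w' (rcons r' e)].
Proof.
move=> smg eA AE dA gs o1 o2 i1 i2 v1 v2 we r.
have [om im mm] := merge_opt smg dA gs o1 o2 i1 i2 v1 v2.
rewrite -AE in om mm; have [um em] := om.
have mem x : (x \in merge (by_label lam) r1 r2) = (x \in A :\ e) by rewrite -em inE.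
have or : ordering A r.
  have er : e \notin merge (by_label lam) r1 r2.
    by rewrite mem !inE eqxx.
  split; first by rewrite /r rcons_uniq er.
  apply/setP => x; rewrite /r !inE mem_rcons inE mem !inE.
  by case: eqP => //= ->; rewrite eA.
have ir : increments g set0 w r.
  rewrite /r -cats1; apply/increments_cat; split=> //; split=> //.
  by rewrite we set0U em setD1K.
split=> // r' w' or' ir'.
have [_ _ _ _ ->] := wcost_last or ir.
have [_ o' i' _ ->] := wcost_last or' ir'.
by rewrite lerD2r; apply: mm.
Qed.

End Merging.

(** * Cuts of a tree *)

Definition relabel (f : nat -> nat) (a b : nat) : nat -> nat :=
  fun v => if f v == f b then f a else f v.

Section Cuts.
Variables (n : nat) (ends : 'I_n.-1 -> 'I_n * 'I_n).
Notation E := 'I_n.-1.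
Notation V := 'I_n.

(* Merging the classes of the two ends of one edge after the other loses at most
   one class per edge, so that [n - 2] edges leave at least two classes; the
   program computes the sides of the cuts in the same way. *)
Definition component (es : seq E) : nat -> nat :=
  foldl (fun f e => relabel f (ends e).1 (ends e).2) id es.

Lemma relabel_eq f a b u v : f u = f v -> relabel f a b u = relabel f a b v.
Proof. by rewrite /relabel => ->. Qed.

Lemma foldl_relabel_eq f es u v : f u = f v ->
  foldl (fun f e => relabel f (ends e).1 (ends e).2) f es u =
  foldl (fun f e => relabel f (ends e).1 (ends e).2) f es v.
Proof. by elim: es f => //= e es IH f fuv; apply: IH; apply: relabel_eq. Qed.

Lemma component_ends es e : e \in es ->
  component es (ends e).1 = component es (ends e).2.
Proof.
rewrite /component; elim: es id => //= e' es IH f; rewrite inE => /orP[/eqP<-|]; last exact: IH.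
by apply: foldl_relabel_eq; rewrite /relabel eqxx; case: eqP.
Qed.

Lemma component_card es :
  (n <= size (undup [seq component es v | v : V <- enum 'I_n]) + size es)%N.
Proof.
rewrite /component.
have U : uniq [seq id (val v) | v : V <- enum 'I_n].
  by rewrite map_inj_uniq ?enum_uniq //; exact: val_inj.
have : (n <= size (undup [seq id (val v) | v : V <- enum 'I_n]))%N.
  by rewrite (undup_id U) size_map size_enum_ord.
suff H (f : nat -> nat) m : (m <= size (undup [seq f v | v : V <- enum 'I_n]))%N ->
  (m <= size (undup [seq foldl (fun f e => relabel f (ends e).1 (ends e).2) f es v
                    | v : V <- enum 'I_n]) + size es)%N by exact: H.
elim: es f m => [|e es IH] f m /= Hm.
  by rewrite addn0.
rewrite addnS -addSn; rewrite -ltnS.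
have := IH (relabel f (ends e).1 (ends e).2) m.-1.
case: m Hm => [|m] Hm //= H; rewrite addSn !ltnS; apply: H.
rewrite -ltnS; apply: leq_trans Hm _.
apply: (@leq_trans (size (f (ends e).2 :: undup [seq relabel f (ends e).1 (ends e).2 (val v) | v <- enum 'I_n]))).
  2: by [].
apply: uniq_leq_size; first exact: undup_uniq.
move=> x; rewrite mem_undup => /mapP[v vV ->]; rewrite inE mem_undup.
case: (eqVneq (f v) (f (ends e).2)) => //= ne.
apply/mapP; exists v => //; by rewrite /relabel (negbTE ne).
Qed.

Definition side (e : E) (v : nat) : bool :=
  let f := component [seq e' <- enum 'I_n.-1 | e' != e] in f v == f (ends e).1.

Definition incident (e : E) (v : V) := ((ends e).1 == v) || ((ends e).2 == v).

Lemma side_ends e e' : e' != e -> side e' (ends e).1 = side e' (ends e).2.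
Proof. by move=> ne; rewrite /side (component_ends (e := e)) // mem_filter mem_enum eq_sym ne. Qed.

Hypothesis tree : is_tree ends.

Lemma tree_ind (P : pred V) v0 : P v0 ->
  (forall e, P (ends e).1 = P (ends e).2) -> forall v, P v.
Proof.
move=> P0 PE v; have /andP[_ /forallP/(_ v0)/forallP/(_ v) conn] := tree.
have cl : closed (adj ends) [pred v | P v].
  by move=> x y /existsP[e /orP[]/eqP Ee]; have := PE e; rewrite Ee !inE /= => ->.
by have := closed_connect cl conn; rewrite !inE P0 => <-.
Qed.

Lemma side1 e : side e (ends e).1.
Proof. by rewrite /side eqxx. Qed.

Lemma side2 e : side e (ends e).2 = false.
Proof.
apply/negbTE/negP => s2.
set es := [seq e' <- enum 'I_n.-1 | e' != e].
have all1 : forall v : V, component es v == component es (ends e).1.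
  apply: (tree_ind (v0 := (ends e).1)); rewrite ?eqxx // => e'.
  case: (eqVneq e' e) => [->|ne]; first by rewrite eqxx; apply/esym.
  by rewrite (component_ends (e := e')) // mem_filter ne mem_enum.
have n1 : (0 < n.-1)%N := leq_ltn_trans (leq0n _) (ltn_ord e).
have := component_card es.
have -> : size es = n.-2.
  rewrite size_filter; have := count_predC (pred1 e) (enum 'I_n.-1).
  rewrite size_enum_ord.
  have -> : count (pred1 e) (enum 'I_n.-1) = 1%N.
    by rewrite count_uniq_mem ?enum_uniq // mem_enum.
  rewrite -[count (predC _) _]/(count (fun e' => e' != e) _); lia.
suff : (size (undup [seq component es v | v : V <- enum 'I_n]) <= 1)%N by lia.
apply: (@uniq_leq_size _ _ [:: component es (ends e).1]); first exact: undup_uniq.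
by move=> x; rewrite mem_undup => /mapP[v _ ->]; rewrite inE all1.
Qed.

Lemma side_incident e e' v v' : e' != e -> incident e v -> incident e v' ->
  side e' v = side e' v'.
Proof.
move=> ne; have := side_ends ne.
by move=> H /orP[]/eqP<- /orP[]/eqP<-.
Qed.

(* Two distinct edges cut a tree into three parts: beyond [e], beyond [e'] and
   between them. *)
Lemma side_far e e' (v z z' : V) : e != e' -> incident e z -> incident e' z' ->
  side e v != side e z' -> side e' v = side e' z.
Proof.
move=> ne iz iz'; have ne' : e' != e by rewrite eq_sym.
have : [pred v : V | (side e v == side e z') || (side e' v == side e' z)] =1 predT.
  move=> u; apply: (tree_ind (v0 := z)) => /=; first by rewrite eqxx orbT.
  move=> f.
  case: (eqVneq f e) => [->|nfe].
    rewrite (side_incident (v := (ends e).1) (v' := z) ne') ?(side_incident (v := (ends e).2) (v' := z) ne') //.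
    - by rewrite eqxx !orbT.
    - by rewrite /incident eqxx orbT.
    by rewrite /incident eqxx.
  case: (eqVneq f e') => [->|nfe'].
    rewrite (side_incident (v := (ends e').1) (v' := z') ne) ?(side_incident (v := (ends e').2) (v' := z') ne) //.
    - by rewrite eqxx.
    - by rewrite /incident eqxx orbT.
    by rewrite /incident eqxx.
  by rewrite (side_ends (e := f) (e' := e)) 1?eq_sym // (side_ends (e := f) (e' := e')) 1?eq_sym.
move=> /(_ v) /=; case: (side e v == side e z') => //= /eqP.
by move=> ->.
Qed.

Lemma side_incident_neq e (v v' : V) : incident e v -> incident e v' -> v != v' ->
  side e v != side e v'.
Proof.
have := side1 e; have := side2 e => s2 s1.
by move=> /orP[]/eqP<- /orP[]/eqP<-; rewrite ?eqxx // ?s1 ?s2.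
Qed.

Lemma incident_other e z : incident e z ->
  exists z', incident e z' /\ side e z' != side e z.
Proof.
have := side1 e; have := side2 e => s2 s1.
case/orP => /eqP <-.
  by exists (ends e).2; rewrite /incident eqxx orbT s1 s2.
by exists (ends e).1; rewrite /incident eqxx s1 s2.
Qed.

Lemma separating_edge (a b : V) : a != b ->
  exists e, incident e a /\ side e a != side e b.
Proof.
have : [pred v : V | (v == a) || [exists e, incident e a && (side e a != side e v)]] =1 predT.
  have H e (x y : V) : incident e x -> incident e y ->
      (x == a) || [exists e, incident e a && (side e a != side e x)] ->
      (y == a) || [exists e, incident e a && (side e a != side e y)].
    move=> ix iy.
    case: (eqVneq y a) => [//|ya] /=.
    case: (eqVneq x a) => [xa _|xa] /=.
      by apply/existsP; exists e; rewrite -xa ix side_incident_neq // eq_sym xa.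
    move=> /existsP[f /andP[fa sf]]; apply/existsP; exists f; rewrite fa /=.
    case: (eqVneq e f) => [ef|ef].
      by rewrite -ef in fa *; rewrite side_incident_neq // eq_sym.
    by rewrite -(@side_incident e f x y) // eq_sym.
  move=> u; apply: (tree_ind (v0 := a)) => [|e] /=; first by rewrite eqxx.
  have i1 : incident e (ends e).1 by rewrite /incident eqxx.
  have i2 : incident e (ends e).2 by rewrite /incident eqxx orbT.
  by apply/idP/idP; apply: (H e).
move=> /(_ b) /= H ab; move: H; rewrite eq_sym (negbTE ab) /= => /existsP[e /andP[]].
by exists e.
Qed.

Lemma edge_in_mem e (a z : V) q : edge_in ends e z q -> incident e a -> a \in z :: q.
Proof.
rewrite /edge_in; elim: q z => [|y q IH] z //= /orP[|] H ia; last first.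
  by rewrite inE (IH y) ?orbT.
case/orP: H => /eqP Ee; move: ia; rewrite /incident Ee /= !inE ![_ == a]eq_sym.
  by case/orP => ->; rewrite ?orbT.
by case/orP => ->; rewrite ?orbT.
Qed.

Lemma path_edge_in e (a : V) q : uniq (a :: q) -> path (adj ends) a q ->
  edge_in ends e a q = (side e a != side e (last a q)).
Proof.
elim: q a => [|z q IH] a; first by rewrite /edge_in /= eqxx.
rewrite cons_uniq => /andP[az uz] /= /andP[/existsP[f Hf] pz].
have hit g : (ends g == (a, z)) || (ends g == (z, a)) -> incident g a /\ incident g z.
  by rewrite /incident => /orP[]/eqP-> /=; rewrite !eqxx ?orbT.
have -> : edge_in ends e a (z :: q) =
    ((ends e == (a, z)) || (ends e == (z, a))) || edge_in ends e z q by [].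
have naz : a != z by apply: contraNneq az => ->; rewrite inE eqxx.
case: (boolP ((ends e == (a, z)) || (ends e == (z, a)))) => [/hit[ia iz]|nhit] /=.
  have nz : edge_in ends e z q = false.
    by apply/negbTE/negP => /edge_in_mem/(_ ia); rewrite (negbTE az).
  have := IH z uz pz; rewrite nz => /esym/negbFE/eqP <-.
  by rewrite side_incident_neq.
have [ia iz] := hit _ Hf.
rewrite (IH z uz pz) (side_incident (e := f) (v := a) (v' := z)) //.
by apply: contraNneq nhit => ->.
Qed.

Lemma on_path_side e (a b : V) : on_path ends e a b = (side e a != side e b).
Proof.
apply/idP/idP => [/existsP[k /existsP[p /and4P[u q /eqP l]]]|sab].
  by rewrite (path_edge_in e u q) l.
have /andP[_ /forallP/(_ a)/forallP/(_ b)/connectP[p0 path0 Eb]] := tree.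
move: Eb; case: (shortenP path0) => p pp up _ Eb.
have szp : (size p < n)%N.
  by have := max_card [in a :: p]; rewrite (card_uniqP up) card_ord.
have szt : size (p ++ nseq (n - size p) a) == n.
  by rewrite size_cat size_nseq subnKC // ltnW.
apply/existsP; exists (Ordinal (leqW szp)); apply/existsP; exists (Tuple szt).
change (let q := take (size p) (p ++ nseq (n - size p) a) in
  [&& uniq (a :: q), path (adj ends) a q, last a q == b & edge_in ends e a q]).
by cbv zeta; rewrite take_size_cat // up pp -Eb eqxx path_edge_in // -Eb sab.
Qed.

(* A smallest side of a cut contained in the given one is a single leaf. *)
Lemma leaf_side e z : incident e z ->
  exists v : V, degree ends v == 1%N /\ side e v = side e z.
Proof.
have [m] := ubnP #|[set v : V | side e v == side e z]|.
elim: m e z => // m IH e z Hm iz.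
case: (boolP (degree ends z == 1%N)) => [dz|dz]; first by exists z.
have /existsP[f /andP[fe fz]] : [exists f, (f != e) && incident f z].
  apply: contraNT dz => /existsPn H; apply/cards1P.
  exists e; apply/setP => f; rewrite !inE; have := H f; rewrite -/(incident f z).
  by case: (eqVneq f e) => [-> _|_] //= /negbTE.
have [z' [iz' nz']] := incident_other fz.
have far (v : V) : side f v = side f z' -> side e v = side e z.
  move=> sv; apply: (@side_far f e v z z) => //.
  by rewrite sv.
have [|v [dv sv]] := IH f z' _ iz'; last by exists v; split=> //; apply: far.
rewrite -ltnS; apply: leq_trans Hm; rewrite ltnS; apply: proper_card; apply/properP; split.
  by apply/subsetP => v; rewrite !inE => /eqP/far->.
by exists z; rewrite !inE ?eqxx // eq_sym.
Qed.

(* The edges of the smallest subtree containing [us]. *)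
Definition span (us : seq V) : {set E} :=
  [set e : E | 0 < count (fun v : V => side e v) us < size us]%N.

Lemma spanP (us : seq V) e :
  reflect (exists u v : V, [/\ u \in us, v \in us & side e u != side e v]) (e \in span us).
Proof.
rewrite inE -has_count -(count_predC (fun v : V => side e v) us) -[X in (X < _)%N]addn0.
rewrite ltn_add2l -has_count; apply: (iffP andP).
  by move=> [/hasP[u uu su] /hasP[v vv sv]]; exists u, v; split=> //; rewrite su.
move=> [u [v [uu vv]]]; case: (boolP (side e u)) => su sv.
  by split; apply/hasP; [exists u|exists v => //=]; rewrite //; case: (side e v) sv.
by split; apply/hasP; [exists v|exists u => //=]; rewrite //; case: (side e v) sv.
Qed.

(* For an end [z] of [e], projecting a tuple spanning a subtree gives a tuple of
   the same length spanning the part of the subtree on the side of [z]. *)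
Definition proj e (z v : V) : V := if side e v == side e z then v else z.

Lemma side_proj e z v : side e (proj e z v) = side e z.
Proof. by rewrite /proj; case: eqP. Qed.

Lemma span_proj e z us : incident e z ->
  span [seq proj e z v | v <- us] =
  [set e' in span us | (e' != e) && (side e (ends e').1 == side e z)].
Proof.
move=> iz; apply/setP => f; rewrite !inE count_map size_map /=.
case: (eqVneq f e) => [->|fe] /=.
  rewrite andbF; apply/negbTE; rewrite negb_and -!leqNgt.
  rewrite (@eq_count _ _ (fun _ => side e z)); last by move=> v; rewrite /= side_proj.
  by case: (side e z); rewrite ?count_predT ?leqnn ?orbT // count_pred0.
have if1 : incident f (ends f).1 by rewrite /incident eqxx.
have ef : e != f by rewrite eq_sym.
case: (eqVneq (side e (ends f).1) (side e z)) => sf; rewrite ?andbT ?andbF.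
  rewrite (@eq_count _ _ (fun v : V => side f v)) // => v /=.
  rewrite /proj; case: eqP => [//|/eqP sv].
  by rewrite (@side_far e f v z (ends f).1) // sf.
rewrite (@eq_count _ _ (fun _ => side f z)).
  apply/negbTE; rewrite negb_and -!leqNgt.
  by case: (side f z); rewrite ?count_predT ?leqnn ?orbT // count_pred0.
move=> v /=; rewrite (@side_far e f (proj e z v) z (ends f).1) //.
by rewrite side_proj eq_sym.
Qed.

Lemma span_full l : (1 < n)%N -> (nleaves ends <= l)%N ->
  exists us, size us = l /\ span us = setT.
Proof.
move=> n1 nl; have n2 : (0 < n.-1)%N by lia.
have [v0 [dv0 _]] := @leaf_side (Ordinal n2) (ends (Ordinal n2)).1 (introT orP (or_introl (eqxx _))).
pose L := enum [set v | degree ends v == 1%N].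
exists (L ++ nseq (l - size L) v0); split.
  by rewrite size_cat size_nseq subnKC // -cardE.
apply/setP => e; rewrite [RHS]inE; apply/spanP.
have [u [du su]] := @leaf_side e (ends e).1 (introT orP (or_introl (eqxx _))).
have [v [dv sv]] := @leaf_side e (ends e).2 (introT orP (or_intror (eqxx _))).
by exists u, v; rewrite !mem_cat !mem_enum !inE du dv su sv side1 side2.
Qed.

Lemma two_leaves : (1 < n)%N -> (1 < nleaves ends)%N.
Proof.
move=> n1; have n2 : (0 < n.-1)%N by lia.
have [u [du su]] := @leaf_side (Ordinal n2) (ends (Ordinal n2)).1 (introT orP (or_introl (eqxx _))).
have [v [dv sv]] := @leaf_side (Ordinal n2) (ends (Ordinal n2)).2 (introT orP (or_intror (eqxx _))).
apply/card_gt1P; exists u, v; rewrite !inE du dv; split=> //.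
by apply/eqP => uv; move: sv; rewrite -uv su side1 side2.
Qed.

Definition sep (a b : V) : {set E} := [set e | side e a != side e b].

Lemma sep_neq0 a b : a != b -> sep a b != set0.
Proof.
by move=> /separating_edge[e [_ se]]; apply/set0Pn; exists e; rewrite inE.
Qed.

Definition touched us (v : V) := [exists e in span us, incident e v].

Lemma sep_sub_span us (a b : V) : a != b ->
  (sep a b \subset span us) = touched us a && touched us b.
Proof.
move=> ab; apply/idP/idP => [/subsetP H|/andP[/exists_inP[f fu fa] /exists_inP[h hu hb]]].
  have [e [ea sab]] := separating_edge ab.
  have [f [fb sba]] : exists e, incident e b /\ side e b != side e a.
    by apply: separating_edge; rewrite eq_sym.
  apply/andP; split; apply/exists_inP; [exists e|exists f] => //; apply: H; rewrite inE //.
  by rewrite eq_sym.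
have toward e k v : incident k v -> k \in span us -> e != k ->
    exists2 u, u \in us & side e u = side e v.
  move=> kv ku ek.
  have ie : incident e (ends e).1 by rewrite /incident eqxx.
  have /spanP[u1 [u2 [uu1 uu2 s12]]] := ku.
  have [u [uu su]] : exists u, u \in us /\ side k u != side k (ends e).1.
    case: (eqVneq (side k u1) (side k (ends e).1)) => s1; last by exists u1.
    by exists u2; rewrite -s1 eq_sym.
  by exists u => //; apply: (@side_far k e u v (ends e).1); rewrite // eq_sym.
apply/subsetP => e; rewrite inE => sab.
case: (eqVneq e f) => [->//|ef]; case: (eqVneq e h) => [->//|eh].
have [u uu su] := toward e f a fa fu ef.
have [v vu sv] := toward e h b hb hu eh.
by apply/spanP; exists u, v; rewrite su sv.
Qed.

Section Reward.
Variables (R : realType) (w : 'I_n -> 'I_n -> R).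
Hypothesis w_ge0 : forall u v, 0 <= w u v.

Definition reward (A : {set E}) : R :=
  \sum_(a : V) \sum_(b : V | (a < b)%N) (if sep a b \subset A then w a b else 0).

Lemma reward_supermodular : supermodular reward.
Proof.
move=> A B; rewrite /reward -!big_split /=; apply: ler_sum => a _.
rewrite -!big_split /=; apply: ler_sum => b _; rewrite subsetI.
case: (boolP (sep a b \subset A)) => sA; case: (boolP (sep a b \subset B)) => sB /=;
  rewrite ?addr0 ?add0r ?(subset_trans sA (subsetUl _ _)) ?(subset_trans sB (subsetUr _ _)) ?lexx //.
by case: ifP.
Qed.

Lemma reward0 : reward set0 = 0.
Proof.
rewrite /reward big1 // => a _; rewrite big1 // => b ab.
by rewrite subset0 (negbTE (sep_neq0 _)) // neq_ltn ab.
Qed.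

Lemma reward_span us : reward (span us) =
  \sum_(a : V) \sum_(b : V | (a < b)%N && touched us a && touched us b) w a b.
Proof.
apply: eq_bigr => a _; rewrite [RHS]big_mkcond [LHS]big_mkcond; apply: eq_bigr => b _.
case: ltnP => //= ab; rewrite sep_sub_span //.
by rewrite neq_ltn ab.
Qed.

Variables (us : seq V) (e : E).
Let A1 := span [seq proj e (ends e).1 v | v <- us].
Let A2 := span [seq proj e (ends e).2 v | v <- us].

Let A1E : A1 = [set f in span us | (f != e) && side e (ends f).1].
Proof.
rewrite /A1 span_proj; last by rewrite /incident eqxx.
by apply/setP => f; rewrite !inE side1 eqb_id.
Qed.

Let A2E : A2 = [set f in span us | (f != e) && ~~ side e (ends f).1].
Proof.
rewrite /A2 span_proj; last by rewrite /incident eqxx orbT.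
by apply/setP => f; rewrite !inE side2 eqbF_neg.
Qed.

Lemma span_split : span us :\ e = A1 :|: A2.
Proof.
apply/setP => f; rewrite A1E A2E !inE.
by case: (f == e); case: (side e _); rewrite ?andbT ?andbF ?orbF.
Qed.

Lemma span_disjoint : [disjoint A1 & A2].
Proof.
rewrite -setI_eq0; apply/eqP/setP => f; rewrite A1E A2E !inE.
by case: (side e _); rewrite ?andbF.
Qed.

Lemma reward_sum (P : {set E}) : P \subset A1 :|: A2 ->
  reward P = reward (P :&: A1) + reward (P :&: A2).
Proof.
move=> /subsetP sP; rewrite /reward -big_split /=; apply: eq_bigr => a _.
rewrite -big_split /=; apply: eq_bigr => b ab.
have nab : a != b by rewrite neq_ltn ab.
have /set0Pn[f0 f0s] := sep_neq0 nab.
rewrite !subsetI; case: (boolP (sep a b \subset P)) => /= [/subsetP sabP|_]; last by rewrite addr0.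
have PA f : f \in sep a b -> (f != e) && (f \in span us).
  by move=> /sabP/sP; rewrite A1E A2E !inE => /orP[]/and3P[-> ->].
have sab : side e a = side e b.
  by case: (eqVneq (side e a) (side e b)) => // nsab; have := PA e; rewrite inE nsab eqxx => /(_ isT).
have sf f : f \in sep a b -> side e (ends f).1 = side e a.
  move=> fs; have /andP[fe _] := PA _ fs; case: (eqVneq (side e (ends f).1) (side e a)) => // nsf; move: fs; apply: contraTeq => _.
  have if1 : incident f (ends f).1 by rewrite /incident eqxx.
  have ie1 : incident e (ends e).1 by rewrite /incident eqxx.
  have ef : e != f by rewrite eq_sym.
  rewrite inE negbK (@side_far e f a (ends e).1 (ends f).1) // 1?eq_sym //.
  by rewrite (@side_far e f b (ends e).1 (ends f).1) // -sab eq_sym.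
have E1 : (sep a b \subset A1) = side e a.
  apply/idP/idP => [/subsetP/(_ _ f0s)|sa]; first by rewrite A1E !inE -(sf _ f0s) => /and3P[].
  apply/subsetP => f fs; have /andP[fe fu] := PA _ fs.
  by rewrite A1E in_set fu fe sf.
have E2 : (sep a b \subset A2) = ~~ side e a.
  apply/idP/idP => [/subsetP/(_ _ f0s)|sa]; first by rewrite A2E !inE -(sf _ f0s) => /and3P[].
  apply/subsetP => f fs; have /andP[fe fu] := PA _ fs.
  by rewrite A2E in_set fu fe sf.
by rewrite E1 E2; case: (side e a); rewrite /= ?addr0 ?add0r.
Qed.

End Reward.
End Cuts.

Section Objective.
Variables (R : realType) (n : nat) (ends : 'I_n.-1 -> 'I_n * 'I_n).
Variables (c : 'I_n.-1 -> R) (w : 'I_n -> 'I_n -> R).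
Hypothesis tree : is_tree ends.
Hypothesis c_gt0 : forall e, 0 < c e.
Hypothesis w_ge0 : forall u v, 0 <= w u v.

Definition before (sigma : {perm 'I_n.-1}) (j : nat) : {set 'I_n.-1} :=
  [set e | ((sigma^-1)%g e < j)%N].

Lemma conn_time_sum sigma (a b : 'I_n) : a != b ->
  conn_time ends c sigma a b =
  \sum_(j : 'I_n.-1) c (sigma j) * (~~ (sep ends a b \subset before sigma j))%:R.
Proof.
move=> ab; have /set0Pn[e0 e0s] := sep_neq0 tree ab.
have [e es emax] := @arg_maxnP _ e0 (fun e => e \in sep ends a b)
  (fun e => nat_of_ord ((sigma^-1)%g e)) e0s.
have -> : \sum_(j : 'I_n.-1) c (sigma j) * (~~ (sep ends a b \subset before sigma j))%:R
        = completion c sigma e.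
  rewrite /completion [RHS]big_mkcond; apply: eq_bigr => j _.
  have -> : (sep ends a b \subset before sigma j) = ((sigma^-1)%g e < j)%N.
    apply/subsetP/idP => [/(_ _ es)|H f fs]; first by rewrite inE.
    by rewrite inE; apply: leq_ltn_trans H; apply: emax.
  by rewrite -leqNgt; case: leqP; rewrite ?mulr1 ?mulr0.
apply/le_anti/andP; split; last first.
  by apply: le_bigmax_cond; rewrite (on_path_side tree); move: es; rewrite /= inE.
apply: bigmax_le => [|f].
  by apply: sumr_ge0 => j _; apply: ltW.
rewrite (on_path_side tree) => fs.
have : ((sigma^-1)%g f <= (sigma^-1)%g e)%N by apply: emax; rewrite /= inE.
move=> fe; rewrite /completion [leLHS]big_mkcond [leRHS]big_mkcond.
apply: ler_sum => j _; case: leqP => jf; first by rewrite (leq_trans jf fe).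
by case: ifP => // _; apply: ltW.
Qed.

Lemma pcost_nth (g : {set 'I_n.-1} -> R) P r x0 :
  pcost c g P r =
  - \sum_(i < size r) c (nth x0 r i) * g (P :|: [set x in take i r]).
Proof.
elim: r P => [|e r IH] P /=; first by rewrite big_ord0 oppr0.
rewrite big_ord_recl /= IH set_ordering0 opprD; congr (_ - _).
apply: eq_bigr => i _; congr (_ * g _).
by apply/setP => x; rewrite !inE orbCA orbA.
Qed.

Lemma objective_pcost sigma :
  objective ends c w sigma =
  csum c setT * reward ends w setT
  + pcost c (reward ends w) set0 [seq sigma j | j <- enum 'I_n.-1].
Proof.
have -> : pcost c (reward ends w) set0 [seq sigma j | j <- enum 'I_n.-1] =
    - \sum_j c (sigma j) * reward ends w (before sigma j).
  case: (posnP n.-1) => [m0|m0].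
    have no : 'I_n.-1 -> False by rewrite m0 => -[].
    rewrite [in RHS]big1 ?oppr0; last by move=> j; case: (no j).
    by case: (enum 'I_n.-1) => // j; case: (no j).
  rewrite (pcost_nth _ _ _ (sigma (Ordinal m0))) size_map size_enum_ord; congr (- _).
  apply: eq_bigr => i _; rewrite (nth_map (Ordinal m0)) ?size_enum_ord // nth_ord_enum.
  congr (_ * reward _ _ _); rewrite set0U; apply/setP => e; rewrite !inE.
  rewrite -map_take; apply/mapP/idP => [[j jt ->]|H].
    rewrite permK; move: jt; rewrite -(mem_map val_inj) map_take val_enum_ord take_iota.
    by rewrite mem_iota add0n => /andP[_ H]; apply: leq_trans H (geq_minl _ _).
  exists ((sigma^-1)%g e); last by rewrite permKV.
  rewrite -(mem_map val_inj) map_take val_enum_ord take_iota mem_iota add0n /=.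
  by rewrite leq_min H ltn_ord.
have -> : csum c setT = \sum_j c (sigma j).
  rewrite /csum (reindex_inj (@perm_inj _ sigma)) /=.
  by apply: eq_bigl => j; rewrite inE.
rewrite mulr_suml -sumrB.
under [RHS]eq_bigr => j _.
  rewrite -mulrBr /reward -sumrB.
  under eq_bigr => a _ do rewrite -sumrB.
  rewrite mulr_sumr; under eq_bigr => a _ do rewrite mulr_sumr.
  over.
rewrite exchange_big /= /objective; apply: eq_bigr => a _.
rewrite exchange_big /= [LHS]big_mkcond [RHS]big_mkcond; apply: eq_bigr => b _.
case: ltnP => //= ab; rewrite conn_time_sum; last by rewrite neq_ltn ab.
have E : w a b * (\sum_j c (sigma j) * (~~ (sep ends a b \subset before sigma j))%:R) =
    \sum_j c (sigma j) * ((if sep ends a b \subset setT then w a b else 0) -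
      (if sep ends a b \subset before sigma j then w a b else 0)).
  rewrite subsetT mulr_sumr; apply: eq_bigr => j _.
  by case: (_ \subset _) => /=; ring.
case: ifP => [_|w0]; first exact: E.
rewrite -E; have -> : w a b = 0 by apply/le_anti; rewrite w_ge0 andbT leNgt w0.
by rewrite mul0r.
Qed.

Lemma opt_ordering_optimal r :
  opt_ordering c (reward ends w) setT r ->
  exists sigma : {perm 'I_n.-1},
    [seq sigma j | j <- enum 'I_n.-1] = r /\ optimal ends c w sigma.
Proof.
move=> [[ur er] optr].
have szr : size r = n.-1.
  by rewrite -[RHS]card_ord -cardsT -er cardsE (card_uniqP ur).
have ordp (sigma : {perm 'I_n.-1}) : ordering setT [seq sigma j | j <- enum 'I_n.-1].
  split; first by rewrite map_inj_uniq ?enum_uniq //; apply: perm_inj.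
  apply/setP => x; rewrite !inE; apply/mapP; exists ((sigma^-1)%g x); rewrite ?mem_enum //.
  by rewrite permKV.
pose f (j : 'I_n.-1) := nth j r j.
have f_inj : injective f.
  move=> i j; rewrite /f (set_nth_default j) ?szr // => /eqP.
  by rewrite nth_uniq ?szr // => /eqP/val_inj.
have mapf : [seq perm f_inj j | j <- enum 'I_n.-1] = r.
  case: (posnP n.-1) => [m0|m0].
    rewrite [RHS](size0nil (etrans szr m0)); apply: size0nil.
    by rewrite size_map size_enum_ord.
  apply: (@eq_from_nth _ (Ordinal m0)); first by rewrite size_map size_enum_ord szr.
  move=> i; rewrite size_map size_enum_ord => im.
  rewrite (nth_map (Ordinal m0)) ?size_enum_ord // permE /f.
  have -> : nth (Ordinal m0) (enum 'I_n.-1) i = Ordinal im.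
    by apply: val_inj; rewrite /= nth_enum_ord.
  by apply: set_nth_default; rewrite szr.
exists (perm f_inj); split=> // sigma'.
by rewrite !objective_pcost mapf lerD2l; apply: optr.
Qed.

End Objective.

Arguments upd {T} f x v /.

(** * Reasoning about programs *)

Fixpoint mvars (c : cmd) : seq nat :=
  match c with
  | CNSet x _ => [:: x]
  | CSeq c1 c2 | CIf _ c1 c2 => mvars c1 ++ mvars c2
  | CWhile _ c1 => mvars c1
  | _ => [::]
  end.

Fixpoint mnarrs (c : cmd) : seq nat :=
  match c with
  | CNWrite a _ _ => [:: a]
  | CSeq c1 c2 | CIf _ c1 c2 => mnarrs c1 ++ mnarrs c2
  | CWhile _ c1 => mnarrs c1
  | _ => [::]
  end.

Fixpoint mrarrs (c : cmd) : seq nat :=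
  match c with
  | CRWrite a _ _ => [:: a]
  | CSeq c1 c2 | CIf _ c1 c2 => mrarrs c1 ++ mrarrs c2
  | CWhile _ c1 => mrarrs c1
  | _ => [::]
  end.

Definition CFor (x : nat) (hi : nexp) (body : cmd) : cmd :=
  CSeq (CNSet x (NLit 0))
    (CWhile (BNLt (NVar x) hi) (CSeq body (CNSet x (NPlus (NVar x) (NLit 1))))).

Section Runs.
Variable R : realType.
Implicit Types (c : cmd) (s : state R) (Q : state R -> Prop).

Definition frame c s s' :=
  [/\ forall x, x \notin mvars c -> nvar s' x = nvar s x,
      forall a, a \notin mnarrs c -> narr s' a = narr s a &
      forall a, a \notin mrarrs c -> rarr s' a = rarr s a].

Lemma exec_frame c s k s' : exec c s k s' -> frame c s s'.
Proof.
elim=> {c s k s'} //=.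
- by move=> x e s; split=> //= y; rewrite inE => /negbTE->.
- by move=> a i e s; split=> //= y; rewrite inE => /negbTE->.
- by move=> a i e s; split=> //= y; rewrite inE => /negbTE->.
- move=> c1 c2 s s1 s2 k1 k2 _ [a1 a2 a3] _ [b1 b2 b3].
  by split=> x /=; rewrite mem_cat negb_or => /andP[xa xb]; rewrite ?b1 ?b2 ?b3 ?a1 ?a2 ?a3.
- move=> b c1 c2 s s' k _ _ [a1 a2 a3].
  by split=> x /=; rewrite mem_cat negb_or => /andP[xa xb]; rewrite ?a1 ?a2 ?a3.
- move=> b c1 c2 s s' k _ _ [a1 a2 a3].
  by split=> x /=; rewrite mem_cat negb_or => /andP[xa xb]; rewrite ?a1 ?a2 ?a3.
move=> b c s s1 s2 k1 k2 _ _ [a1 a2 a3] _ [b1 b2 b3].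
by split=> x /= xa; rewrite ?b1 ?b2 ?b3 ?a1 ?a2 ?a3.
Qed.

Definition runs c s (B : nat) Q := exists s' k, [/\ exec c s k s', (k <= B)%N & Q s'].

Lemma runs_imp c s B B' Q Q' : runs c s B Q -> (B <= B')%N ->
  (forall s', frame c s s' -> Q s' -> Q' s') -> runs c s B' Q'.
Proof.
move=> [s' [k [ex kB Qs]]] BB imp; exists s', k; split=> //; first exact: leq_trans BB.
by apply: imp => //; apply: exec_frame ex.
Qed.

Lemma runs_le c s B B' Q : runs c s B Q -> (B <= B')%N -> runs c s B' Q.
Proof. by move=> H BB; apply: runs_imp H BB _. Qed.

Lemma runs_skip s Q : Q s -> runs CSkip s 1 Q.
Proof. by exists s, 1%N; split=> //; apply: ExSkip. Qed.

Lemma runs_nset x e s Q :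
  Q (State (upd (nvar s) x (neval s e)) (narr s) (rarr s)) -> runs (CNSet x e) s 1 Q.
Proof. by eexists _, _; split; [exact: ExNSet|by []|by []]. Qed.

Lemma runs_nwrite a i e s Q :
  Q (State (nvar s) (upd (narr s) a (upd (narr s a) (neval s i) (neval s e))) (rarr s)) ->
  runs (CNWrite a i e) s 1 Q.
Proof. by eexists _, _; split; [exact: ExNWrite|by []|by []]. Qed.

Lemma runs_rwrite a i e s Q :
  Q (State (nvar s) (narr s) (upd (rarr s) a (upd (rarr s a) (neval s i) (reval s e)))) ->
  runs (CRWrite a i e) s 1 Q.
Proof. by eexists _, _; split; [exact: ExRWrite|by []|by []]. Qed.

Lemma runs_seq c1 c2 s B1 B2 Q :
  runs c1 s B1 (fun s1 => runs c2 s1 B2 Q) -> runs (CSeq c1 c2) s (B1 + B2).+1 Q.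
Proof.
move=> [s1 [k1 [e1 b1 [s2 [k2 [e2 b2 Qs]]]]]]; exists s2, (k1 + k2).+1.
by split=> //; [apply: ExSeq e1 e2|rewrite ltnS leq_add].
Qed.

Lemma runs_ifT b c1 c2 s B Q : beval s b -> runs c1 s B Q -> runs (CIf b c1 c2) s B.+1 Q.
Proof.
by move=> bs [s1 [k1 [e1 b1 Qs]]]; exists s1, k1.+1; split=> //; apply: ExIfT.
Qed.

Lemma runs_ifF b c1 c2 s B Q : ~~ beval s b -> runs c2 s B Q -> runs (CIf b c1 c2) s B.+1 Q.
Proof.
by move=> bs [s1 [k1 [e1 b1 Qs]]]; exists s1, k1.+1; split=> //; apply: ExIfF.
Qed.

Lemma runs_if b c1 c2 s B1 B2 Q :
  (beval s b -> runs c1 s B1 Q) -> (~~ beval s b -> runs c2 s B2 Q) ->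
  runs (CIf b c1 c2) s (B1 + B2).+1 Q.
Proof.
move=> HT HF; case: (boolP (beval s b)) => bs.
  by apply: runs_ifT => //; apply: runs_le (HT bs) (leq_addr _ _).
by apply: runs_ifF => //; apply: runs_le (HF bs) (leq_addl _ _).
Qed.

Definition setv s x v : state R := State (upd (nvar s) x v) (narr s) (rarr s).

Lemma frame_trans c s1 s2 s3 : frame c s1 s2 -> frame c s2 s3 -> frame c s1 s3.
Proof.
by move=> [a1 a2 a3] [b1 b2 b3]; split=> x xc; rewrite ?b1 ?b2 ?b3 ?a1 ?a2 ?a3.
Qed.

Lemma runs_for x hi body s m (B : nat -> nat) (I : nat -> state R -> Prop) Q :
  x \notin mvars body ->
  (forall i s1, (i <= m)%N -> nvar s1 x = i -> frame (CFor x hi body) s s1 -> I i s1 ->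
     neval s1 hi = m) ->
  I 0%N (setv s x 0) ->
  (forall i s1, (i < m)%N -> nvar s1 x = i -> frame (CFor x hi body) s s1 -> I i s1 ->
     runs body s1 (B i) (fun s2 => I i.+1 (setv s2 x i.+1))) ->
  (forall s1, frame (CFor x hi body) s s1 -> I m s1 -> Q s1) ->
  runs (CFor x hi body) s (3 + \sum_(i < m) (B i + 3)) Q.
Proof.
move=> xb hiE I0 Istep IQ; set F := frame (CFor x hi body) s.
pose W := CWhile (BNLt (NVar x) hi) (CSeq body (CNSet x (NPlus (NVar x) (NLit 1)))).
have F0 : F (setv s x 0) by split=> //= y; rewrite inE => /norP[/negbTE->].
have FW : frame W (setv s x 0) (setv s x 0) by [].
suff H i s1 : (i <= m)%N -> nvar s1 x = i -> F s1 -> I i s1 ->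
    runs W s1 (1 + \sum_(i <= j < m) (B j + 3)) Q.
  apply: (@runs_le _ _ (1 + (1 + \sum_(0 <= j < m) (B j + 3))).+1); last first.
    by rewrite big_mkord; lia.
  apply: runs_seq; apply: runs_nset; apply: H => //=.
  by rewrite eqxx.
move=> im; rewrite -(subKn im); move: (m - i)%N (leq_subr i m) => {im}k.
elim: k s1 => [|k IH] s1 km.
  rewrite subn0 => xs Fs Is; rewrite big_geq // addn0.
  exists s1, 1%N; split=> //; last exact: IQ.
  by apply: ExWhileF; rewrite /= xs (hiE m s1) // ltnn.
move=> xs Fs Is; have lt : (m - k.+1 < m)%N by lia.
have [s2 [k2 [e2 b2 Is2]]] := Istep _ _ lt xs Fs Is.
have fr2 := exec_frame e2.
have x2 : nvar s2 x = (m - k.+1)%N by case: fr2 => -> //.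
have F2 : F (setv s2 x (m - k.+1).+1).
  apply: frame_trans Fs _; case: fr2 => [a1 a2 a3]; split=> y /=.
  - rewrite inE mem_cat inE !negb_or => /and3P[yx yb _]; rewrite (negbTE yx) a1 //.
  - by rewrite cats0; apply: a2.
  by rewrite cats0; apply: a3.
have Em : ((m - k.+1).+1 = m - k)%N by lia.
rewrite Em in Is2 F2.
have [||s3 [k3 [e3 b3 Qs]]] := IH (setv s2 x (m - k)%N) _ _ F2 Is2.
- by lia.
- by rewrite /= eqxx.
exists s3, ((k2 + 1).+1 + k3).+1; split=> //.
  apply: (ExWhileT (s1 := setv s2 x (m - k)%N)).
  - by rewrite /= xs (hiE _ _ (ltnW lt) xs).
  - apply: (ExSeq e2).
    have -> : setv s2 x (m - k)%N = State (upd (nvar s2) x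
        (neval s2 (NPlus (NVar x) (NLit 1)))) (narr s2) (rarr s2).
      by rewrite /setv /= x2 addn1 Em.
    exact: ExNSet.
  exact: e3.
by rewrite (@big_ltn _ _ _ (m - k.+1)) // Em; lia.
Qed.

Lemma runs_for_const x hi body s m B (I : nat -> state R -> Prop) Q :
  x \notin mvars body ->
  (forall i s1, (i <= m)%N -> nvar s1 x = i -> frame (CFor x hi body) s s1 -> I i s1 ->
     neval s1 hi = m) ->
  I 0%N (setv s x 0) ->
  (forall i s1, (i < m)%N -> nvar s1 x = i -> frame (CFor x hi body) s s1 -> I i s1 ->
     runs body s1 B (fun s2 => I i.+1 (setv s2 x i.+1))) ->
  (forall s1, frame (CFor x hi body) s s1 -> I m s1 -> Q s1) ->
  runs (CFor x hi body) s (3 + m * (B + 3)) Q.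
Proof.
move=> xb hiE I0 Istep IQ; apply: (@runs_le _ _ (3 + \sum_(i < m) (B + 3))).
  exact: runs_for Istep IQ.
by rewrite sum_nat_const card_ord.
Qed.

End Runs.
Arguments frame : simpl never.
Arguments runs : simpl never.

Section FrameFacts.
Variable R : realType.
Implicit Types (c : cmd) (s : state R).

Lemma frame_v c s s' x : frame c s s' -> x \notin mvars c -> nvar s' x = nvar s x.
Proof. by case=> H _ _; apply: H. Qed.

Lemma frame_n c s s' a : frame c s s' -> a \notin mnarrs c -> narr s' a = narr s a.
Proof. by case=> _ H _; apply: H. Qed.

Lemma frame_r c s s' a : frame c s s' -> a \notin mrarrs c -> rarr s' a = rarr s a.
Proof. by case=> _ _ H; apply: H. Qed.

Lemma frame_seq c1 c2 s s1 s2 : frame c1 s s1 -> frame c2 s1 s2 -> frame (CSeq c1 c2) s s2.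
Proof.
move=> [a1 a2 a3] [b1 b2 b3].
by split=> x /=; rewrite mem_cat negb_or => /andP[xa xb]; rewrite ?b1 ?b2 ?b3 ?a1 ?a2 ?a3.
Qed.

End FrameFacts.

Lemma sum_ord_ltS (R : realType) n i (im : (i < n)%N) (P : pred 'I_n) (F : 'I_n -> R) :
  \sum_(v : 'I_n | (v < i.+1)%N && P v) F v =
  \sum_(v : 'I_n | (v < i)%N && P v) F v + (if P (Ordinal im) then F (Ordinal im) else 0).
Proof.
rewrite [LHS]big_mkcond [X in _ = X + _]big_mkcond (bigD1 (Ordinal im)) //=.
rewrite [X in _ = X + _](bigD1 (Ordinal im)) //= ltnSn ltnn /= add0r addrC; congr (_ + _).
by apply: eq_bigr => v /eqP vi; rewrite ltnS leq_eqVlt; case: eqP => // E;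
  case: vi; apply: val_inj.
Qed.

Lemma sum_ord_lt_all (R : realType) n (P : pred 'I_n) (F : 'I_n -> R) :
  \sum_(v : 'I_n | (v < n)%N && P v) F v = \sum_(v : 'I_n | P v) F v.
Proof. by apply: eq_bigl => v; rewrite ltn_ord. Qed.

Lemma card_ord_ltS m i (im : (i < m)%N) (A : {set 'I_m}) :
  #|[set e in A | (e < i.+1)%N]| = (#|[set e in A | (e < i)%N]| + (Ordinal im \in A))%N.
Proof.
rewrite (cardsD1 (Ordinal im)) !inE /= ltnSn andbT addnC; congr (#|pred_of_set _| + _)%N.
apply/setP => e; rewrite !inE ltnS leq_eqVlt -val_eqE /=.
by case: eqP => [->|_]; rewrite ?ltnn ?andbF.
Qed.

Lemma ltn_pred_exp n l (e : nat) : (e < n.-1)%N -> (0 < l)%N -> (e < n ^ l)%N.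
Proof.
case: l => // l en _; apply: (@leq_trans n); first by lia.
by rewrite expnS leq_pmulr // expn_gt0; lia.
Qed.

Lemma index_inj n (a b v u : nat) : (v < n)%N -> (u < n)%N ->
  (a * n + v == b * n + u)%N = (a == b) && (v == u).
Proof.
move=> vn un; apply/eqP/andP => [E|[/eqP-> /eqP->]] //.
have : ((a * n + v) %/ n = (b * n + u) %/ n)%N by rewrite E.
rewrite !divnMDl ?(leq_ltn_trans _ vn) // !divn_small // !addn0 => ab.
by rewrite ab eqxx; split=> //; apply/eqP; move: E; rewrite ab => /addnI.
Qed.

(** * The program *)

(* Register and array allocation.  Natural registers: 0 holds n, 1 holds n^l,
   2-4 and 9-10 are temporaries, 5-6 run over edges, 7-8 over vertices,
   11 is the round (the number of edges of the subtrees being solved),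
   12 the code of a tuple, 13 the number of edges it spans, 14-15 run over
   positions of an ordering, 16-17 are the codes of the two subtrees left by an
   edge, 18-21 the bounds of their orderings, 22 the first free cell of the
   heap, 23 flags that a candidate was found, 24 ends the current block.
   Natural arrays: 0 input edges, 1 output, 2 multiplication by n, 3 and 4
   remainder and quotient by n, 5 component labels, 6 sides of the cuts,
   7 and 8 projections to the two sides, 9 touched vertices, 10 and 11 size and
   address of the ordering found for a tuple, 12 edges on the heap.
   Real arrays: 0 lengths, 1 weights, 2 reward of the current subtree,
   3 reward still to be collected, 4 cost of the candidate, 5 least cost,
   6 increments on the heap, 7 and 8 length and reward of the block containing a
   heap cell (their quotient is its label), 9-10 the scanned block, 11-12 the
   best block. *)

Definition pow_cmd (l : nat) : cmd :=
  CSeq (CNSet 1 (NLit 1))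
  (CFor 14 (NLit l)
    (CSeq (CNSet 2 (NLit 0))
    (CSeq (CFor 7 (NVar 0) (CNSet 2 (NPlus (NVar 2) (NVar 1))))
          (CNSet 1 (NVar 2))))).

Definition tables_cmd : cmd :=
  CSeq (CNSet 2 (NLit 0)) (CSeq (CNSet 3 (NLit 0)) (CSeq (CNSet 4 (NLit 0))
  (CFor 12 (NVar 1)
    (CSeq (CNWrite 2 (NVar 12) (NVar 2))
    (CSeq (CNWrite 3 (NVar 12) (NVar 4))
    (CSeq (CNWrite 4 (NVar 12) (NVar 3))
    (CSeq (CNSet 2 (NPlus (NVar 2) (NVar 0)))
    (CSeq (CNSet 4 (NPlus (NVar 4) (NLit 1)))
    (CIf (BNEq (NVar 4) (NVar 0))
      (CSeq (CNSet 4 (NLit 0)) (CNSet 3 (NPlus (NVar 3) (NLit 1))))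
      CSkip))))))))).

Definition nexp_end1 (x : nat) : nexp := NRead 0 (NPlus (NVar x) (NVar x)).
Definition nexp_end2 (x : nat) : nexp := NRead 0 (NPlus (NPlus (NVar x) (NVar x)) (NLit 1)).
Definition nexp_edges : nexp := NMinus (NVar 0) (NLit 1).

Definition sides_cmd : cmd :=
  CFor 5 nexp_edges
  (CSeq (CFor 7 (NVar 0) (CNWrite 5 (NVar 7) (NVar 7)))
  (CSeq (CFor 6 nexp_edges
    (CIf (BNEq (NVar 6) (NVar 5)) CSkip
      (CSeq (CNSet 9 (NRead 5 (nexp_end1 6)))
      (CSeq (CNSet 10 (NRead 5 (nexp_end2 6)))
      (CFor 7 (NVar 0)
        (CIf (BNEq (NRead 5 (NVar 7)) (NVar 10)) (CNWrite 5 (NVar 7) (NVar 9)) CSkip))))))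
  (CFor 7 (NVar 0)
    (CIf (BNEq (NRead 5 (NVar 7)) (NRead 5 (nexp_end1 5)))
      (CSeq (CNWrite 6 (NPlus (NRead 2 (NVar 5)) (NVar 7)) (NLit 1))
      (CSeq (CNWrite 7 (NPlus (NRead 2 (NVar 5)) (NVar 7)) (NVar 7))
            (CNWrite 8 (NPlus (NRead 2 (NVar 5)) (NVar 7)) (nexp_end2 5))))
      (CSeq (CNWrite 6 (NPlus (NRead 2 (NVar 5)) (NVar 7)) (NLit 0))
      (CSeq (CNWrite 7 (NPlus (NRead 2 (NVar 5)) (NVar 7)) (nexp_end1 5))
            (CNWrite 8 (NPlus (NRead 2 (NVar 5)) (NVar 7)) (NVar 7)))))))).

Section Precomputation.
Variables (R : realType) (n l : nat) (ends : 'I_n.-1 -> 'I_n * 'I_n).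
Variables (c : 'I_n.-1 -> R) (w : 'I_n -> 'I_n -> R).
Hypothesis n_gt0 : (0 < n)%N.
Hypothesis l_gt0 : (0 < l)%N.

Lemma pow_run (s : state R) : nvar s 0 = n ->
  runs (pow_cmd l) s (6 + l * (4 * n + 12)) (fun s' => nvar s' 1 = (n ^ l)%N).
Proof.
clear n_gt0 l_gt0; move=> n0; eapply runs_le.
  apply: runs_seq; apply: runs_nset => /=.
  apply: (runs_for_const (m := l) (I := fun i s1 => nvar s1 1 = (n ^ i)%N)) => //=.
  move=> i s1 il _ fr s1E; apply: runs_seq; apply: runs_nset => /=.
  apply: runs_seq.
  apply: (runs_for_const (m := n)
    (I := fun j s2 => nvar s2 2 = (j * n ^ i)%N)) => //=.
  - by move=> j s2 _ _ fr2 _; rewrite (frame_v fr2) //= (frame_v fr).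
  - move=> j s2 _ _ fr2 E2; apply: runs_nset; rewrite /= E2.
    by rewrite (frame_v fr2) //= s1E mulSn addnC.
  by move=> s2 fr2 E2; apply: runs_nset; rewrite /= E2 expnS.
by nia.
Qed.

Lemma tables_run (s : state R) : nvar s 0 = n -> nvar s 1 = (n ^ l)%N ->
  runs tables_cmd s (12 + 20 * n ^ l)
    (fun s' => forall k, (k < n ^ l)%N ->
       [/\ narr s' 2 k = (k * n)%N, narr s' 3 k = (k %% n)%N & narr s' 4 k = (k %/ n)%N]).
Proof.
clear l_gt0; move=> n0 n1; eapply runs_le.
  apply: runs_seq; apply: runs_nset; apply: runs_seq; apply: runs_nset.
  apply: runs_seq; apply: runs_nset => /=.
  apply: (runs_for_const (m := (n ^ l)%N)
    (I := fun i s1 => [/\ nvar s1 2 = (i * n)%N, nvar s1 4 = (i %% n)%N, nvar s1 3 = (i %/ n)%N &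
      forall k, (k < i)%N ->
       [/\ narr s1 2 k = (k * n)%N, narr s1 3 k = (k %% n)%N & narr s1 4 k = (k %/ n)%N]])) => //=.
  - by move=> i s1 _ _ fr _; rewrite (frame_v fr).
  - by rewrite mod0n div0n.
  - move=> i s1 im xi fr [E2 E4 E3 T].
    have E0 : nvar s1 0 = n by rewrite (frame_v fr).
    have T' k : (k < i.+1)%N ->
       [/\ (if k == i then (i * n)%N else narr s1 2 k) = (k * n)%N,
           (if k == i then (i %% n)%N else narr s1 3 k) = (k %% n)%N &
           (if k == i then (i %/ n)%N else narr s1 4 k) = (k %/ n)%N].
      by rewrite ltnS leq_eqVlt; case: eqP => [-> //|_ /= /T].
    do 5 (apply: runs_seq; (apply: runs_nwrite || apply: runs_nset)).
    rewrite /= E0 E2 E4 E3 xi.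
    have Si : i.+1 = (i %/ n * n + (i %% n + 1))%N by rewrite addnA -divn_eq addn1.
    apply: runs_if => /= /eqP; rewrite E0 => E.
      have E' : i.+1 = ((i %/ n + 1) * n)%N by rewrite mulnDl mul1n Si E.
      apply: runs_seq; apply: runs_nset; apply: runs_nset; rewrite /= ?E0 ?E2 ?E4 ?E3 ?xi; split=> //.
      + by rewrite mulSn addnC.
      + by rewrite E' modnMl.
      by rewrite [in RHS]E' mulnK.
    have lt : (i %% n + 1 < n)%N.
      by have := ltn_pmod i n_gt0; lia.
    apply: runs_skip; rewrite /= ?E0 ?E2 ?E4 ?E3 ?xi; split=> //.
    + by rewrite mulSn addnC.
    + by rewrite [in RHS]Si modnMDl (modn_small lt).
    by rewrite [in RHS]Si divnMDl // (divn_small lt) addn0.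
  by move=> s1 fr [_ _ _].
by nia.
Qed.

Definition ends_at (s : state R) := forall e : 'I_n.-1,
  narr s 0 (e + e)%N = (ends e).1 /\ narr s 0 (e + e + 1)%N = (ends e).2.

Lemma component_take (e : 'I_n.-1) i (im : (i < n.-1)%N) (v : nat) :
  component ends [seq f <- take i.+1 (enum 'I_n.-1) | f != e] v =
  let f := component ends [seq f <- take i (enum 'I_n.-1) | f != e] in
  if Ordinal im == e then f v
  else relabel f (ends (Ordinal im)).1 (ends (Ordinal im)).2 v.
Proof.
have ie : (i < size (enum 'I_n.-1))%N by rewrite size_enum_ord.
have E : nth (Ordinal im) (enum 'I_n.-1) i = Ordinal im.
  by apply: val_inj; rewrite /= nth_enum_ord.
rewrite (take_nth (Ordinal im) ie) E filter_rcons.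
by case: eqP => //= _; rewrite /component foldl_rcons.
Qed.

Lemma sides_run (s : state R) : nvar s 0 = n -> ends_at s ->
  (forall k, (k < n ^ l)%N -> narr s 2 k = (k * n)%N) ->
  runs sides_cmd s (100 * n ^ 3)
    (fun s' => forall (e : 'I_n.-1) (v : 'I_n),
      [/\ narr s' 6 (e * n + v)%N = side ends e v :> nat,
          narr s' 7 (e * n + v)%N = proj ends e (ends e).1 v &
          narr s' 8 (e * n + v)%N = if side ends e v then (ends e).2 else v]).
Proof.
move=> n0 ends0 mul0; eapply runs_le.
  apply: (runs_for_const (m := n.-1) (I := fun i s1 => forall (e : 'I_n.-1) (v : 'I_n), (e < i)%N ->
      [/\ narr s1 6 (e * n + v)%N = side ends e v :> nat,
          narr s1 7 (e * n + v)%N = proj ends e (ends e).1 v &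
          narr s1 8 (e * n + v)%N = if side ends e v then (ends e).2 else v])) => //=.
  - by move=> i s1 _ _ fr _; rewrite (frame_v fr) //= n0 subn1.
  - move=> i s1 im xi fr I1; pose e := Ordinal im.
    have n1 : nvar s1 0 = n by rewrite (frame_v fr).
    have ends1 : ends_at s1 by move=> f; rewrite (frame_n fr).
    have mul1 : narr s1 2 i = (i * n)%N by rewrite (frame_n fr) // mul0 // (@ltn_pred_exp n l i).
    apply: runs_seq.
    apply: (runs_for_const (m := n) (I := fun j s2 => forall v, (v < j)%N -> narr s2 5 v = v)) => //=.
    + by move=> j s2 _ _ fr2 _; rewrite (frame_v fr2) //=.
    + move=> j s2 _ xj _ I2; apply: runs_nwrite => /= v; rewrite xj ltnS leq_eqVlt.
      by case: eqP => [->|_ /= /I2].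
    move=> s2 fr2 I2; apply: runs_seq.
    apply: (runs_for_const (m := n.-1) (I := fun j s3 => forall v, (v < n)%N ->
        narr s3 5 v = component ends [seq f <- take j (enum 'I_n.-1) | f != e] v)) => //=.
    + by move=> j s3 _ _ fr3 _; rewrite (frame_v fr3) //= (frame_v fr2) //= n1 subn1.
    + by move=> v vn; rewrite take0 /= I2.
    + move=> j s3 jm xj fr3 I3.
      have n3 : nvar s3 0 = n by rewrite (frame_v fr3) //= (frame_v fr2).
      have e3 : nvar s3 5 = i by rewrite (frame_v fr3) //= (frame_v fr2).
      have ends3 : ends_at s3.
        move=> f; rewrite (frame_n fr3) //=; rewrite (frame_n fr2) //; apply: ends1.
      apply: runs_if => /=; rewrite xj e3 => ji.
        apply: runs_skip => v vn /=; rewrite component_take -val_eqE /= ji.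
        exact: I3.
      apply: runs_seq; apply: runs_nset => /=; apply: runs_seq; apply: runs_nset => /=.
      have [en1 en2] := ends3 (Ordinal jm); rewrite /= in en1 en2; rewrite xj en1 en2 !I3 //.
      set cj := component ends [seq f <- take j (enum 'I_n.-1) | f != e].
      set a := cj (ends (Ordinal jm)).1; set b := cj (ends (Ordinal jm)).2.
      apply: (runs_for_const (m := n) (I := fun k s4 => forall v, (v < n)%N ->
        narr s4 5 v = if (v < k)%N then component ends [seq f <- take j.+1 (enum 'I_n.-1) | f != e] v
                     else component ends [seq f <- take j (enum 'I_n.-1) | f != e] v)) => //=.
      * by move=> k s4 _ _ fr4 _; rewrite (frame_v fr4) //=.
      * move=> k s4 kn xk fr4 I4.
        have b4 : nvar s4 10 = b by rewrite (frame_v fr4).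
        have a4 : nvar s4 9 = a by rewrite (frame_v fr4).
        have K v : (v < n)%N -> (v < k.+1)%N ->
            component ends [seq f <- take j.+1 (enum 'I_n.-1) | f != e] v =
            if v == k then
              (if cj k == b then a else cj k)
            else narr s4 5 v.
          move=> vn; rewrite ltnS leq_eqVlt; case: eqP => [->|_ /= vk]; last by rewrite I4 // vk.
          by rewrite component_take -val_eqE /= (negbTE ji).
        have E5 : narr s4 5 k = cj k by rewrite I4 // ltnn.
        have out v : (v < n)%N -> (v < k.+1)%N = false -> (v == k) = false by lia.
        apply: runs_if => /=; rewrite xk E5 b4 => cmp.
          apply: runs_nwrite => v vn /=; rewrite xk a4; case: (boolP (v < k.+1)%N) => [|/negbTE] vk.
            by rewrite K // cmp.
          rewrite (out _ _ vk) // I4 // ifF //; lia.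
        apply: runs_skip => v vn /=; case: ifP => vk.
          by rewrite K // (negbTE cmp); case: eqP => // ->.
        rewrite I4 // ifF //; lia.
      by move=> s4 fr4 I4 v vn; rewrite /= I4 // vn.
    move=> s3 fr3 I3.
    have n3 : nvar s3 0 = n by rewrite (frame_v fr3) //= (frame_v fr2).
    have e3 : nvar s3 5 = i by rewrite (frame_v fr3) //= (frame_v fr2).
    have en3 : narr s3 0 = narr s1 0 by rewrite (frame_n fr3) //= (frame_n fr2).
    have mul3 : narr s3 2 i = (i * n)%N by rewrite (frame_n fr3) //= (frame_n fr2).
    have I63 : forall (f : 'I_n.-1) (v : 'I_n), (f < i)%N ->
      [/\ narr s3 6 (f * n + v)%N = side ends f v :> nat,
          narr s3 7 (f * n + v)%N = proj ends f (ends f).1 v &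
          narr s3 8 (f * n + v)%N = if side ends f v then (ends f).2 else v].
      by move=> f v fi; rewrite !(frame_n fr3) //= !(frame_n fr2) //; apply: I1.
    have {}I3 v : (v < n)%N -> narr s3 5 v = component ends [seq f <- enum 'I_n.-1 | f != e] v.
      by move=> vn; rewrite I3 // take_oversize // size_enum_ord.
    apply: (runs_for_const (m := n) (I := fun j s4 => forall (f : 'I_n.-1) (v : 'I_n),
       ((f < i) || ((f == e) && (v < j)))%N ->
      [/\ narr s4 6 (f * n + v)%N = side ends f v :> nat,
          narr s4 7 (f * n + v)%N = proj ends f (ends f).1 v &
          narr s4 8 (f * n + v)%N = if side ends f v then (ends f).2 else v])) => //=.
    + by move=> j s4 _ _ fr4 _; rewrite (frame_v fr4) //=.
    + by move=> f v; rewrite ltn0 andbF orbF; apply: I63.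
    + move=> j s4 jn xj fr4 I4.
      have e4 : nvar s4 5 = i by rewrite (frame_v fr4).
      have mul4 : narr s4 2 i = (i * n)%N by rewrite (frame_n fr4).
      have [en1 en2] : narr s4 0 (i + i)%N = (ends e).1 /\ narr s4 0 (i + i + 1)%N = (ends e).2.
        by rewrite (frame_n fr4) //= en3; apply: (ends1 e).
      have c4 v : (v < n)%N -> narr s4 5 v = component ends [seq f <- enum 'I_n.-1 | f != e] v.
        by rewrite (frame_n fr4) //=; apply: I3.
      have sE : (narr s4 5 j == narr s4 5 (ends e).1) = side ends e j by rewrite !c4.
      have step (f : 'I_n.-1) (v : 'I_n) (X Y Z : nat) (b : bool) :
          ((f < i) || ((f == e) && (v < j.+1)))%N -> side ends e j = b ->
          X = b -> Y = (if b then j else (ends e).1) -> Z = (if b then val (ends e).2 else j) ->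
          [/\ (if (f * n + v == i * n + j)%N then X else narr s4 6 (f * n + v)%N) = side ends f v :> nat,
              (if (f * n + v == i * n + j)%N then Y else narr s4 7 (f * n + v)%N) = proj ends f (ends f).1 v &
              (if (f * n + v == i * n + j)%N then Z else narr s4 8 (f * n + v)%N) =
                (if side ends f v then (ends f).2 else v)].
        move=> fv sb -> -> ->; rewrite index_inj //.
        case: (boolP ((val f == i) && (val v == j))) => [/andP[/eqP fi /eqP vj]|neq].
          have -> : f = e by apply: val_inj.
          rewrite /proj side1 vj sb; split=> //; first by case: b {sb}; rewrite ?eqb_id.
          by case: b {sb}.
        apply: I4; case/orP: fv => [->//|/andP[/eqP fe]]; rewrite ltnS leq_eqVlt fe eqxx.
        case/orP=> [/eqP vj|->]; last by rewrite orbT.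
        by case/negP: neq; rewrite fe /= vj !eqxx.
      rewrite /= in en1 en2.
      apply: runs_if => /=; rewrite xj e4 en1 sE => sj.
        do 2 (apply: runs_seq; apply: runs_nwrite); apply: runs_nwrite.
        rewrite /= xj e4 mul4 en2 => f v fv; apply: (step f v _ _ _ true) => //.
      do 2 (apply: runs_seq; apply: runs_nwrite); apply: runs_nwrite.
      rewrite /= xj e4 mul4 en1 => f v fv; apply: (step f v _ _ _ false) => //.
      exact: negbTE.
    move=> s4 fr4 I4 f v /= fi; apply: I4; move: fi; rewrite ltnS leq_eqVlt => /orP[fi|->//].
    by rewrite -val_eqE /= fi ltn_ord orbT.
  by move=> s1 fr I1 e v; apply: I1.
have mn : (n.-1 <= n)%N by apply: leq_pred.
have mnn : (n.-1 * n <= n * n)%N by rewrite leq_mul2r mn orbT.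
rewrite !expnS expn0 muln1.
set X := (_ + 3)%N; suff HX : (X <= 90 * (n * n))%N.
  apply: (@leq_trans (3 + n * (90 * (n * n)))); first by rewrite leq_add2l leq_mul.
  have : (1 <= n * (n * n))%N by rewrite !muln_gt0 n_gt0.
  by lia.
rewrite /X; have : (n <= n * n)%N by rewrite leq_pmulr.
by nia.
Qed.

End Precomputation.

(* With [te] the code of an [l]-tuple in base [n] and register 5 an edge [e]:
   the number of entries on the first side of [e], and the code of the
   projected tuple.  Reads in the tables replace the missing multiplication and
   division. *)
Fixpoint count_exp (l : nat) (te : nexp) : nexp :=
  if l is l'.+1 then
    NPlus (NRead 6 (NPlus (NRead 2 (NVar 5)) (NRead 3 te))) (count_exp l' (NRead 4 te))
  else NLit 0.

Fixpoint code_exp (a l : nat) (te : nexp) : nexp :=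
  if l is l'.+1 then
    NPlus (NRead a (NPlus (NRead 2 (NVar 5)) (NRead 3 te)))
          (NRead 2 (code_exp a l' (NRead 4 te)))
  else NLit 0.

Definition span_test (l : nat) : bexp :=
  BAnd (BNLt (NLit 0) (count_exp l (NVar 12))) (BNLt (count_exp l (NVar 12)) (NLit l)).

Definition count_cmd (l : nat) : cmd :=
  CSeq (CNSet 13 (NLit 0))
  (CFor 5 nexp_edges (CIf (span_test l) (CNSet 13 (NPlus (NVar 13) (NLit 1))) CSkip)).

Definition touch_cmd (l : nat) : cmd :=
  CSeq (CFor 7 (NVar 0) (CNWrite 9 (NVar 7) (NLit 0)))
  (CFor 5 nexp_edges
    (CIf (span_test l)
      (CSeq (CNWrite 9 (nexp_end1 5) (NLit 1)) (CNWrite 9 (nexp_end2 5) (NLit 1)))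
      CSkip)).

Definition cell (a : nat) : rexp := RRead a (NLit 0).
Definition set_cell (a : nat) (r : rexp) : cmd := CRWrite a (NLit 0) r.

Definition reward_cmd : cmd :=
  CSeq (set_cell 2 (RLit 0))
  (CFor 7 (NVar 0) (CFor 8 (NVar 0)
    (CIf (BAnd (BNLt (NVar 7) (NVar 8))
           (BAnd (BNEq (NRead 9 (NVar 7)) (NLit 1)) (BNEq (NRead 9 (NVar 8)) (NLit 1))))
      (set_cell 2 (RPlus (cell 2) (RRead 1 (NPlus (NRead 2 (NVar 7)) (NVar 8)))))
      CSkip))).

Section Phases.
Variables (R : realType) (n l : nat) (ends : 'I_n.-1 -> 'I_n * 'I_n).
Variables (c : 'I_n.-1 -> R) (w : 'I_n -> 'I_n -> R).
Hypothesis tree : is_tree ends.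
Hypothesis l_gt0 : (0 < l)%N.
Notation E := 'I_n.-1.
Notation V := 'I_n.

Lemma tree_gt0 : (0 < n)%N.
Proof. by case/andP: tree. Qed.

Record env (s : state R) : Prop := Env {
  env_n : nvar s 0 = n;
  env_N : nvar s 1 = (n ^ l)%N;
  env_ends : ends_at ends s;
  env_tab : forall k, (k < n ^ l)%N ->
    [/\ narr s 2 k = (k * n)%N, narr s 3 k = (k %% n)%N & narr s 4 k = (k %/ n)%N];
  env_side : forall (e : E) (v : V),
    [/\ narr s 6 (e * n + v)%N = side ends e v :> nat,
        narr s 7 (e * n + v)%N = proj ends e (ends e).1 v &
        narr s 8 (e * n + v)%N = proj ends e (ends e).2 v];
  env_c : forall e : E, rarr s 0 e = c e;
  env_w : forall a b : V, rarr s 1 (a * n + b)%N = w a b }.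

Definition keeps_env (c : cmd) : bool :=
  [&& all (fun x => x \notin mvars c) [:: 0; 1]%N,
      all (fun x => x \notin mnarrs c) [:: 0; 2; 3; 4; 6; 7; 8]%N &
      all (fun x => x \notin mrarrs c) [:: 0; 1]%N].

Lemma env_frame k s s' : frame k s s' -> keeps_env k -> env s -> env s'.
Proof.
move=> [f1 f2 f3] /and3P[/and3P[v0 v1 _]].
move=> /and5P[n0 n2 n3 n4 /and4P[n6 n7 n8 _]] /and3P[r0 r1 _] [e0 e1 e2 e3 e4 e5 e6].
split; rewrite ?f1 //.
- by move=> e; rewrite f2.
- by move=> i im; rewrite !f2 //; apply: e3.
- by move=> e v; rewrite !f2 //; apply: e4.
- by move=> e; rewrite f3.
by move=> a b; rewrite f3.
Qed.

Lemma env_set s s' : env s ->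
  nvar s' 0 = nvar s 0 -> nvar s' 1 = nvar s 1 ->
  narr s' 0 = narr s 0 -> narr s' 2 = narr s 2 -> narr s' 3 = narr s 3 ->
  narr s' 4 = narr s 4 -> narr s' 6 = narr s 6 -> narr s' 7 = narr s 7 ->
  narr s' 8 = narr s 8 -> rarr s' 0 = rarr s 0 -> rarr s' 1 = rarr s 1 -> env s'.
Proof.
move=> [e0 e1 e2 e3 e4 e5 e6] v0 v1 n0 n2 n3 n4 n6 n7 n8 r0 r1.
split; rewrite ?v0 ?v1 ?n2 ?n3 ?n4 ?n6 ?n7 ?n8 ?r0 ?r1 //.
by rewrite /ends_at n0.
Qed.

Lemma env_mul s (e : nat) : env s -> (e < n)%N -> narr s 2 e = (e * n)%N.
Proof.
move=> es en; case: (env_tab es (k := e)) => //.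
by apply: leq_trans en _; case: l l_gt0 => // k _; rewrite expnS leq_pmulr // expn_gt0 tree_gt0.
Qed.

Lemma env_mulE s (e : E) : env s -> narr s 2 e = (e * n)%N.
Proof. by move=> es; apply: env_mul => //; apply: leq_trans (ltn_ord e) (leq_pred n). Qed.

Definition digit (k : nat) : V := Ordinal (ltn_pmod k tree_gt0).

Fixpoint decode (m k : nat) : seq V :=
  if m is m'.+1 then digit k :: decode m' (k %/ n)%N else [::].

Fixpoint code (us : seq V) : nat := if us is v :: us' then (v + code us' * n)%N else 0%N.

Lemma size_decode m k : size (decode m k) = m.
Proof. by elim: m k => //= m IH k; rewrite IH. Qed.

Lemma code_lt us : (code us < n ^ size us)%N.
Proof using Type.
elim: us => //= v us; rewrite expnSr; move: (ltn_ord v).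
move: (nat_of_ord v) (code us) (n ^ size us)%N => {v us} v a b; clear; nia.
Qed.

Lemma decode_code us : decode (size us) (code us) = us.
Proof.
elim: us => //= v us IH; rewrite addnC divnMDl ?tree_gt0 // divn_small // addn0 IH; congr (_ :: _).
by apply: val_inj; rewrite /= modnMDl modn_small.
Qed.

Lemma ltn_div_exp m k : (k < n ^ m.+1)%N -> (k %/ n < n ^ m)%N.
Proof. by rewrite expnSr ltn_divLR // tree_gt0. Qed.

Lemma count_exp_eval s (e : E) te m : env s -> nvar s 5 = e -> (m <= l)%N ->
  (neval s te < n ^ m)%N ->
  neval s (count_exp m te) = count (fun v : V => side ends e v) (decode m (neval s te)).
Proof.
move=> es e5; elim: m te => //= m IH te ml tem.
have tel : (neval s te < n ^ l)%N.
  by apply: leq_trans tem _; rewrite leq_pexp2l // tree_gt0.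
have [_ tm td] := env_tab es tel.
rewrite IH /= ?td ?(ltnW ml) ?ltn_div_exp // e5 env_mulE // tm.
by have [-> _ _] := env_side es e (digit (neval s te)).
Qed.

Lemma code_exp_eval s (e : E) (z : V) a te m : env s -> nvar s 5 = e -> (m <= l)%N ->
  (forall v : V, narr s a (e * n + v)%N = proj ends e z v) ->
  (neval s te < n ^ m)%N ->
  neval s (code_exp a m te) = code [seq proj ends e z v | v <- decode m (neval s te)].
Proof.
move=> es e5 + az; elim: m te => //= m IH te ml tem.
have tel : (neval s te < n ^ l)%N.
  by apply: leq_trans tem _; rewrite leq_pexp2l // tree_gt0.
have [_ tm td] := env_tab es tel.
rewrite IH /= ?td ?(ltnW ml) ?ltn_div_exp // e5 env_mulE // tm.
have := az (digit (neval s te)); rewrite /= => ->; congr (_ + _)%N.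
case: (env_tab es (k := code [seq proj ends e z v | v <- decode m (neval s te %/ n)])) => //.
have := code_lt [seq proj ends e z v | v <- decode m (neval s te %/ n)].
rewrite size_map size_decode => /leq_trans; apply.
by rewrite leq_pexp2l ?tree_gt0 // ltnW.
Qed.

Definition tspan (t : nat) : {set E} := span ends (decode l t).

Lemma span_test_eval s (e : E) t : env s -> nvar s 5 = e -> nvar s 12 = t -> (t < n ^ l)%N ->
  beval s (span_test l) = (e \in tspan t).
Proof.
move=> es e5 tE tl; rewrite /= (count_exp_eval (e := e)) //= ?tE //.
by rewrite inE size_decode.
Qed.

Lemma count_run s t : env s -> nvar s 12 = t -> (t < n ^ l)%N ->
  runs (count_cmd l) s (5 + 7 * n) (fun s' => nvar s' 13 = #|tspan t|).
Proof.
move=> es tE tl; eapply runs_le.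
  apply: runs_seq; apply: runs_nset => /=.
  apply: (runs_for_const (m := n.-1)
    (I := fun i s1 => nvar s1 13 = #|[set e in tspan t | (e < i)%N]|)) => //=.
  - by move=> i s1 _ _ fr _; rewrite (frame_v fr) //= (env_n es) subn1.
  - by rewrite (eq_card0) // => e; rewrite !inE andbF.
  - move=> i s1 im xi fr I1.
    have es1 : env s1 by apply: env_frame fr _ _ => //; apply: (env_set es).
    have t1 : nvar s1 12 = t by rewrite (frame_v fr).
    rewrite -/(span_test l); apply: runs_if; rewrite (span_test_eval (e := Ordinal im) es1 xi t1 tl) => He.
      by apply: runs_nset; rewrite /= card_ord_ltS He I1.
    by apply: runs_skip; rewrite /= card_ord_ltS (negbTE He) I1 addn0.
  move=> s1 _ ->; congr #|pred_of_set _|; apply/setP => e; rewrite !inE.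
  by rewrite ltn_ord andbT.
have := leq_pred n; lia.
Qed.

Lemma touch_run s t : env s -> nvar s 12 = t -> (t < n ^ l)%N ->
  runs (touch_cmd l) s (7 + 14 * n)
    (fun s' => forall v : V, narr s' 9 v = touched ends (decode l t) v).
Proof.
move=> es tE tl; eapply runs_le.
  apply: runs_seq.
  apply: (runs_for_const (m := n) (I := fun i s1 => forall v, (v < i)%N -> narr s1 9 v = 0%N)) => //=.
  - by move=> i s1 _ _ fr _; rewrite (frame_v fr) //= (env_n es).
  - move=> i s1 im xi fr I1; apply: runs_nwrite => /= v; rewrite xi ltnS leq_eqVlt.
    by case: eqP => //= _ /I1.
  move=> s0 fr0 I0.
  have es0 : env s0 by apply: env_frame fr0 _ _.
  have t0 : nvar s0 12 = t by rewrite (frame_v fr0).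
  apply: (runs_for_const (m := n.-1) (I := fun i s1 => forall v : V,
     narr s1 9 v = [exists e in tspan t, (e < i)%N && incident ends e v] :> nat)) => //=.
  - by move=> i s1 _ _ fr _; rewrite (frame_v fr) //= (env_n es0) subn1.
  - move=> v; rewrite I0 //; apply/esym/eqP; rewrite eqb0; apply/negP.
    by move=> /exists_inP[e _].
  - move=> i s1 im xi fr I1.
    have es1 : env s1 by apply: env_frame fr _ _ => //; apply: (env_set es0).
    have t1 : nvar s1 12 = t by rewrite (frame_v fr).
    have [en1 en2] := env_ends es1 (Ordinal im); rewrite /= in en1 en2.
    have step v : [exists e in tspan t, (e < i.+1)%N && incident ends e v] =
        [exists e in tspan t, (e < i)%N && incident ends e v] ||
        ((Ordinal im \in tspan t) && incident ends (Ordinal im) v).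
      apply/idP/idP => [/exists_inP[e et /andP[]]|].
        rewrite ltnS leq_eqVlt => /orP[/eqP ei|ei] iv.
          by have <- : e = Ordinal im; [apply: val_inj|rewrite et iv orbT].
        by apply/orP; left; apply/exists_inP; exists e; rewrite ?ei.
      case/orP => [/exists_inP[e et /andP[ei iv]]|/andP[it iv]]; apply/exists_inP.
        by exists e; rewrite // iv andbT ltnW.
      by exists (Ordinal im); rewrite // iv ltnSn.
    rewrite -/(span_test l); apply: runs_if; rewrite (span_test_eval (e := Ordinal im) es1 xi t1 tl) => He.
      apply: runs_seq; apply: runs_nwrite; apply: runs_nwrite => /= v.
      rewrite xi en1 en2 step He [incident ends (Ordinal im) v]/incident -!val_eqE /= I1 ![nat_of_ord v == _]eq_sym.
      case: (_ == nat_of_ord v); first by rewrite !orbT.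
      case: (_ == nat_of_ord v); first by rewrite !orbT.
      by rewrite !orbF.
    by apply: runs_skip => v /=; rewrite step (negbTE He) orbF I1.
  move=> s1 _ I1 v; rewrite I1 /touched; congr nat_of_bool.
  by apply/exists_inP/exists_inP => -[e et H]; exists e => //; [case/andP: H|rewrite ltn_ord].
have := leq_pred n; lia.
Qed.

Lemma reward_run s us : env s ->
  (forall v : V, narr s 9 v = touched ends us v) ->
  runs reward_cmd s (20 * n ^ 2) (fun s' => rarr s' 2 0 = reward ends w (span ends us)).
Proof.
move=> es tch; rewrite (reward_span tree); eapply runs_le.
  apply: runs_seq; apply: runs_rwrite => /=.
  pose P (a b : V) := (a < b)%N && touched ends us a && touched ends us b.
  apply: (runs_for_const (m := n) (I := fun i s1 =>
    rarr s1 2 0%N = \sum_(a : V | (a < i)%N && true) \sum_(b : V | P a b) w a b)) => //=.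
  - by move=> i s1 _ _ fr _; rewrite (frame_v fr) //= (env_n es).
  - by rewrite big_pred0.
  - move=> i s1 im xi fr I1.
    have es1 : env s1 by apply: env_frame fr _ _ => //; apply: (env_set es).
    pose a : V := Ordinal im.
    apply: (runs_for_const (m := n) (I := fun j s2 =>
      rarr s2 2 0%N = \sum_(a : V | (a < i)%N && true) \sum_(b : V | P a b) w a b
        + \sum_(b : V | (b < j)%N && P a b) w a b)) => //=.
    + by move=> j s2 _ _ fr2 _; rewrite (frame_v fr2) //= (env_n es1).
    + by rewrite [X in _ = _ + X]big_pred0 // addr0.
    + move=> j s2 jn xj fr2 I2.
      have es2 : env s2 by apply: env_frame fr2 _ _ => //; apply: (env_set es1).
      have x2 : nvar s2 7 = i by rewrite (frame_v fr2).
      have tch2 (v : V) : narr s2 9 v = touched ends us v.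
        by rewrite (frame_n fr2) //= (frame_n fr) //; apply: tch.
      have Pij : [&& (i < j)%N, narr s2 9 i == 1%N & narr s2 9 j == 1%N] = P a (Ordinal jn).
        by rewrite (tch2 a) (tch2 (Ordinal jn)) /P !eqb1 andbA.
      apply: runs_if; rewrite /= x2 xj Pij => HP.
        apply: runs_rwrite; rewrite /= sum_ord_ltS HP I2 x2 xj addrA; congr (_ + _).
        by rewrite (env_mul es2 im) -(env_w es2).
      by apply: runs_skip; rewrite /= sum_ord_ltS (negbTE HP) addr0.
    by move=> s2 _ I2; rewrite /= I2 sum_ord_ltS sum_ord_lt_all.
  move=> s1 _ ->; rewrite sum_ord_lt_all; apply: eq_bigr => a _; exact: eq_bigl.
have n0 := tree_gt0; rewrite !expnS expn0 muln1.
by nia.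
Qed.

End Phases.

Definition rprod (a : nat) (i : nexp) (b : nat) (j : nexp) : rexp :=
  RTimes (RRead a i) (RRead b j).

(* Labels are compared by cross-multiplication, as there is no division. *)
Definition take_first : bexp :=
  BAnd (BNLt (NVar 18) (NVar 19))
    (BNot (BAnd (BNLt (NVar 20) (NVar 21))
      (BRLt (rprod 8 (NVar 18) 7 (NVar 20)) (rprod 8 (NVar 20) 7 (NVar 18))))).

Definition copy_item (x : nat) : cmd :=
  CSeq (CNWrite 12 (NPlus (NVar 22) (NVar 14)) (NRead 12 (NVar x)))
  (CSeq (CRWrite 6 (NPlus (NVar 22) (NVar 14)) (RRead 6 (NVar x)))
        (CNSet x (NPlus (NVar x) (NLit 1)))).

Definition merge_cmd : cmd :=
  CFor 14 (NMinus (NVar 11) (NLit 1))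
  (CSeq (CIf take_first (copy_item 18) (copy_item 20))
  (CSeq (set_cell 4 (RPlus (cell 4)
          (RTimes (RRead 0 (NRead 12 (NPlus (NVar 22) (NVar 14)))) (cell 3))))
        (set_cell 3 (RMinus (cell 3) (RRead 6 (NPlus (NVar 22) (NVar 14))))))).

Section Merge.
Variables (R : realType) (n : nat) (c : 'I_n.-1 -> R).
Notation E := 'I_n.-1.
Implicit Types (s : state R) (r : seq E) (w lam : E -> R).

Definition list_at s p r w := forall i (x : E), (i < size r)%N ->
  narr s 12 (p + i)%N = nth x r i /\ rarr s 6 (p + i)%N = w (nth x r i).

Definition label_at s p r lam := forall i (x : E), (i < size r)%N ->
  0 < rarr s 7 (p + i)%N /\ rarr s 8 (p + i)%N = lam (nth x r i) * rarr s 7 (p + i)%N.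

Definition below top p r := forall i, (i < size r)%N -> (p + i < top)%N.

Definition same_below top s s' := forall k, (k < top)%N ->
  [/\ narr s' 12 k = narr s 12 k, rarr s' 6 k = rarr s 6 k,
      rarr s' 7 k = rarr s 7 k & rarr s' 8 k = rarr s 8 k].

Lemma same_below_trans top top' s1 s2 s3 : (top <= top')%N ->
  same_below top s1 s2 -> same_below top' s2 s3 -> same_below top s1 s3.
Proof.
move=> tt H1 H2 k kt; have [<- <- <- <-] := H1 k kt.
exact: H2 (leq_trans kt tt).
Qed.

Lemma list_at_same top s s' p r w : same_below top s s' -> below top p r ->
  list_at s p r w -> list_at s' p r w.
Proof.
by move=> H pr L i x ir; have [-> -> _ _] := H _ (pr _ ir); apply: L.
Qed.

Lemma label_at_same top s s' p r lam : same_below top s s' -> below top p r ->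
  label_at s p r lam -> label_at s' p r lam.
Proof.
by move=> H pr L i x ir; have [_ _ -> ->] := H _ (pr _ ir); apply: L.
Qed.

Lemma list_at_ext s p r w w' : {in r, w =1 w'} -> list_at s p r w -> list_at s p r w'.
Proof. by move=> ww' L i x ir; have [-> ->] := L i x ir; rewrite ww' ?mem_nth. Qed.

Lemma label_at_ext s p r lam lam' : {in r, lam =1 lam'} -> label_at s p r lam -> label_at s p r lam'.
Proof. by move=> ww' L i x ir; have [? ->] := L i x ir; rewrite ww' ?mem_nth. Qed.

Lemma merge_run s r1 r2 e w lam p1 p2 top :
  let M := merge (by_label lam) r1 r2 in let L := rcons M e in
  (forall x : E, rarr s 0 x = c x) ->
  nvar s 18 = p1 -> nvar s 19 = (p1 + size r1)%N ->
  nvar s 20 = p2 -> nvar s 21 = (p2 + size r2)%N ->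
  nvar s 22 = top -> nvar s 11 = size L ->
  below top p1 r1 -> below top p2 r2 ->
  list_at s p1 r1 w -> list_at s p2 r2 w -> label_at s p1 r1 lam -> label_at s p2 r2 lam ->
  rarr s 3 0 = \sum_(x <- L) w x -> rarr s 4 0 = 0 ->
  runs merge_cmd s (3 + 20 * size L)
    (fun s' => [/\ list_at s' top M w, same_below top s s', rarr s' 3 0 = w e &
       rarr s' 4 0 + c e * w e = wcost c w L]).
Proof.
move=> M L c0 v18 v19 v20 v21 v22 v11 b1 b2 l1 l2 m1 m2 rem0 cost0.
have szL : size L = (size M).+1 by rewrite size_rcons.
have szM : size M = (size r1 + size r2)%N by rewrite size_merge size_cat.
have dropL i : (i <= size M)%N -> drop i L = rcons (drop i M) e by move=> iM; rewrite drop_rcons.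
eapply runs_le.
  apply: (runs_for_const (m := size M) (I := fun i s1 => exists i1 i2,
    [/\ [/\ (i1 <= size r1)%N, (i2 <= size r2)%N & drop i M = merge (by_label lam) (drop i1 r1) (drop i2 r2)],
        [/\ (i1 + i2 = i)%N, nvar s1 18 = (p1 + i1)%N & nvar s1 20 = (p2 + i2)%N],
        list_at s1 top (take i M) w, same_below top s s1 &
        rarr s1 3 0%N = \sum_(x <- drop i L) w x /\
        rarr s1 4 0%N + wcost c w (drop i L) = wcost c w L])) => //=.
  - by move=> i s1 _ _ fr _; rewrite (frame_v fr) //= v11 szL subn1.
  - exists 0%N, 0%N; rewrite !drop0 !addn0 take0; split=> //; split=> //.
    by rewrite cost0 add0r.
  - move=> i s1 iM xi fr [i1 [i2 [[i1s i2s dM] [i12 n18 n20] La same1 [rem1 cost1]]]].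
    have n19 : nvar s1 19 = (p1 + size r1)%N by rewrite (frame_v fr).
    have n21 : nvar s1 21 = (p2 + size r2)%N by rewrite (frame_v fr).
    have n22 : nvar s1 22 = top by rewrite (frame_v fr).
    have c1 x : rarr s1 0 (nat_of_ord x) = c x by rewrite (frame_r fr) //= c0.
    have l1' := list_at_same same1 b1 l1; have l2' := list_at_same same1 b2 l2.
    have m1' := label_at_same same1 b1 m1; have m2' := label_at_same same1 b2 m2.
    apply: runs_seq.
    apply: (@runs_imp _ _ _ _ _ (fun s2 => exists x i1 i2,
      [/\ [/\ (i1 <= size r1)%N, (i2 <= size r2)%N,
              drop i M = x :: merge (by_label lam) (drop i1 r1) (drop i2 r2) & (i1 + i2 = i.+1)%N],
          [/\ nvar s2 18 = (p1 + i1)%N & nvar s2 20 = (p2 + i2)%N],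
          (forall k, narr s2 12 k = if k == (top + i)%N then val x else narr s1 12 k) &
          (forall k, rarr s2 6 k = if k == (top + i)%N then w x else rarr s1 6 k)])).
      have get1 : (i1 < size r1)%N ->
          exists2 x, drop i1 r1 = x :: drop i1.+1 r1 & [/\ narr s1 12 (p1 + i1)%N = x, rarr s1 6 (p1 + i1)%N = w x,
            0 < rarr s1 7 (p1 + i1)%N & rarr s1 8 (p1 + i1)%N = lam x * rarr s1 7 (p1 + i1)%N].
        move=> lt; exists (nth e r1 i1); first exact: drop_nth.
        by have [-> ->] := l1' _ e lt; have [? ->] := m1' _ e lt.
      have get2 : (i2 < size r2)%N ->
          exists2 x, drop i2 r2 = x :: drop i2.+1 r2 & [/\ narr s1 12 (p2 + i2)%N = x, rarr s1 6 (p2 + i2)%N = w x,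
            0 < rarr s1 7 (p2 + i2)%N & rarr s1 8 (p2 + i2)%N = lam x * rarr s1 7 (p2 + i2)%N].
        move=> lt; exists (nth e r2 i2); first exact: drop_nth.
        by have [-> ->] := l2' _ e lt; have [? ->] := m2' _ e lt.
      apply: runs_if => /=; rewrite n18 n19 n20 n21 !ltn_add2l => H.
        have /andP[lt1 H2] := H; have [x d1 [sx wx ax bx]] := get1 lt1.
        apply: runs_seq; apply: runs_nwrite; apply: runs_seq; apply: runs_rwrite; apply: runs_nset.
        exists x, i1.+1, i2; rewrite /= n18 n20 n22 xi sx wx addn1 -addnS; split=> //; split=> //.
        + rewrite dM d1; case: (leqP (size r2) i2) => lt2.
            by rewrite (drop_oversize lt2) !merges0.
          have [y d2 [_ _ ay bY]] := get2 lt2.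
          rewrite d2 merge_cons ifT //; move: H2; rewrite lt2 /= bx bY -leNgt => H3.
          by rewrite -(ler_pM2r (mulr_gt0 ax ay)); lra.
        by rewrite addSn i12.
      have lt2 : (i2 < size r2)%N.
        rewrite ltnNge; apply/negP => ge2; case/negP: H.
        have -> : (i2 < size r2)%N = false by apply/negbTE; rewrite -leqNgt.
        rewrite /= andbT; have := iM; rewrite szM; lia.
      have [y d2 [sy wy ay bY]] := get2 lt2.
      apply: runs_seq; apply: runs_nwrite; apply: runs_seq; apply: runs_rwrite; apply: runs_nset.
      exists y, i1, i2.+1; rewrite /= n18 n20 n22 xi sy wy addn1 -addnS; split=> //; split=> //.
      + rewrite dM d2; case: (leqP (size r1) i1) => lt1.
          by rewrite (drop_oversize lt1) !merge0s.
        have [x d1 [_ _ ax bx]] := get1 lt1.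
        rewrite d1 merge_cons ifF //; apply/negbTE; rewrite -ltNge; move: H; rewrite lt1 lt2 /= negbK bx bY => H3.
        by rewrite -(ltr_pM2r (mulr_gt0 ax ay)); lra.
      by rewrite addnS i12.
    - exact: leqnn.
    move=> s2 fr2 [x [j1 [j2 [[j1s j2s dx j12] [n18' n20'] sq wt]]]].
    have c2 y : rarr s2 0 (nat_of_ord y) = c y by rewrite (frame_r fr2).
    have n22' : nvar s2 22 = top by rewrite (frame_v fr2).
    have xi' : nvar s2 14 = i by rewrite (frame_v fr2).
    have dL : drop i L = x :: drop i.+1 L.
      rewrite !dropL ?(ltnW iM) // dx /=; congr (_ :: rcons _ _).
      by have := congr1 (drop 1) dx; rewrite drop_drop add1n /= drop0.
    apply: runs_seq; apply: runs_rwrite; apply: runs_rwrite.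
    have r3 : rarr s2 3 = rarr s1 3 by rewrite (frame_r fr2).
    have r4 : rarr s2 4 = rarr s1 4 by rewrite (frame_r fr2).
    exists j1, j2; rewrite /= n22' xi' sq wt eqxx c2 r3 r4; split=> //.
    + split=> //; have := congr1 (drop 1) dx; rewrite drop_drop add1n /= => ->.
      by rewrite drop0.
    + have takeM (y : E) : take i.+1 M = rcons (take i M) x.
        rewrite (take_nth y iM); congr rcons.
        by have := congr1 (head y) dx; rewrite /= -nth0 nth_drop addn0.
      move=> k y; rewrite (takeM y) size_rcons size_takel ?(ltnW iM) // ltnS nth_rcons.
      rewrite size_takel ?(ltnW iM) // /= sq wt eqn_add2l leq_eqVlt.
      case: eqP => [->|_] /=; first by rewrite ltnn.
      by move=> ki; rewrite ki; apply: La; rewrite size_takel // ltnW.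
    + move=> k kt; have [E1 E2 E3 E4] := same1 k kt; have kn : (k == top + i)%N = false by lia.
      by rewrite /= sq wt kn (frame_r fr2 (a := 7)) // (frame_r fr2 (a := 8)).
    split; first by rewrite rem1 dL big_cons addrC addKr.
    by move: cost1; rewrite dL /= rem1 dL addrA.
  move=> s1 fr [i1 [i2 [_ _ La same [rem1 cost1]]]].
  rewrite take_size in La; rewrite dropL // drop_size in rem1 cost1.
  rewrite /= big_cons big_nil addr0 in rem1; rewrite /= big_cons big_nil !addr0 in cost1.
  by split.
by rewrite szL; lia.
Qed.

End Merge.

Definition load_cmd (l : nat) : cmd :=
  CSeq (CNSet 16 (code_exp 7 l (NVar 12)))
  (CSeq (CNSet 17 (code_exp 8 l (NVar 12)))
  (CSeq (CNSet 18 (NRead 11 (NVar 16)))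
  (CSeq (CNSet 19 (NPlus (NVar 18) (NRead 10 (NVar 16))))
  (CSeq (CNSet 20 (NRead 11 (NVar 17)))
  (CSeq (CNSet 21 (NPlus (NVar 20) (NRead 10 (NVar 17))))
  (CSeq (set_cell 3 (cell 2)) (set_cell 4 (RLit 0)))))))).

Definition last_pos : nexp := NMinus (NPlus (NVar 22) (NVar 11)) (NLit 1).

Definition finish_cmd : cmd :=
  CSeq (CNWrite 12 last_pos (NVar 5))
  (CSeq (CRWrite 6 last_pos (cell 3))
  (CSeq (set_cell 4 (RPlus (cell 4) (RTimes (RRead 0 (NVar 5)) (cell 3))))
  (CSeq (CIf (BAnd (BNEq (NVar 23) (NLit 1)) (BNot (BRLt (cell 4) (cell 5)))) CSkip
          (CSeq (set_cell 5 (cell 4))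
          (CSeq (CNSet 23 (NLit 1)) (CNWrite 11 (NVar 12) (NVar 22)))))
        (CNSet 22 (NPlus (NVar 22) (NVar 11)))))).

Definition edges_cmd (l : nat) : cmd :=
  CSeq (CNSet 23 (NLit 0))
  (CFor 5 nexp_edges
    (CIf (span_test l) (CSeq (load_cmd l) (CSeq merge_cmd finish_cmd)) CSkip)).

Section Candidates.
Variables (R : realType) (n l : nat) (ends : 'I_n.-1 -> 'I_n * 'I_n).
Variables (c : 'I_n.-1 -> R) (w : 'I_n -> 'I_n -> R).
Hypothesis tree : is_tree ends.
Hypothesis l_gt0 : (0 < l)%N.
Hypothesis c_gt0 : forall e, 0 < c e.
Hypothesis w_ge0 : forall u v, 0 <= w u v.
Notation E := 'I_n.-1.
Notation V := 'I_n.
Notation env := (env l ends c w).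
Notation tspan := (tspan l tree).
Notation rew := (reward ends w).

Definition entry (s : state R) (t : nat) := exists r wt lam,
  [/\ opt_ordering c rew (tspan t) r, increments rew set0 wt r, envelope c wt lam r &
   [/\ narr s 10 t = size r, below (nvar s 22) (narr s 11 t) r,
       list_at s (narr s 11 t) r wt & label_at s (narr s 11 t) r lam]].

Lemma entry_same s s' t top : same_below top s s' -> nvar s 22 = top ->
  (top <= nvar s' 22)%N -> narr s' 10 t = narr s 10 t -> narr s' 11 t = narr s 11 t ->
  entry s t -> entry s' t.
Proof.
move=> sb topE top' e10 e11 [r [wt [lam [o i v [sz b L M]]]]].
rewrite topE in b; exists r, wt, lam; rewrite e10 e11; split=> //; split=> //.
- by move=> k kr; apply: leq_trans (b k kr) top'.
- exact: (list_at_same sb b L).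
exact: (label_at_same sb b M).
Qed.

Lemma ordering_size A (r : seq E) : ordering A r -> size r = #|A|.
Proof. by case=> u <-; rewrite cardsE (card_uniqP u). Qed.

Definition merged (s s' : state R) (A : {set E}) (e : E) (top : nat) := exists M wt,
  [/\ ordering A (rcons M e), increments rew set0 wt (rcons M e),
      (forall r' w', ordering A (rcons r' e) -> increments rew set0 w' (rcons r' e) ->
        wcost c wt (rcons M e) <= wcost c w' (rcons r' e)) &
   [/\ list_at s' top M wt, same_below top s s', rarr s' 3 0 = wt e &
       rarr s' 4 0 + c e * wt e = wcost c wt (rcons M e)]].

Lemma merge_phase s t (e : E) top Q B :
  env s -> nvar s 12 = t -> (t < n ^ l)%N -> nvar s 5 = e -> e \in tspan t ->
  nvar s 11 = #|tspan t| -> nvar s 22 = top -> rarr s 2 0 = rew (tspan t) ->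
  (forall t', (t' < n ^ l)%N -> (#|tspan t'| < #|tspan t|)%N -> entry s t') ->
  (forall s1, frame (CSeq (load_cmd l) merge_cmd) s s1 -> merged s s1 (tspan t) e top ->
     runs finish_cmd s1 B Q) ->
  runs (CSeq (load_cmd l) (CSeq merge_cmd finish_cmd)) s (50 * n + B) Q.
Proof.
move=> es tE tl eE eA dE topE rE ent HQ; set A := tspan t in eA dE rE ent HQ *.
have Asz : (#|A| <= n.-1)%N by rewrite -[X in (_ <= X)%N]card_ord max_card.
set us := decode tree l t.
set us1 := [seq proj ends e (ends e).1 v | v <- us].
set us2 := [seq proj ends e (ends e).2 v | v <- us].
have sz1 : size us1 = l by rewrite size_map size_decode.
have sz2 : size us2 = l by rewrite size_map size_decode.
have t1l : (code us1 < n ^ l)%N by rewrite -[X in (_ < n ^ X)%N]sz1 code_lt.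
have t2l : (code us2 < n ^ l)%N by rewrite -[X in (_ < n ^ X)%N]sz2 code_lt.
set A1 := span ends us1; set A2 := span ends us2.
have dec1 : decode tree l (code us1) = us1.
  by rewrite -[X in decode _ X _]sz1 decode_code.
have tA1 : tspan (code us1) = A1 by rewrite -[LHS]/(span ends (decode tree l (code us1))) dec1.
have dec2 : decode tree l (code us2) = us2.
  by rewrite -[X in decode _ X _]sz2 decode_code.
have tA2 : tspan (code us2) = A2 by rewrite -[LHS]/(span ends (decode tree l (code us2))) dec2.
have AE : A :\ e = A1 :|: A2 := span_split tree us e.
have dA : [disjoint A1 & A2] := span_disjoint tree us e.
have cA : #|A :\ e|.+1 = #|A| by rewrite (cardsD1 e A) eA.
have cA1 : (#|A1| < #|A|)%N by rewrite -cA ltnS AE subset_leq_card // subsetUl.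
have cA2 : (#|A2| < #|A|)%N by rewrite -cA ltnS AE subset_leq_card // subsetUr.
have [|r1 [w1 [lam1 [o1 i1 v1 [z1 b1 l1 m1]]]]] := ent _ t1l; first by rewrite tA1.
have [|r2 [w2 [lam2 [o2 i2 v2 [z2 b2 l2 m2]]]]] := ent _ t2l; first by rewrite tA2.
rewrite tA1 in o1; rewrite tA2 in o2.
have in1 x : (x \in r1) = (x \in A1) by case: o1 => -[_ <-] _; rewrite inE.
have in2 x : (x \in r2) = (x \in A2) by case: o2 => -[_ <-] _; rewrite inE.
have AEx x : (x != e) && (x \in A) = (x \in A1) || (x \in A2).
  by rewrite -in_setU -AE in_setD1.
have ne1 x : x \in A1 -> (x == e) = false.
  by move=> x1; have := AEx x; rewrite x1 /=; case: eqP.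
have ne2 x : x \in A2 -> (x == e) = false.
  by move=> x2; have := AEx x; rewrite x2 orbT /=; case: eqP.
have n21 x : x \in A2 -> (x \in A1) = false by move=> xA2; rewrite (disjointFl dA).
pose wt x := if x == e then rew A - rew (A :\ e) else if x \in A1 then w1 x else w2 x.
pose lam x := if x \in A1 then lam1 x else lam2 x.
have ew1 : {in r1, w1 =1 wt} by move=> x; rewrite in1 /wt => x1; rewrite ne1 // x1.
have ew2 : {in r2, w2 =1 wt} by move=> x; rewrite in2 /wt => x2; rewrite ne2 // n21.
have el1 : {in r1, lam1 =1 lam} by move=> x; rewrite in1 /lam => ->.
have el2 : {in r2, lam2 =1 lam} by move=> x; rewrite in2 /lam => x2; rewrite n21.
have {}i1 := increments_ext ew1 i1; have {}i2 := increments_ext ew2 i2.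
have {}v1 := envelope_ext ew1 el1 v1; have {}v2 := envelope_ext ew2 el2 v2.
have {}l1 := list_at_ext ew1 l1; have {}l2 := list_at_ext ew2 l2.
have {}m1 := label_at_ext el1 m1; have {}m2 := label_at_ext el2 m2.
have smg := reward_supermodular ends w_ge0.
have we : wt e = rew A - rew (A :\ e) by rewrite /wt eqxx.
have [oL iL mL] := merge_last_opt c_gt0 smg eA AE dA (fun P => @reward_sum _ _ tree _ w us e P) o1 o2 i1 i2 v1 v2 we.
set M := merge _ _ _ in oL iL mL.
have sumL : rew A = \sum_(x <- rcons M e) wt x.
  by rewrite (increments_sum iL) set0U (reward0 tree) subr0; case: oL => _ ->.
have p1v (v : V) : narr s 7 (e * n + v)%N = proj ends e (ends e).1 v by case: (env_side es e v).
have p2v (v : V) : narr s 8 (e * n + v)%N = proj ends e (ends e).2 v by case: (env_side es e v).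
eapply runs_le.
  apply: runs_seq.
  apply: (@runs_imp _ _ _ _ _ (fun s1 => [/\ nvar s1 18 = narr s 11 (code us1),
     nvar s1 19 = (narr s 11 (code us1) + size r1)%N,
     nvar s1 20 = narr s 11 (code us2),
     nvar s1 21 = (narr s 11 (code us2) + size r2)%N &
     rarr s1 3 0 = rew A /\ rarr s1 4 0 = 0])).
  - have E16 : neval s (code_exp 7 l (NVar 12)) = code us1.
      by rewrite (code_exp_eval tree l_gt0 es eE _ p1v) //= tE.
    do 6 (apply: runs_seq; apply: runs_nset).
    apply: runs_seq; apply: runs_rwrite; apply: runs_rwrite.
    have E17 (s0 : state R) : env s0 -> nvar s0 5 = e -> nvar s0 12 = t -> narr s0 8 = narr s 8 ->
        neval s0 (code_exp 8 l (NVar 12)) = code us2.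
      move=> es0 e0 t0 n0; rewrite (code_exp_eval (z := (ends e).2) tree l_gt0 es0 e0) //= ?t0 //.
      by move=> v; rewrite n0.
    rewrite /= E16 E17 //=; last by apply: (env_set es).
    by rewrite z1 z2 rE.
  - exact: leqnn.
  move=> s1 fr1 [n18 n19 n20 n21' [r3 r4]].
  have es1 : env s1 by apply: env_frame fr1 _ es.
  have d1 : nvar s1 11 = size (rcons M e) by rewrite (frame_v fr1) // dE (ordering_size oL).
  have top1 : nvar s1 22 = top by rewrite (frame_v fr1).
  rewrite topE in b1 b2.
  have sb1 : same_below top s s1.
    by move=> k kt; rewrite (frame_n fr1) // !(frame_r fr1).
  apply: runs_seq; apply: runs_imp.
  - apply: (@merge_run _ _ c s1 r1 r2 e wt lam (narr s 11 (code us1)) (narr s 11 (code us2)) top) => //.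
    + exact: (env_c es1).
    + exact: (list_at_same sb1 b1 l1).
    + exact: (list_at_same sb1 b2 l2).
    + exact: (label_at_same sb1 b1 m1).
    + exact: (label_at_same sb1 b2 m2).
    by rewrite r3.
  - exact: leqnn.
  move=> s2 fr2 [L2 sb2 r32 r42]; apply: HQ.
    exact: frame_seq fr1 fr2.
  exists M, wt; split=> //; split=> //.
  exact: same_below_trans (leqnn _) sb1 sb2.
have : (size (rcons M e) <= n.-1)%N by rewrite (ordering_size oL).
have n0 := tree_gt0 tree; rewrite -/M; move: (size _) => a; lia.
Qed.

Definition best_inv (s : state R) (t i top : nat) :=
  let A := tspan t in
  (nvar s 23 = 0%N /\ forall e, e \in A -> (i <= e)%N) \/
  (nvar s 23 = 1%N /\ exists L wt,
    [/\ ordering A L, increments rew set0 wt L, list_at s (narr s 11 t) L wt &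
     [/\ below (nvar s 22) (narr s 11 t) L, (top <= narr s 11 t)%N, rarr s 5 0 = wcost c wt L &
      forall r' w' (e' : E), (e' < i)%N -> ordering A (rcons r' e') ->
        increments rew set0 w' (rcons r' e') -> wcost c wt L <= wcost c w' (rcons r' e')]]).

Lemma finish_run s0 s t (e : E) top0 top :
  env s -> nvar s 12 = t -> nvar s 5 = e -> nvar s 11 = #|tspan t| -> nvar s 22 = top ->
  (top0 <= top)%N -> e \in tspan t ->
  nvar s 23 = nvar s0 23 -> rarr s 5 = rarr s0 5 -> narr s 11 = narr s0 11 -> nvar s0 22 = top ->
  merged s0 s (tspan t) e top -> best_inv s0 t e top0 ->
  runs finish_cmd s 16 (fun s' => [/\ best_inv s' t e.+1 top0, same_below top s0 s',
    (top <= nvar s' 22)%N & forall t', t' != t -> narr s' 11 t' = narr s0 11 t']).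
Proof.
clear l_gt0; move=> es tE eE dE topE top0le eA h0 b0 p0 topE0 [M [wt [oL iL mL [LM sb r3 r4]]]] best.
have szL := ordering_size oL; rewrite size_rcons in szL.
have lastE : (top + #|tspan t| - 1 = top + size M)%N by rewrite -szL; lia.
have ce : rarr s 0 e = c e by apply: env_c es e.
set A := tspan t in oL eA szL lastE *.
have sb' s' : (forall k, narr s' 12 k = if k == (top + size M)%N then val e else narr s 12 k) ->
    (forall k, rarr s' 6 k = if k == (top + size M)%N then wt e else rarr s 6 k) ->
    rarr s' 7 = rarr s 7 -> rarr s' 8 = rarr s 8 ->
    same_below top s0 s' /\ list_at s' top (rcons M e) wt.
  move=> H12 H6 H7 H8; split.
    move=> k kt; have kn : (k == top + size M)%N = false by lia.
    by rewrite H12 H6 H7 H8 kn; apply: sb.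
  move=> i x; rewrite size_rcons ltnS leq_eqVlt nth_rcons H12 H6 eqn_add2l.
  by case: eqP => [->|_ /= iM]; rewrite ?ltnn ?iM //; apply: LM.
have bL : below (top + #|A|) top (rcons M e).
  by move=> i; rewrite size_rcons szL ltn_add2l.
have prev s' : rarr s' 5 = rarr s 5 -> narr s' 11 = narr s 11 -> nvar s' 23 = nvar s 23 ->
    same_below top s0 s' -> nvar s' 22 = (top + #|A|)%N ->
    nvar s 23 = 1%N -> rarr s 5 0 <= wcost c wt (rcons M e) -> best_inv s' t e.+1 top0.
  move=> b1 p1 h1 sb1 topE' h01 bc; right; split; first by rewrite h1.
  case: best => [[]|[_ [L [wL [o i LL [bb tl bE mm]]]]]]; first by rewrite -h0 h01.
  rewrite topE0 in bb.
  exists L, wL; split=> //; first by rewrite p1 p0; apply: (list_at_same sb1 bb LL).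
  split.
  - by move=> i0 i0L; rewrite p1 p0 topE' ltn_addr // bb.
  - by rewrite p1 p0.
  - by rewrite b1 b0.
  move=> r' w' e'; rewrite ltnS leq_eqVlt => /orP[/eqP/val_inj->|]; last exact: mm.
  by move=> o' i'; rewrite -bE -b0; apply: le_trans bc _; apply: mL.
have new s' : rarr s' 5 0 = wcost c wt (rcons M e) -> narr s' 11 t = top -> nvar s' 23 = 1%N ->
    list_at s' top (rcons M e) wt -> nvar s' 22 = (top + #|A|)%N ->
    (nvar s 23 = 1%N -> wcost c wt (rcons M e) <= rarr s 5 0) -> best_inv s' t e.+1 top0.
  move=> b1 p1 h1 L1 topE' H; right; split=> //.
  exists (rcons M e), wt; rewrite p1 topE'; split=> //; split=> //.
  move=> r' w' e'; rewrite ltnS leq_eqVlt => /orP[/eqP/val_inj->|lt]; first exact: mL.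
  case: best => [[_ none] o' _|[h1' [L [wL [o i LL [bb tl bE mm]]]]] o' i'].
    have : e' \in tspan t by case: o' => _ <-; rewrite inE mem_rcons inE eqxx.
    by move=> /none; rewrite leqNgt lt.
  by apply: le_trans (mm _ _ _ lt o' i'); rewrite -bE -b0; apply: H; rewrite h0.
eapply runs_le.
  apply: runs_seq; apply: runs_nwrite; apply: runs_seq; apply: runs_rwrite.
  apply: runs_seq; apply: runs_rwrite; rewrite /= topE dE lastE eE.
  apply: runs_seq; apply: runs_if => /=; rewrite ?eE ce r3 r4 => H.
    apply: runs_skip; apply: runs_nset => /=; rewrite topE dE.
    set s' := State _ _ _; have [|||| sbs Ls] := sb' s' => //.
    have /andP[/eqP h1 H2] := H; rewrite -leNgt in H2.
    split=> //=; first by apply: prev => //=; rewrite topE dE.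
    + exact: leq_addr.
    by move=> t' _; rewrite p0.
  apply: runs_seq; apply: runs_rwrite; apply: runs_seq; apply: runs_nset; apply: runs_nwrite.
  apply: runs_nset => /=; rewrite ?topE ?dE ?tE ?eE ?ce ?r3 ?r4.
  set s' := State _ _ _; have [|||| sbs Ls] := sb' s' => //.
  split=> //=.
  + apply: new => //=; first by rewrite ?tE eqxx.
    by move=> h1; move: H; rewrite h1 /= negbK => /ltW.
  + exact: leq_addr.
  by move=> t' /negbTE ->; rewrite p0.
by [].
Qed.

End Candidates.

Definition pos_at (i : nexp) : nexp := NPlus (NRead 11 (NVar 12)) i.

Definition scan_cmd : cmd :=
  CSeq (set_cell 9 (RLit 0)) (CSeq (set_cell 10 (RLit 0))
  (CFor 15 (NMinus (NVar 11) (NVar 14))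
    (CSeq (set_cell 9 (RPlus (cell 9) (RRead 0 (NRead 12 (pos_at (NPlus (NVar 14) (NVar 15)))))))
    (CSeq (set_cell 10 (RPlus (cell 10) (RRead 6 (pos_at (NPlus (NVar 14) (NVar 15))))))
    (CIf (BAnd (BNLt (NLit 0) (NVar 15))
           (BNot (BRLt (RTimes (cell 12) (cell 9)) (RTimes (cell 10) (cell 11)))))
      CSkip
      (CSeq (set_cell 11 (cell 9)) (CSeq (set_cell 12 (cell 10))
        (CNSet 24 (NPlus (NPlus (NVar 14) (NVar 15)) (NLit 1)))))))))).

Definition label_cmd : cmd :=
  CSeq (CNSet 24 (NLit 0))
  (CFor 14 (NVar 11)
    (CSeq (CIf (BNEq (NVar 14) (NVar 24)) scan_cmd CSkip)
    (CSeq (CRWrite 7 (pos_at (NVar 14)) (cell 11))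
          (CRWrite 8 (pos_at (NVar 14)) (cell 12))))).

Definition copy_cmd : cmd :=
  CFor 14 (NVar 11) (CNWrite 1 (NVar 14) (NRead 12 (pos_at (NVar 14)))).

Section Labels.
Variables (R : realType) (n : nat) (c : 'I_n.-1 -> R).
Hypothesis c_gt0 : forall e, 0 < c e.
Notation E := 'I_n.-1.
Implicit Types (s : state R) (r : seq E) (wt lam : E -> R).

Lemma sum_take_S (f : E -> R) x r j : (j < size r)%N ->
  \sum_(y <- take j.+1 r) f y = \sum_(y <- take j r) f y + f (nth x r j).
Proof. by move=> jr; rewrite (take_nth x jr) -cats1 big_cat big_seq1. Qed.

Lemma sum_take_gt0 r j : (0 < j)%N -> (0 < size r)%N -> 0 < \sum_(y <- take j r) c y.
Proof.
case: r j => // x r [//|j] _ _; rewrite /= big_cons ltr_wpDr //.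
by apply: sumr_ge0 => i _; apply: ltW.
Qed.

Lemma scan_run s L wt p t i :
  (forall x : E, rarr s 0 x = c x) -> nvar s 12 = t -> narr s 11 t = p -> nvar s 14 = i ->
  nvar s 11 = size L -> (i < size L)%N -> list_at s p L wt ->
  runs scan_cmd s (10 + 20 * size L) (fun s' => exists k, let D := drop i L in
    [/\ (0 < k)%N, (i + k <= size L)%N, nvar s' 24 = (i + k)%N &
     [/\ rarr s' 11 0 = \sum_(x <- take k D) c x, rarr s' 12 0 = \sum_(x <- take k D) wt x &
      forall j, (\sum_(x <- take j D) wt x) * (\sum_(x <- take k D) c x) <=
                (\sum_(x <- take k D) wt x) * (\sum_(x <- take j D) c x)]]).
Proof.
move=> c0 tE pE iE dE iL La; set D := drop i L.
have szD : size D = (size L - i)%N by rewrite size_drop.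
have D0 : (0 < size D)%N by rewrite szD subn_gt0.
pose C j := \sum_(x <- take j D) c x; pose W j := \sum_(x <- take j D) wt x.
have C0 j : (0 < j)%N -> 0 < C j by move=> j0; apply: sum_take_gt0.
eapply runs_le.
  apply: runs_seq; apply: runs_rwrite; apply: runs_seq; apply: runs_rwrite => /=.
  apply: (runs_for_const (m := size D) (I := fun j s1 => [/\ rarr s1 9 0%N = C j, rarr s1 10 0%N = W j &
    j = 0%N \/ exists k, [/\ (0 < k)%N, (k <= j)%N, nvar s1 24 = (i + k)%N &
      [/\ rarr s1 11 0%N = C k, rarr s1 12 0%N = W k &
         forall j', (j' <= j)%N -> W j' * C k <= W k * C j']]])) => //=.
  - by move=> j s1 _ _ fr _; rewrite !(frame_v fr) //= dE iE szD.
  - by split; [rewrite /C take0 big_nil|rewrite /W take0 big_nil|left].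
  - move=> j s1 jD xj fr [E9 E10 best].
    have c1 (x : E) : rarr s1 0 x = c x by rewrite (frame_r fr) //= c0.
    have t1 : nvar s1 12 = t by rewrite (frame_v fr).
    have p1 : narr s1 11 t = p by rewrite (frame_n fr).
    have i1 : nvar s1 14 = i by rewrite (frame_v fr).
    have ijL : (i + j < size L)%N by move: jD; rewrite szD; lia.
    have [x0 _] : exists x0 : E, true by case: (L) ijL => // a; exists a.
    have [sq wq] := La _ x0 ijL.
    have sq1 : narr s1 12 (p + (i + j))%N = nth x0 L (i + j) by rewrite (frame_n fr).
    have wq1 : rarr s1 6 (p + (i + j))%N = wt (nth x0 L (i + j)) by rewrite (frame_r fr).
    have CS : C j.+1 = C j + c (nth x0 L (i + j)) by rewrite /C (sum_take_S _ x0 jD) nth_drop.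
    have WS : W j.+1 = W j + wt (nth x0 L (i + j)) by rewrite /W (sum_take_S _ x0 jD) nth_drop.
    have E9' : rarr s1 9 0 + rarr s1 0 (narr s1 12 (p + (i + j))%N) = C j.+1.
      by rewrite E9 sq1 c1 CS.
    have E10' : rarr s1 10 0 + rarr s1 6 (p + (i + j))%N = W j.+1 by rewrite E10 wq1 WS.
    apply: runs_seq; apply: runs_rwrite; apply: runs_seq; apply: runs_rwrite.
    rewrite /= t1 p1 i1 xj E9' E10'.
    apply: runs_if => /=; rewrite ?t1 ?p1 ?i1 ?xj ?E9' ?E10' => H.
      apply: runs_skip; rewrite /= ?t1 ?p1 ?i1 ?xj ?E9' ?E10'; split=> //; right.
      have /andP[j0 H2] := H.
      case: best => [jz|[k [k0 kj n24 [E11 E12 mk]]]]; first by rewrite jz in j0.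
      exists k; split=> //; first exact: leqW.
      split=> // j'; rewrite leq_eqVlt ltnS => /orP[/eqP->|]; last exact: mk.
      by move: H2; rewrite -leNgt E11 E12.
    apply: runs_seq; apply: runs_rwrite; apply: runs_seq; apply: runs_rwrite.
    apply: runs_nset; rewrite /= ?t1 ?p1 ?i1 ?xj ?E9' ?E10'; split=> //; right.
    exists j.+1; split=> //; first by rewrite addn1 addnS.
    split=> // j'; rewrite leq_eqVlt ltnS => /orP[/eqP->//|jj'].
    case: (posnP j') => [->|j'0]; first by rewrite /C /W take0 !big_nil mul0r mulr0.
    case: best => [jz|[k [k0 kj n24 [E11 E12 mk]]]]; first by move: jj'; rewrite jz leqn0 => /eqP jz'; rewrite jz' in j'0.
    have j0 : (0 < j)%N by apply: leq_trans j'0 jj'.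
    have h2 : W k * C j.+1 < W j.+1 * C k by move: H; rewrite j0 /= negbK E11 E12.
    have h1 := mk _ jj'.
    rewrite -(ler_pM2r (C0 _ k0)).
    have h3 : W j' * C k * C j.+1 <= W k * C j' * C j.+1 by rewrite ler_pM2r // C0.
    have h4 : W k * C j.+1 * C j' <= W j.+1 * C k * C j' by rewrite ler_pM2r ?C0 // ltW.
    by lra.
  move=> s1 fr [E9 E10 [|[k [k0 kD n24 [E11 E12 mk]]]]]; first by move=> D1; rewrite D1 in D0.
  exists k; split=> //; first by move: kD; rewrite szD; lia.
  split=> // j; case: (leqP j (size D)) => jD; first exact: mk.
  by have := mk _ (leqnn (size D)); rewrite /C /W take_size (take_oversize (ltnW jD)).
rewrite szD; move: (size L) => z; lia.
Qed.

Lemma label_run s L wt p t top :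
  uniq L -> (forall x : E, rarr s 0 x = c x) -> nvar s 12 = t -> narr s 11 t = p ->
  nvar s 11 = size L -> list_at s p L wt -> (forall i, (i < size L)%N -> (top <= p + i)%N) ->
  runs label_cmd s (5 + size L * (20 + 20 * size L)) (fun s' =>
    exists lam, [/\ envelope c wt lam L, label_at s' p L lam & same_below top s s']).
Proof.
move=> uL c0 tE pE dE La tople; eapply runs_le.
  apply: runs_seq; apply: runs_nset => /=.
  apply: (runs_for_const (m := size L) (I := fun i s1 => exists kend lab,
    [/\ [/\ nvar s1 24 = kend, (i <= kend)%N & (kend <= size L)%N],
        (forall k x, (k < i)%N -> 0 < rarr s1 7 (p + k)%N /\
           rarr s1 8 (p + k)%N = lab (nth x L k) * rarr s1 7 (p + k)%N),
        (forall k x, (i <= k < kend)%N -> 0 < rarr s1 11 0%N /\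
           rarr s1 12 0%N = lab (nth x L k) * rarr s1 11 0%N),
        (forall lam, {in take kend L, lam =1 lab} ->
           envelope c wt lam (drop kend L) -> envelope c wt lam L) &
        same_below top s s1])) => //=.
  - by move=> i s1 _ _ fr _; rewrite !(frame_v fr) //= dE.
  - by exists 0%N, wt; rewrite drop0; split=> // k x; rewrite leq0n.
  - move=> i s1 iL xi fr [kend [lab [[n24 ik kL] done pend env same]]].
    have c1 (x : E) : rarr s1 0 x = c x by rewrite (frame_r fr) //= c0.
    have t1 : nvar s1 12 = t by rewrite (frame_v fr).
    have p1 : narr s1 11 t = p by rewrite (frame_n fr).
    have d1 : nvar s1 11 = size L by rewrite (frame_v fr).
    have La1 : list_at s1 p L wt by move=> k x kl; rewrite (frame_n fr) // (frame_r fr) //; apply: La.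
    apply: runs_seq.
    apply: (@runs_imp _ _ _ _ _ (fun s2 => exists kend lab,
    [/\ [/\ nvar s2 24 = kend, (i < kend)%N & (kend <= size L)%N],
        (forall k x, (k < i)%N -> 0 < rarr s2 7 (p + k)%N /\
           rarr s2 8 (p + k)%N = lab (nth x L k) * rarr s2 7 (p + k)%N),
        (forall k x, (i <= k < kend)%N -> 0 < rarr s2 11 0%N /\
           rarr s2 12 0%N = lab (nth x L k) * rarr s2 11 0%N) &
        (forall lam, {in take kend L, lam =1 lab} ->
           envelope c wt lam (drop kend L) -> envelope c wt lam L)])).
    + apply: runs_if => /=; rewrite xi n24 => H; last first.
        by apply: runs_skip; exists kend, lab; split=> //; split=> //; rewrite ltn_neqAle H.
      apply: runs_imp; first exact: (scan_run c1 t1 p1 xi d1 iL La1).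
        exact: leqnn.
      move=> s2 fr2 [k]; set D := drop i L => -[k0 ikL n24' [E11 E12 mk]].
      have ki : kend = i by rewrite (eqP H).
      have szD : size D = (size L - i)%N by rewrite size_drop.
      set q := take k D in E11 E12 mk.
      have qpos : 0 < \sum_(x <- q) c x by apply: sum_take_gt0; rewrite // szD subn_gt0.
      set mu := (\sum_(x <- q) wt x) / (\sum_(x <- q) c x).
      have muE : \sum_(x <- q) wt x = mu * \sum_(x <- q) c x by rewrite /mu divfK // lt0r_neq0.
      have nq j x : (j < i)%N -> nth x L j \notin q.
        move=> ji; apply/negP => /mem_take; rewrite /D => /(nthP x)[j' j'L].
        move: j'L; rewrite -/D szD nth_drop => j'L /eqP; rewrite nth_uniq //; try lia.
      have yq j x : (i <= j < i + k)%N -> nth x L j \in q.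
        move=> /andP[ij jk]; apply/(nthP x); exists (j - i)%N.
          by rewrite size_takel ?szD ?leq_subRL ?(ltnW iL) // ltn_subLR.
        by rewrite nth_take ?nth_drop ?subnKC //; lia.
      exists (i + k)%N, (fun x => if x \in q then mu else lab x); split=> //.
      * by split=> //; lia.
      * by move=> j x ji; rewrite (negbTE (nq j x ji)) !(frame_r fr2) //; apply: done.
      * by move=> j x ij; rewrite yq // E11 E12 muE.
      move=> lam hlam henv.
      have Lq : take (i + k) L = take i L ++ q by rewrite takeD.
      apply: env; rewrite ki.
        move=> x xi'; rewrite hlam; last by rewrite Lq mem_cat xi'.
        by have /(nthP x)[j jt <-] := xi'; move: jt; rewrite size_takel ?(ltnW iL) // => jt;
           rewrite nth_take // (negbTE (nq j x jt)).
      have DE : D = q ++ drop (i + k) L by rewrite addnC -drop_drop cat_take_drop.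
      rewrite -/D DE; apply: (envelope_block c_gt0 (lam0 := mu)) => //.
      * by apply/eqP => q0; move: qpos; rewrite q0 big_nil ltxx.
      * by move=> x xq; rewrite hlam ?xq // Lq mem_cat xq orbT.
      * by move=> j; rewrite -DE -(ler_pM2r qpos) mulrAC -muE; apply: mk.
    + exact: leqnn.
    move=> s2 fr2 [kend' [lab' [[n24' ik' kL'] done' pend' env']]].
    have xi2 : nvar s2 14 = i by rewrite (frame_v fr2).
    have t2 : nvar s2 12 = t by rewrite (frame_v fr2).
    have p2 : narr s2 11 t = p by rewrite (frame_n fr2).
    apply: runs_seq; apply: runs_rwrite; apply: runs_rwrite.
    exists kend', lab'; rewrite /= t2 p2 xi2; split=> //.
    + move=> k x; rewrite eqn_add2l ltnS leq_eqVlt; case: eqP => [->|_ /= ki]; last exact: done'.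
      by move=> _; apply: pend'; rewrite leqnn.
    + by move=> k x /andP[ik2 kk]; apply: pend'; rewrite kk ltnW.
    move=> k kt /=; have tp := tople _ iL; have kn : (k == p + i)%N = false by lia.
    by rewrite kn (frame_n fr2 (a := 12)) // (frame_r fr2 (a := 6)) //
       (frame_r fr2 (a := 7)) // (frame_r fr2 (a := 8)) //; apply: same.
  move=> s1 fr [kend [lab [[n24 ik kL] done _ env same]]].
  exists lab; split=> //; apply: env => //.
  by rewrite drop_oversize //; apply: envelope_nil.
set K := (_ + 3)%N; change (5 + size L * K <= 5 + size L * (20 + 20 * size L))%N.
rewrite leq_add2l leq_mul2l; apply/orP; right; rewrite /K.
by move: (size L) => z; lia.
Qed.

Lemma copy_run s L wt p t :
  nvar s 12 = t -> narr s 11 t = p -> nvar s 11 = size L -> list_at s p L wt ->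
  runs copy_cmd s (3 + 4 * size L)
    (fun s' => forall i x, (i < size L)%N -> narr s' 1 i = nth x L i).
Proof.
move=> tE pE dE La; eapply runs_le.
  apply: (runs_for_const (m := size L) (I := fun i s1 => forall k x, (k < i)%N ->
    narr s1 1 k = nth x L k)) => //=.
  - by move=> i s1 _ _ fr _; rewrite !(frame_v fr) //= dE.
  - move=> i s1 iL xi fr I1.
    have t1 : nvar s1 12 = t by rewrite (frame_v fr).
    have p1 : narr s1 11 t = p by rewrite (frame_n fr).
    have q1 : narr s1 12 = narr s 12 by rewrite (frame_n fr).
    apply: runs_nwrite => k x /=; rewrite xi t1 p1 q1 ltnS leq_eqVlt.
    case: eqP => [->|_ /= ki]; last exact: I1.
    by move=> _; have [-> _] := La _ x iL.
by lia.
Qed.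

End Labels.

Definition process_cmd (l : nat) : cmd :=
  CSeq (touch_cmd l) (CSeq reward_cmd (CSeq (CNWrite 10 (NVar 12) (NVar 11))
  (CSeq (edges_cmd l) (CSeq label_cmd copy_cmd)))).

Definition rounds_cmd (l : nat) : cmd :=
  CFor 11 (NVar 0) (CFor 12 (NVar 1)
    (CSeq (count_cmd l) (CIf (BNEq (NVar 13) (NVar 11)) (process_cmd l) CSkip))).

Definition main_cmd (l : nat) : cmd :=
  CSeq (pow_cmd l) (CSeq tables_cmd (CSeq sides_cmd (rounds_cmd l))).

(* Each of the [N] codes is expensive in at most one of the [n] rounds. *)
Lemma amortized_sum (n N P K : nat) (f : nat -> nat) :
  (\sum_(d < n) (3 + \sum_(t < N) (K + (f t == d) * P + 3) + 3) <=
   n * (6 + N * (K + 3)) + N * P)%N.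
Proof.
have E d : (\sum_(t < N) (K + (f t == d) * P + 3) = N * (K + 3) + \sum_(t < N) (f t == d) * P)%N.
  under eq_bigr => t _ do rewrite addnAC.
  by rewrite big_split /= sum_nat_const card_ord.
under eq_bigr => d _ do rewrite E addnA addnAC.
rewrite big_split /= sum_nat_const card_ord; apply: leq_add.
  by rewrite leq_mul2l; apply/orP; right; lia.
rewrite exchange_big /= -[N in (_ <= N * _)%N]card_ord -sum_nat_const; apply: leq_sum => t _.
rewrite -big_distrl /= -[leqRHS]mul1n leq_mul2r; apply/orP; right.
rewrite (eq_bigr (fun d : 'I_n => if f t == d then 1%N else 0%N)); last by move=> d _; case: eqP.
rewrite -big_mkcond /= sum1_card; apply/card_le1_eqP => d d' /eqP E1 /eqP E2.
by apply: val_inj; rewrite /= -E1 -E2.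
Qed.

Section Main.
Variables (R : realType) (n l : nat) (ends : 'I_n.-1 -> 'I_n * 'I_n).
Variables (c : 'I_n.-1 -> R) (w : 'I_n -> 'I_n -> R).
Hypothesis tree : is_tree ends.
Hypothesis l_gt0 : (0 < l)%N.
Hypothesis c_gt0 : forall e, 0 < c e.
Hypothesis w_ge0 : forall u v, 0 <= w u v.
Notation E := 'I_n.-1.
Notation V := 'I_n.
Notation env := (env l ends c w).
Notation tspan := (tspan l tree).
Notation rew := (reward ends w).
Notation entry := (entry l c w tree).

Lemma opt_ordering_of_last (A : {set E}) L wt :
  ordering A L -> increments rew set0 wt L ->
  (forall r' w' (e' : E), ordering A (rcons r' e') -> increments rew set0 w' (rcons r' e') ->
    wcost c wt L <= wcost c w' (rcons r' e')) -> opt_ordering c rew A L.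
Proof.
move=> oL iL mL; split=> // r' or'.
have [w' iw'] : exists w', increments rew set0 w' r'.
  by apply: increments_exist; case: or'.
have szr := ordering_size oL; rewrite -(ordering_size or') in szr.
case: (lastP r') or' iw' szr => [|r'' e'] o' i' szr; first by rewrite (size0nil szr).
have := mL _ _ _ o' i'; rewrite (ordering_wcost c oL iL) (ordering_wcost c o' i').
by rewrite lerD2l.
Qed.

Lemma edges_run s t top :
  env s -> nvar s 12 = t -> (t < n ^ l)%N ->
  nvar s 11 = #|tspan t| -> nvar s 22 = top -> rarr s 2 0 = rew (tspan t) ->
  (forall t', (t' < n ^ l)%N -> (#|tspan t'| < #|tspan t|)%N -> entry s t') ->
  runs (edges_cmd l) s (100 * n ^ 2) (fun s' => [/\ same_below top s s', (top <= nvar s' 22)%N,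
     (forall t', t' != t -> narr s' 11 t' = narr s 11 t') & exists L wt,
     [/\ opt_ordering c rew (tspan t) L, increments rew set0 wt L, list_at s' (narr s' 11 t) L wt,
         below (nvar s' 22) (narr s' 11 t) L &
         forall i, (i < size L)%N -> (top <= narr s' 11 t + i)%N]]).
Proof.
move=> es tE tl dE topE rE ent; set A := tspan t in dE rE ent *.
eapply runs_le.
  apply: runs_seq; apply: runs_nset => /=.
  apply: (runs_for_const (m := n.-1) (I := fun i s1 =>
    [/\ same_below top s s1, (top <= nvar s1 22)%N,
     (forall t', t' != t -> narr s1 11 t' = narr s 11 t') & best_inv l c w tree s1 t i top])) => //=.
  - by move=> i s1 _ _ fr _; rewrite (frame_v fr) //= (env_n es) subn1.
  - by split; rewrite ?topE //; left.
  - move=> i s1 im xi fr [sb1 top1 p1 best].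
    have es1 : env s1 by apply: env_frame fr _ _ => //; apply: (env_set es).
    have t1 : nvar s1 12 = t by rewrite (frame_v fr).
    have d1 : nvar s1 11 = #|A| by rewrite (frame_v fr).
    have r1 : rarr s1 2 0 = rew A by rewrite (frame_r fr).
    have n10 : narr s1 10 = narr s 10 by rewrite (frame_n fr).
    have ent1 t' : (t' < n ^ l)%N -> (#|tspan t'| < #|A|)%N -> entry s1 t'.
      move=> tl' ct'; have tt' : t' != t by apply: contraTneq ct' => ->; rewrite ltnn.
      by apply: (entry_same sb1 topE top1 _ (p1 _ tt') (ent _ tl' ct')); rewrite n10.
    pose e : E := Ordinal im.
    rewrite -/(span_test l); apply: runs_if.
      rewrite (span_test_eval tree l_gt0 es1 (e := e) xi t1 tl) => eA.
      apply: (merge_phase (e := e) l_gt0 c_gt0 w_ge0 es1 t1 tl xi eA d1 erefl r1 ent1).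
      move=> s2 fr2 mrg.
      have es2 : env s2 by apply: env_frame fr2 _ _.
      apply: runs_imp.
      + apply: (finish_run (s0 := s1) (top0 := top) (t := t) (e := e) es2 _ _ _ _ top1 eA _ _ _ erefl mrg best);
          by rewrite ?(frame_v fr2) ?(frame_r fr2) ?(frame_n fr2).
      + exact: leqnn.
      move=> s3 fr3 [best3 sb3 top3 p3]; split.
      + exact: same_below_trans top1 sb1 sb3.
      + exact: leq_trans top1 top3.
      + by move=> t' tt' /=; rewrite p3 // p1.
      exact: best3.
    rewrite (span_test_eval tree l_gt0 es1 (e := e) xi t1 tl) => eA.
    apply: runs_skip; split=> //.
    case: best => [[h none]|[h [L [wt [o i0 La [b tp bE mm]]]]]].
      left; split=> // e' e'A; rewrite ltn_neqAle none // andbT.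
      apply: contraNneq eA => ei; suff -> : e = e' by [].
      exact: val_inj.
    right; split=> //; exists L, wt; split=> //; split=> // r' w' e'.
    rewrite ltnS leq_eqVlt => /orP[/eqP ei|]; last exact: mm.
    move=> [_ eqA] _; case/negP: eA; have -> : e = e' by apply: val_inj.
    by rewrite -eqA inE mem_rcons inE eqxx.
  move=> s1 fr [sb1 top1 p1 best]; split=> //.
  case: best => [[h none]|[h [L [wt [o i0 La [b tp bE mm]]]]]]; last first.
    exists L, wt; split=> //; last by move=> i _; apply: leq_trans tp (leq_addr _ _).
    by apply: (opt_ordering_of_last o i0) => r' w' e'; apply: mm.
  have A0 : tspan t = set0.
    apply/setP => e; rewrite in_set0; apply/negP => /none.
    by rewrite leqNgt ltn_ord.
  exists [::], (fun _ => 0); split=> //.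
  have o0 : ordering (tspan t) [::] by rewrite A0; split=> //; apply/setP => x; rewrite !inE.
  apply: (opt_ordering_of_last (wt := fun _ => 0) o0) => // r' w' e' o'.
  by have := ordering_size o'; rewrite -(ordering_size o0) size_rcons.
have := leq_pred n; have := tree_gt0 tree; rewrite expnS expn1 => n0 mn.
have mnn : (n.-1 * n <= n * n)%N by rewrite leq_mul2r mn orbT.
nia.
Qed.

Lemma process_run s t :
  env s -> nvar s 12 = t -> (t < n ^ l)%N -> nvar s 11 = #|tspan t| ->
  (forall t', (t' < n ^ l)%N -> (#|tspan t'| < #|tspan t|)%N -> entry s t') ->
  runs (process_cmd l) s (400 * n ^ 2) (fun s' => [/\ entry s' t,
     (forall t', t' != t -> entry s t' -> entry s' t') &
     exists r, opt_ordering c rew (tspan t) r /\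
       forall i x, (i < size r)%N -> narr s' 1 i = nth x r i]).
Proof.
move=> es tE tl dE ent; set A := tspan t in dE ent *.
have Asz : (#|A| <= n.-1)%N by rewrite -[X in (_ <= X)%N]card_ord max_card.
set top := nvar s 22.
eapply runs_le.
  apply: runs_seq; apply: runs_imp; [exact: (touch_run tree l_gt0 es tE tl)|exact: leqnn|].
  move=> s1 fr1 tch.
  have es1 : env s1 by apply: env_frame fr1 _ es.
  apply: runs_seq; apply: runs_imp; [exact: (reward_run tree l_gt0 es1 tch)|exact: leqnn|].
  move=> s2 fr2 r2.
  have es2 : env s2 by apply: env_frame fr2 _ es1.
  have fr12 := frame_seq fr1 fr2.
  apply: runs_seq; apply: runs_nwrite; set s3 := State _ _ _.
  have n3 a : a != 10%N -> a != 9%N -> narr s3 a = narr s a.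
    by move=> a10 a9; rewrite /= (negbTE a10) (frame_n fr12) //= !inE !(negbTE a9).
  have es3 : env s3 by apply: (env_set es2).
  have t3 : nvar s3 12 = t by rewrite /= (frame_v fr12).
  have d3 : nvar s3 11 = #|A| by rewrite /= (frame_v fr12).
  have top3 : nvar s3 22 = top by rewrite /= (frame_v fr12).
  have sz3 t' : narr s3 10 t' = if t' == t then #|A| else narr s 10 t'.
    by rewrite /= !(frame_v fr12) // tE dE (frame_n fr12).
  have sb3 : same_below top s s3.
    by move=> k kt; rewrite n3 // /s3 /= !(frame_r fr12).
  have ent3 t' : t' != t -> entry s t' -> entry s3 t'.
    move=> tt' et'; apply: (entry_same sb3 erefl _ _ _ et').
    - by rewrite top3.
    - by rewrite sz3 (negbTE tt').
    by rewrite n3.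
  have lowt t' : (#|tspan t'| < #|A|)%N -> t' != t.
    by move=> ct'; apply: contraTneq ct' => ->; rewrite ltnn.
  apply: runs_seq; apply: runs_imp.
  - apply: (edges_run es3 t3 tl d3 top3 r2) => t' tl' ct'.
    by apply: ent3; [exact: lowt|exact: ent].
  - exact: leqnn.
  move=> s4 fr4 [sb4 top4 p4 [L [wt [oL iL La bL tL]]]].
  have [oL' _] := oL; have szL := ordering_size oL'.
  have es4 : env s4 by apply: env_frame fr4 _ es3.
  have t4 : nvar s4 12 = t by rewrite (frame_v fr4).
  have d4 : nvar s4 11 = size L by rewrite (frame_v fr4) // d3 szL.
  apply: runs_seq; apply: runs_imp.
  - by apply: (label_run (top := top) c_gt0 _ (env_c es4) t4 erefl d4 La tL); case: oL'.
  - have Ln : (size L <= n)%N by rewrite szL; apply: leq_trans Asz (leq_pred n).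
    have LB : (5 + size L * (20 + 20 * size L) <= 5 + n * (20 + 20 * n))%N.
      by rewrite leq_add2l leq_mul // leq_add2l leq_mul2l Ln orbT.
    exact: LB.
  move=> s5 fr5 [lam [eL LL sb5]].
  have t5 : nvar s5 12 = t by rewrite (frame_v fr5).
  have d5 : nvar s5 11 = size L by rewrite (frame_v fr5).
  have p5 : narr s5 11 = narr s4 11 by rewrite (frame_n fr5).
  have La5 : list_at s5 (narr s5 11 t) L wt.
    by move=> i x iL'; rewrite (frame_n fr5) // (frame_n fr5) // (frame_r fr5) //; apply: La.
  apply: runs_imp; first exact: (copy_run t5 erefl d5 La5).
  - have LB : (3 + 4 * size L <= 3 + 4 * n)%N.
      by rewrite leq_add2l leq_mul2l szL (leq_trans Asz (leq_pred n)) orbT.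
    exact: LB.
  move=> s6 fr6 out.
  have top6 : nvar s6 22 = nvar s4 22 by rewrite (frame_v fr6) // (frame_v fr5).
  have fr46 := frame_seq fr5 fr6.
  have sz6 : narr s6 10 = narr s3 10 by rewrite (frame_n fr46) // (frame_n fr4).
  have p6 : narr s6 11 = narr s4 11 by rewrite (frame_n fr46).
  have sb6 : same_below top s s6.
    apply: (same_below_trans (leqnn top) sb3); apply: (same_below_trans (leqnn top) sb4).
    apply: (same_below_trans (leqnn top) sb5) => k kt.
    by rewrite (frame_n fr6) // !(frame_r fr6).
  split.
  - exists L, wt, lam; split=> //; split.
    + by rewrite sz6 sz3 eqxx szL.
    + by rewrite top6 p6.
    + by move=> i x iL'; rewrite p6 (frame_n fr6 (a := 12)) // (frame_r fr6) // -p5; apply: La5.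
    by move=> i x iL'; rewrite p6 !(frame_r fr6) //; apply: LL.
  - move=> t' tt' et'; apply: (entry_same sb6 erefl _ _ _ et').
    + by rewrite top6.
    + by rewrite sz6 sz3 (negbTE tt').
    by rewrite p6 p4 // n3.
  exists L; split=> // i x iL'; exact: out.
have n0 := tree_gt0 tree; rewrite expnS expn1.
have nn : (n <= n * n)%N by rewrite leq_pmulr.
by rewrite mulnDr [(n * (20 * n))%N]mulnCA; lia.
Qed.

(* The output array always holds the latest ordering found. *)
Definition last_round (s : state R) (d : nat) := exists (A : {set E}) r,
  [/\ #|A| = d, opt_ordering c rew A r & forall i x, (i < size r)%N -> narr s 1 i = nth x r i].

Lemma rounds_run s : env s ->
  (exists t, (t < n ^ l)%N /\ #|tspan t| = n.-1) ->
  runs (rounds_cmd l) s (500 * n ^ (l + 2)) (fun s' => exists r,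
    opt_ordering c rew setT r /\ forall i x, (i < size r)%N -> narr s' 1 i = nth x r i).
Proof.
move=> es [tT [tTl ctT]]; have n0 := tree_gt0 tree.
pose P := (400 * n ^ 2)%N.
pose B d t := (8 + 7 * n + (#|tspan t| == d) * P)%N.
eapply runs_le.
  apply: (runs_for (m := n) (B := fun d => (3 + \sum_(t < n ^ l) (B d t + 3))%N) (I := fun d s1 =>
    (forall t', (t' < n ^ l)%N -> (#|tspan t'| < d)%N -> entry s1 t') /\
    ((0 < d)%N -> (exists t', (t' < n ^ l)%N /\ #|tspan t'| = d.-1) -> last_round s1 d.-1))) => //=.
  - by move=> d s1 _ _ fr _; rewrite (frame_v fr) //= (env_n es).
  - move=> d s1 dn xd fr [ent1 _].
    have es1 : env s1 by apply: env_frame fr _ _ => //; apply: (env_set es).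
    apply: (runs_for (m := (n ^ l)%N) (B := B d) (I := fun t s2 =>
      (forall t', (t' < n ^ l)%N -> (#|tspan t'| < d)%N || ((#|tspan t'| == d) && (t' < t)%N) -> entry s2 t') /\
      ((exists t', [/\ (t' < t)%N, (t' < n ^ l)%N & #|tspan t'| = d]) -> last_round s2 d))) => //=.
    + by move=> t s2 _ _ fr2 _; rewrite (frame_v fr2) //= (env_N es1).
    + split; last by move=> [t' []].
      by move=> t' tl'; rewrite ltn0 andbF orbF; apply: ent1.
    + move=> t s2 tl xt fr2 [ent2 out2].
      have es2 : env s2 by apply: env_frame fr2 _ _ => //; apply: (env_set es1).
      have d2 : nvar s2 11 = d by rewrite (frame_v fr2).
      have splitS t' : ((#|tspan t'| < d)%N || ((#|tspan t'| == d) && (t' < t.+1)%N)) ->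
          ((#|tspan t'| < d)%N || ((#|tspan t'| == d) && (t' < t)%N)) \/ (t' = t /\ #|tspan t| = d).
        case/orP => [->|/andP[cd]]; first by left.
        rewrite ltnS leq_eqVlt => /orP[/eqP tt'|->]; last by rewrite cd orbT; left.
        by right; rewrite -tt'; split=> //; apply/eqP.
      case: (eqVneq #|tspan t| d) => ctd.
        apply: (@runs_le _ _ _ ((5 + 7 * n) + P.+1).+1); last by rewrite /B ctd eqxx; lia.
        apply: runs_seq; apply: runs_imp; [exact: (count_run tree l_gt0 es2 xt tl)|exact: leqnn|].
        move=> s3 fr3 cnt.
        have es3 : env s3 by apply: env_frame fr3 _ es2.
        have t3 : nvar s3 12 = t by rewrite (frame_v fr3).
        have d3 : nvar s3 11 = d by rewrite (frame_v fr3).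
        have sb3 : same_below (nvar s2 22) s2 s3.
          by move=> k _; rewrite (frame_n fr3) // !(frame_r fr3).
        have ent3 t' : entry s2 t' -> entry s3 t'.
          move=> et'; apply: (entry_same sb3 erefl _ _ _ et');
            by rewrite ?(frame_v fr3) ?(frame_n fr3).
        apply: runs_ifT; first by rewrite /= cnt d3 ctd.
        apply: runs_imp.
        * apply: (process_run es3 t3 tl); first by rewrite d3 ctd.
          by move=> t' tl' ct'; apply: ent3; apply: ent2 => //; rewrite -ctd ct'.
        * exact: leqnn.
        move=> s4 fr4 [et pres [r [or outr]]]; split.
          move=> t' tl' /splitS[ct'|[-> _]]; last exact: et.
          case: (eqVneq t' t) => [->|tt']; first exact: et.
          by apply: (pres _ tt'); apply: ent3; apply: ent2.
        by move=> _; exists (tspan t), r.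
      apply: (@runs_le _ _ _ ((5 + 7 * n) + 2).+1); last by rewrite /B (negbTE ctd); lia.
      apply: runs_seq; apply: runs_imp; [exact: (count_run tree l_gt0 es2 xt tl)|exact: leqnn|].
      move=> s3 fr3 cnt.
      have d3 : nvar s3 11 = d by rewrite (frame_v fr3).
      have sb3 : same_below (nvar s2 22) s2 s3.
        by move=> k _; rewrite (frame_n fr3) // !(frame_r fr3).
      have ent3 t' : entry s2 t' -> entry s3 t'.
        move=> et'; apply: (entry_same sb3 erefl _ _ _ et');
          by rewrite ?(frame_v fr3) ?(frame_n fr3).
      apply: runs_ifF; first by rewrite /= cnt d3.
      apply: runs_skip; split.
        move=> t' tl' /splitS[ct'|[_ ctd']]; first by apply: ent3; apply: ent2.
        by rewrite ctd' eqxx in ctd.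
      move=> [t' [tt' tl' ct']].
      have [|A [r [cA oA outA]]] := out2.
        exists t'; split=> //; move: tt'; rewrite ltnS leq_eqVlt => /orP[/eqP E|//].
        by rewrite -E ct' eqxx in ctd.
      by exists A, r; split=> // i x ir; rewrite /= (frame_n fr3) //; apply: outA.
    move=> s2 fr2 [ent2 out2]; split.
      move=> t' tl' ct'; apply: ent2 => //; rewrite tl' andbT orbC.
      by rewrite -leq_eqVlt -ltnS.
    move=> _ [t' [tl' ct']]; apply: out2; exists t'; split=> //.
  move=> s1 fr [_ out1]; have [|A [r [cA oA outA]]] := out1 n0; first by exists tT.
  exists r; split=> //; suff <- : A = setT by [].
  by apply/eqP; rewrite eqEcard subsetT cardsT card_ord cA leqnn.
have am := amortized_sum n (n ^ l) P (8 + 7 * n) (fun t => #|tspan t|).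
apply: (@leq_trans (3 + (n * (6 + n ^ l * (8 + 7 * n + 3)) + n ^ l * P))).
  by rewrite leq_add2l; exact: am.
rewrite /P addn2 !expnS expn0 muln1.
have N0 : (0 < n ^ l)%N by rewrite expn_gt0 n0.
move: (n ^ l)%N N0 => N N0.
have h1 : (n <= n * n)%N by rewrite leq_pmulr.
have h2 : (n * n <= n * (n * N))%N by rewrite leq_mul2l leq_pmulr ?orbT.
have h3 : (n * N <= n * (n * N))%N by rewrite leq_pmull.
nia.
Qed.
End Main.

Section Final.
Variables (R : realType) (n l : nat) (ends : 'I_n.-1 -> 'I_n * 'I_n).
Variables (c : 'I_n.-1 -> R) (w : 'I_n -> 'I_n -> R).
Hypothesis tree : is_tree ends.
Hypothesis l_gt0 : (0 < l)%N.
Hypothesis leaves : (nleaves ends <= l)%N.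
Hypothesis c_gt0 : forall e, 0 < c e.
Hypothesis w_ge0 : forall u v, 0 <= w u v.
Notation s0 := (init_state ends c w).

Lemma init_ends : ends_at ends s0.
Proof.
move=> e; rewrite /= addnn doubleK odd_double addn1 /= odd_double uphalf_double.
by rewrite !valK.
Qed.

Lemma init_c (e : 'I_n.-1) : rarr s0 0 e = c e.
Proof. by rewrite /= valK. Qed.

Lemma init_w (a b : 'I_n) : rarr s0 1 (a * n + b) = w a b.
Proof.
have n0 := tree_gt0 tree.
by rewrite /= divnMDl // divn_small // addn0 modnMDl modn_small // !valK.
Qed.

Lemma full_tuple : exists t, (t < n ^ l)%N /\ #|tspan l tree t| = n.-1.
Proof.
have n0 := tree_gt0 tree.
case: (leqP n 1) => n1.
  have n_eq : n.-1 = 0%N by lia.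
  exists 0%N; split; first by rewrite expn_gt0 n0.
  have : (#|tspan l tree 0| <= n.-1)%N by rewrite -[X in (_ <= X)%N]card_ord max_card.
  by move: #|_| => k; lia.
have [us [usl usT]] := span_full tree n1 leaves.
exists (code us); rewrite -{1}usl code_lt; split=> //.
by rewrite /tspan -{1}usl decode_code usT cardsT card_ord.
Qed.

Lemma main_run : runs (main_cmd l) s0 ((1000 + 20 * l) * n ^ (l + 2)) (fun s' => exists r,
    opt_ordering c (reward ends w) setT r /\ forall i x, (i < size r)%N -> narr s' 1 i = nth x r i).
Proof.
have n0 := tree_gt0 tree.
eapply runs_le.
  apply: runs_seq; apply: runs_imp; [by apply: (@pow_run R n l)|exact: leqnn|].
  move=> s1 fr1 N1.
  have n1 : nvar s1 0 = n by rewrite (frame_v fr1).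
  apply: runs_seq; apply: runs_imp; [exact: (tables_run n0 n1 N1)|exact: leqnn|].
  move=> s2 fr2 T2.
  have fr12 := frame_seq fr1 fr2.
  have n2 : nvar s2 0 = n by rewrite (frame_v fr12).
  have e2 : ends_at ends s2 by move=> e; rewrite (frame_n fr12) //; apply: init_ends.
  apply: runs_seq; apply: runs_imp.
  - by apply: (sides_run n0 l_gt0 n2 e2) => k /T2[].
  - exact: leqnn.
  move=> s3 fr3 S3; have fr123 := frame_seq fr12 fr3.
  apply: rounds_run => //; last exact: full_tuple.
  split.
  - by rewrite (frame_v fr3).
  - by rewrite (frame_v fr3) // (frame_v fr2).
  - by move=> e; rewrite (frame_n fr3).
  - by move=> k kn; rewrite !(frame_n fr3) //; apply: T2.
  - move=> e v; have [-> -> ->] := S3 e v; rewrite {3}/proj side2 //.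
    by case: (side ends e v).
  - by move=> e; rewrite (frame_r fr123) // init_c.
  by move=> a b; rewrite (frame_r fr123) // init_w.
have h1 : (n ^ l <= n ^ (l + 2))%N by rewrite leq_pexp2l // leq_addr.
have h2 : (n ^ 3 <= n ^ (l + 2))%N by rewrite leq_pexp2l //; lia.
have h3 : (n <= n ^ (l + 2))%N by rewrite -{1}(expn1 n) leq_pexp2l //; lia.
have h4 : (1 <= n ^ (l + 2))%N by rewrite expn_gt0 n0.
move: (n ^ (l + 2))%N (n ^ l)%N (n ^ 3)%N h1 h2 h3 h4 => X Y Z h1 h2 h3 h4.
have h5 : (l * (4 * n + 12) <= l * (16 * X))%N by rewrite leq_mul2l; lia.
lia.
Qed.

End Final.

(* For every fixed l there is a program P (of the real-RAM while language of
   Defs.v) and a constant C such that on every instance of Problem A on a tree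
   with n vertices and at most l leaves, P halts within C * n^(l+2) steps and
   writes an optimal s-sequence (edge at position j in narr 1 j). *)
Theorem theorem2 (l : nat) :
  exists (P : cmd) (C : nat),
  forall (R : realType) (n : nat) (ends : 'I_n.-1 -> 'I_n * 'I_n)
         (c : 'I_n.-1 -> R) (w : 'I_n -> 'I_n -> R),
    is_tree ends ->
    (nleaves ends <= l)%N ->
    (forall e, 0 < c e) ->
    (forall u v, 0 <= w u v) ->
    (forall u v, w u v = w v u) ->
    (forall v, w v v = 0) ->
    exists (s' : state R) (k : nat),
      exec P (init_state ends c w) k s' /\
      (k <= C * n ^ (l + 2))%N /\
      exists sigma : {perm 'I_n.-1},
        (forall j : 'I_n.-1, narr s' 1 j = sigma j) /\ optimal ends c w sigma.
Proof.
case: l => [|l].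
  exists CSkip, 1%N => R n ends c w tree leaves _ _ _ _.
  have n1 : n = 1%N.
    have n0 := tree_gt0 tree; apply/eqP; rewrite eqn_leq n0 andbT leqNgt.
    by apply/negP => /(two_leaves tree) H; have := leq_trans H leaves.
  have no : 'I_n.-1 -> False by rewrite n1 => -[].
  exists (init_state ends c w), 1%N; split; first exact: ExSkip.
  split; first by rewrite n1.
  exists 1%g; split=> [j|sigma]; first by case: (no j).
  by have -> : sigma = 1%g by apply/permP => j; case: (no j).
exists (main_cmd l.+1), (1000 + 20 * l.+1)%N => R n ends c w tree leaves c_gt0 w_ge0 _ _.
have [s' [k [ex kB [r [opt out]]]]] := main_run tree (ltn0Sn l) leaves c_gt0 w_ge0.
exists s', k; split=> //; split=> //.
have [sigma [sr sopt]] := opt_ordering_optimal tree c_gt0 w_ge0 opt.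
exists sigma; split=> // j.
have szr : size r = n.-1 by rewrite -sr size_map size_enum_ord.
rewrite (out j j) ?szr // -sr (nth_map j) ?size_enum_ord //.
by rewrite nth_ord_enum.
Qed.
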